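(* Suppose that $\alpha_0,\dots,\alpha_{n-1}$ are the Verblunsky coefficients of an $n\times n$ unitary matrix with distinct eigenvalues $\{e^{i\lambda_k},1\le k\le n\}$. Let $b_0=0$ and define $$b_k=\mathcal P\begin{pmatrix}1&\bar\alpha_0\\\alpha_0&1\end{pmatrix}\cdots\begin{pmatrix}1&\bar\alpha_{k-1}\\\alpha_{k-1}&1\end{pmatrix}\begin{pmatrix}0\\1\end{pmatrix}\quad(1\le k\le n),\qquad b(t)=b_{\lfloor nt\rfloor},\ t\in[0,1].$$ Then $|b(t)|<1$ for $t\in[0,1)$ and $|b(1)|=1$. The Dirac operator $$\tau g=\frac{2}{1-|b|^2}\begin{pmatrix}1+|b|^2&2b\\2\bar b&1+|b|^2\end{pmatrix}\begin{pmatrix}-i&0\\0&i\end{pmatrix}g',\qquad t\in[0,1),$$ acting on functions $g:[0,1)\to\mathbb C^2$ with initial and end conditions $(1,1)^t$ and $(b(1),1)^t$ is self-adjoint on the domain described in the context. The spectrum of $\tau$ is the set $\{n\lambda_k+2\pi nj:\ 1\le k\le n,\ j\in\mathbb Z\}$.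
   Context: $\mathcal P(r_1,r_2)^t=r_1/r_2$. Verblunsky coefficients: let $V$ be an $n\times n$ unitary matrix with $n$ distinct eigenvalues and fix a unit vector $e$ not orthogonal to any eigenvector. Gram–Schmidt applied to $e,Ve,\dots,V^{n-1}e$ gives the orthogonal basis $\Phi_0(V)e,\dots,\Phi_{n-1}(V)e$ with $\Phi_0=1$ and $\Phi_k$ monic of degree $k$; put $\Phi_n(z)=\det(z-V)$ and $\Phi_k^*(z)=z^k\overline{\Phi_k(1/\bar z)}$. They satisfy the Szegő recursion $$\begin{pmatrix}\Phi_{k+1}\\\Phi_{k+1}^*\end{pmatrix}=\begin{pmatrix}1&-\bar\alpha_k\\-\alpha_k&1\end{pmatrix}\begin{pmatrix}z&0\\0&1\end{pmatrix}\begin{pmatrix}\Phi_k\\\Phi_k^*\end{pmatrix},\quad 0\le k\le n-1,$$ and the $\alpha_k$ are the Verblunsky coefficients; $|\alpha_k|<1$ for $k<n-1$, $|\alpha_{n-1}|=1$. Hilbert space and domain: the operator $\tau$ is the conjugate $\tilde U\sigma\tilde U^{-1}$, $\tilde U=\frac1{\sqrt2}\begin{pmatrix}1&-i\\1&i\end{pmatrix}$, of the operator $\sigma v=R^{-1}Jv'$ with $J=\begin{pmatrix}0&-1\\1&0\end{pmatrix}$, $R=\frac1{2y}\begin{pmatrix}1&-x\\-x&x^2+y^2\end{pmatrix}$, $\frac{x+iy-i}{x+iy+i}=b$. It acts in the Hilbert space of functions $g:[0,1)\to\mathbb C^2$ with inner product $\int_0^1g^*W h\,dt$, $W=\tilde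 UR\tilde U^*=\frac{1}{2(1-|b|^2)}\begin{pmatrix}1+|b|^2&-2b\\-2\bar b&1+|b|^2\end{pmatrix}$. The domain consists of the locally absolutely continuous $g$ with $g,\tau g$ in this Hilbert space, $g(0)\parallel(1,1)^t$ and $\lim_{t\to1}g(t)\parallel(b(1),1)^t$ (parallel over $\mathbb C$, the zero vector allowed). *)

(* Defs.v *)
From HB Require Import structures.
From mathcomp Require Import all_boot all_order all_algebra.
From mathcomp Require Import sesquilinear spectral complex.
From mathcomp Require Import all_classical all_reals all_analysis.

Set Implicit Arguments.
Unset Strict Implicit.
Unset Printing Implicit Defensive.

Import Order.TTheory GRing.Theory Num.Theory.
Import numFieldNormedType.Exports.

Local Open Scope classical_set_scope.
Local Open Scope ring_scope.
Local Open Scope sesquilinear_scope.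

Definition expi {R : realType} (x : R) : R[i] := (cos x +i* sin x)%C.

Section LinearAlgebra.
Context {R : realType}.
Local Notation C := R[i].

Definition hdot n (u v : 'cV[C]_n) : C := (u^t* *m v) 0 0.

Definition mx2 (a b c d : C) : 'M[C]_2 :=
  \matrix_(i, j) if i == 0 then (if j == 0 then a else b)
                 else (if j == 0 then c else d).

Definition cv2 (a b : C) : 'cV[C]_2 := \col_i if i == 0 then a else b.

Definition parallel (v w : 'cV[C]_2) : Prop := exists c : C, v = c *: w.

End LinearAlgebra.

Section Verblunsky.
Context {R : realType}.
Local Notation C := R[i].

Definition poly_act n (V : 'M[C]_n) (p : {poly C}) (e : 'cV[C]_n) : 'cV[C]_n :=
  \sum_(i < size p) p`_i *: (V ^+ i *m e).

(* z^k * conj (p (1 / conj z)), for p of degree at most k. *)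
Definition revpoly (k : nat) (p : {poly C}) : {poly C} :=
  \poly_(i < k.+1) (p`_(k - i))^*.

Lemma horner_revpoly (k : nat) (p : {poly C}) (z : C) :
  (size p <= k.+1)%N -> z != 0 ->
  (revpoly k p).[z] = z ^+ k * (p.[(z^*)^-1])^*.
Proof.
move=> sp z0; rewrite horner_poly (horner_coef_wide _ sp) rmorph_sum mulr_sumr.
rewrite (reindex_inj rev_ord_inj); apply: eq_bigr => i _ /=.
have ik : (i <= k)%N by rewrite -ltnS.
rewrite rmorphM rmorphXn fmorphV /= conjCK subSS subKn //.
by rewrite mulrCA exprVn expfB_cond ?(negPf z0).
Qed.

(* Gram-Schmidt applied to e, V e, .., V^(n-1) e: Phi_0 = 1, Phi_k is monic of
   degree k, and the vectors Phi_k(V) e with k < n are pairwise orthogonal;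
   moreover Phi_n = det (z - V). *)
Definition szego_polys n (V : 'M[C]_n) (e : 'cV[C]_n) (Phi : nat -> {poly C}) :=
  [/\ Phi 0%N = 1,
      forall k, (k < n)%N -> Phi k \is monic /\ size (Phi k) = k.+1,
      forall j k, (j < k < n)%N ->
        hdot (poly_act V (Phi j) e) (poly_act V (Phi k) e) = 0
    & Phi n = char_poly V].

Definition is_verblunsky n (V : 'M[C]_n) (e : 'cV[C]_n) (alpha : 'I_n -> C) :=
  exists2 Phi : nat -> {poly C}, szego_polys V e Phi &
    forall k : 'I_n,
      Phi k.+1 = 'X * Phi k - ((alpha k)^*)%:P * revpoly k (Phi k) /\
      revpoly k.+1 (Phi k.+1) =
        - (alpha k)%:P * ('X * Phi k) + revpoly k (Phi k).

Definition proj_ratio (r : 'cV[C]_2) : C := r 0 0 / r 1 0.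

(* The product is ordered by increasing j; for k = 0 it is the identity,
   whence bvertex alpha 0 = 0. *)
Definition bvertex n (alpha : 'I_n -> C) (k : nat) : C :=
  proj_ratio ((\prod_(j < n | (j < k)%N) mx2 1 ((alpha j)^*) (alpha j) 1)
              *m cv2 0 1).

Definition bpath n (alpha : 'I_n -> C) (t : R) : C :=
  bvertex alpha (Num.truncn (n%:R * t)).

End Verblunsky.

(* An unbounded operator in a space H of vectors, with inner product ip, is
   given by its graph G.  Elements of H at distance 0 are identified: the
   graphs below are saturated for this identification. *)
Section UnboundedOperators.
Context {R : realType} {E : lmodType R[i]}.
Variables (H : set E) (ip : E -> E -> R[i]).
Implicit Types G : set (E * E).

Definition hnorm (u : E) : R := Num.sqrt (complex.Re (ip u u)).

Definition densely_defined G :=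
  forall h, H h -> forall eps : R, 0 < eps ->
    exists2 p, G p & hnorm (h - p.1) < eps.

Definition adjoint G : set (E * E) :=
  [set q | [/\ H q.1, H q.2 & forall p, G p -> ip q.1 p.2 = ip q.2 p.1]].

(* Linearity, and single-valuedness up to distance 0, follow from
   adjoint G = G and the density of the domain. *)
Definition self_adjoint G := densely_defined G /\ adjoint G = G.

(* z such that the operator minus z is a bijection from its domain to H with
   bounded inverse. *)
Definition resolvent_set G : set R[i] :=
  [set z | [/\ forall h, H h ->
                 exists2 p, G p & hnorm (p.2 - z *: p.1 - h) = 0,
               forall p, G p -> hnorm (p.2 - z *: p.1) = 0 -> hnorm p.1 = 0
             & exists M : R, forall p, G p ->
                 hnorm p.1 <= M * hnorm (p.2 - z *: p.1)]].

Definition spectrum G : set R[i] := ~` resolvent_set G.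

End UnboundedOperators.

Section AbsoluteContinuity.
Context {R : realType}.

Definition abs_continuous (f : R -> R) (x y : R) : Prop :=
  forall eps : R, 0 < eps -> exists2 delta : R, 0 < delta &
    forall (m : nat) (u v : 'I_m -> R),
      (forall i, x <= u i /\ u i <= v i /\ v i <= y) ->
      trivIset setT (fun i => `]u i, v i[%classic) ->
      \sum_i (v i - u i) < delta ->
      \sum_i `|f (v i) - f (u i)| < eps.

(* absolute continuity on every compact subinterval of [0, 1) *)
Definition loc_abs_continuous (f : R -> R) : Prop :=
  forall c : R, 0 <= c < 1 -> abs_continuous f 0 c.

End AbsoluteContinuity.

(* Functions on [0, 1) are represented by functions on R whose values outside
   of [0, 1) are irrelevant. *)
Section Dirac.
Context {R : realType}.
Local Notation C := R[i].
Local Notation fct := (R -> 'cV[C]_2).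
Local Notation mu := (@lebesgue_measure R).
Local Notation I01 := (`[0, 1[%classic : set R).

Definition ae_eq01 (g h : fct) : Prop :=
  {ae mu, forall t, I01 t -> g t = h t}.

Definition re_coord (g : fct) (i : 'I_2) (t : R) : R := complex.Re (g t i 0).
Definition im_coord (g : fct) (i : 'I_2) (t : R) : R := complex.Im (g t i 0).

Definition deriv_fct (g : fct) : fct := fun t =>
  \col_i (derive1 (re_coord g i) t +i* derive1 (im_coord g i) t)%C.

Definition loc_ac_fct (g : fct) : Prop :=
  forall i, loc_abs_continuous (re_coord g i) /\
            loc_abs_continuous (im_coord g i).

Definition left_lim1 (g : fct) (l : 'cV[C]_2) : Prop :=
  forall i, re_coord g i t @[t --> 1^'-] --> complex.Re (l i 0) /\
            im_coord g i t @[t --> 1^'-] --> complex.Im (l i 0).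

Definition weight (b : C) : 'M[C]_2 :=
  (2 * (1 - `|b| ^+ 2))^-1 *:
    mx2 (1 + `|b| ^+ 2) (- 2 * b) (- 2 * b^*) (1 + `|b| ^+ 2).

Variable b : R -> C.

Definition wdot (g h : fct) (t : R) : C :=
  ((g t)^t* *m weight (b t) *m h t) 0 0.

Definition L2W : set fct :=
  [set g | (forall i, measurable_fun I01 (re_coord g i) /\
                      measurable_fun I01 (im_coord g i)) /\
           (\int[mu]_(t in I01) (complex.Re (wdot g g t))%:E < +oo)%E].

Definition ipW (g h : fct) : C :=
  ((\int[mu]_(t in I01) complex.Re (wdot g h t))%R +i*
   (\int[mu]_(t in I01) complex.Im (wdot g h t))%R)%C.

Definition tau (g : fct) : fct := fun t =>
  (2 / (1 - `|b t| ^+ 2)) *: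
    (mx2 (1 + `|b t| ^+ 2) (2 * b t) (2 * (b t)^*) (1 + `|b t| ^+ 2)
     *m mx2 (- 'i) 0 0 'i *m deriv_fct g t).

(* tau g is only determined almost everywhere; it belongs to the Hilbert space
   when it agrees almost everywhere with an element of L2W. *)
Definition dirac_domain : set fct :=
  [set g | [/\ loc_ac_fct g,
               L2W g,
               exists2 f, L2W f & ae_eq01 f (tau g),
               parallel (g 0) (cv2 1 1)
             & exists2 l, left_lim1 g l & parallel l (cv2 (b 1) 1)]].

(* The graph of g |-> tau g on dirac_domain, for classes of functions modulo
   almost everywhere equality. *)
Definition dirac_op : set (fct * fct) :=
  [set p | [/\ L2W p.1, L2W p.2 &
               exists2 g, dirac_domain g &
                 ae_eq01 p.1 g /\ ae_eq01 p.2 (tau g)]].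

End Dirac.

(* Main.v *)
(* On the k-th interval the equation tau g = z g reads g' = z D^-1 W g with a
   constant coefficient, D = diag(-i, i), so its fundamental matrix U_z is an
   explicit product of exponentials.  Variation of constants shows that tau - z
   is boundedly invertible unless U_z(1) (1,1)^t is parallel to (b(1),1)^t, in
   which case z is an eigenvalue.  Writing the vertices b_k with the products
   Q_k of the matrices [[1, conj alpha_j], [alpha_j, 1]], the k-th factor of
   U_z(1) is Q_k E Q_k^-1 with E proportional to diag(e^(iz/n), 1), and
   Q_(k+1)^-1 Q_k is proportional to the matrix of the Szego recursion.  Hence
   U_z(1) (1,1)^t satisfies the end condition iff det(e^(iz/n) - V) = 0.
   Lagrange's identity makes tau symmetric, and the invertibility of tau - i and
   tau + i upgrades this to self-adjointness.
   The bounds on alpha come from |Phi_(k+1)(V) e|^2 = (1 - |alpha_k|^2)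
   |Phi_k(V) e|^2, where Phi_k(V) e vanishes for k = n but not for k < n.
   A locally absolutely continuous function is the integral of its derivative
   because its variation defines a Stieltjes measure dominated by Lebesgue
   measure, to which the Radon-Nikodym theorem applies. *)
Require Import Defs.
From HB Require Import structures.
From mathcomp Require Import all_boot all_order all_algebra.
From mathcomp Require Import sesquilinear spectral complex.
From mathcomp Require Import all_classical all_reals all_analysis.
From mathcomp Require Import measurable_realfun ring lra.

Set Implicit Arguments.
Unset Strict Implicit.
Unset Printing Implicit Defensive.

Import Order.TTheory GRing.Theory Num.Theory.
Import numFieldNormedType.Exports.

Local Open Scope classical_set_scope.
Local Open Scope ring_scope.

(** * Densities of absolutely continuous functions *)

Section AbsoluteContinuityIntervals.
Context {R : realType}.
Implicit Types (f : R -> R) (p q : R * R) (s : seq (R * R)).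

(** Since [b] jumps, solutions are not classical: everything is stated for primitives of integrable
    functions, and identities between solutions come from expressions whose derivative vanishes
    almost everywhere. On [[0, 1)] the path takes finitely many values inside the disc, so the
    weight is uniformly comparable with the identity although [|b(1)| = 1], and the estimates reduce
    to ordinary L2. The last factor of the matrix product is singular because the last coefficient
    has modulus 1; hence the recursion is followed with invertible matrices up to the last step, and
    the end condition is evaluated by a separate computation that yields the first row of that step.
    The zeros of the resulting discriminant are real because the eigenvalues of [V] lie on the unit
    circle; this makes i and -i available before self-adjointness is known. Density of the domain is
    a separate matter: square integrable functions are approximated by Lipschitz functions vanishing
    at 0 and 1, which satisfy both boundary conditions. *)

Definition nonoverlap p q := (p.2 <= q.1) || (q.2 <= p.1).

Definition itv_within (a c : R) p := [&& a <= p.1, p.1 <= p.2 & p.2 <= c].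

Definition total_length s := \sum_(p <- s) (p.2 - p.1).

Definition total_increment f s := \sum_(p <- s) `|f p.2 - f p.1|.

(** Lists replace the indexed families of [abs_continuous]: they can be concatenated, and one
    interval can be exchanged for the pieces of a partition. *)
Definition ac_on f (a c : R) := forall eps : R, 0 < eps ->
  exists2 delta : R, 0 < delta & forall s, all (itv_within a c) s ->
    pairwise nonoverlap s -> total_length s < delta ->
    total_increment f s < eps.

Lemma abs_continuous_ac_on f a c : abs_continuous f a c -> ac_on f a c.
Proof.
move=> acf e e0; have [d d0 dP] := acf e e0; exists d => // s ins dis lens.
pose u (i : 'I_(size s)) := (nth (0, 0) s i).1.
pose v (i : 'I_(size s)) := (nth (0, 0) s i).2.
rewrite /total_increment (big_nth (0, 0)) big_mkord.
apply: (dP (size s) u v).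
- by move=> i; have /and3P[] := allP ins _ (mem_nth (0, 0) (ltn_ord i)).
- move=> i j _ _ [x []] /=; rewrite !in_itv /= => /andP[ux xv] /andP[uy yv].
  apply/val_inj/eqP; apply: contraT => /=.
  have key (k l : 'I_(size s)) : u k < x -> x < v k -> u l < x -> x < v l ->
      ~ (k < l)%N.
    move=> uk vk ul vl kl.
    have /(_ k l) := (pairwiseP (0, 0) dis).
    rewrite !inE => /(_ (ltn_ord k) (ltn_ord l) kl).
    rewrite /nonoverlap -/(u k) -/(v k) -/(u l) -/(v l).
    by move=> /orP[] /(lt_le_trans _); [move=> /(_ _ vk)|move=> /(_ _ vl)];
      move=> /lt_trans; [move=> /(_ _ ul)|move=> /(_ _ uk)]; rewrite ltxx.
  rewrite neq_ltn => /orP[] kl.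
    by case: (key i j ux xv uy yv kl).
  by case: (key j i uy yv ux xv kl).
- by move: lens; rewrite /total_length (big_nth (0, 0)) big_mkord.
Qed.

Lemma ac_on_sub f a c a' c' : a <= a' -> c' <= c -> ac_on f a c -> ac_on f a' c'.
Proof.
move=> aa cc acf e e0; have [d d0 dP] := acf e e0; exists d => // s /allP ins.
apply: dP; apply/allP => p /ins /and3P[p1 p2 p3]; apply/and3P; split => //.
- exact: le_trans p1.
- exact: le_trans cc.
Qed.

Definition pieces (a b : R) (l : seq R) : seq (R * R) := zip (a :: l) l.

Lemma piecesP a b l : itv_partition a b l ->
  [/\ all (itv_within a b) (pieces a b l), pairwise nonoverlap (pieces a b l),
      total_length (pieces a b l) = b - a &
      forall f, total_increment f (pieces a b l) = variation a b f l].
Proof.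
elim: l a => [|x l IH] a.
  move=> /itv_partition_nil ->; split => //.
    by rewrite /total_length big_nil subrr.
  by move=> f; rewrite /total_increment /variation !big_nil.
move=> abl; have xbl := itv_partition_cons abl.
have ax : a < x by case: abl => /= /andP[].
have xb := itv_partition_le xbl.
have [h1 h2 h3 h4] := IH _ xbl.
rewrite /pieces /= -/(pieces x b l); split.
- apply/andP; split; first by rewrite /itv_within /= lexx (ltW ax).
  apply: sub_all h1 => p /and3P[p1 p2 p3]; apply/and3P; split => //.
  exact: le_trans (ltW ax) p1.
- rewrite h2 andbT; apply/allP => p /(allP h1) /and3P[p1 p2 p3].
  by rewrite /nonoverlap /= p1.
- by rewrite /total_length big_cons -/(total_length _) h3 /=; lra.
- move=> f; rewrite /total_increment big_cons -/(total_increment f _) h4 /=.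
  by rewrite /variation /= [RHS]big_nat_recl.
Qed.

Lemma total_increment_cat f s s' :
  total_increment f (s ++ s') = total_increment f s + total_increment f s'.
Proof. by rewrite /total_increment big_cat. Qed.

Lemma total_length_cat s s' :
  total_length (s ++ s') = total_length s + total_length s'.
Proof. by rewrite /total_length big_cat. Qed.

Lemma itv_within_trans a c p q :
  itv_within a c p -> itv_within p.1 p.2 q -> itv_within a c q.
Proof.
move=> /and3P[p1 p2 p3] /and3P[q1 q2 q3]; apply/and3P; split => //.
- exact: le_trans q1.
- exact: le_trans p3.
Qed.

(* Replacing each total variation by the variation along a partition keeps the
   total length, so the bound passes to the suprema one interval at a time. *)
Lemma sum_total_variation_le f a c (eps delta : R) :
  (forall s, all (itv_within a c) s -> pairwise nonoverlap s ->
    total_length s < delta -> total_increment f s <= eps) ->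
  forall s s', all (itv_within a c) (s ++ s') -> pairwise nonoverlap (s ++ s') ->
    total_length (s ++ s') < delta ->
    (\sum_(p <- s) total_variation p.1 p.2 f + (total_increment f s')%:E <= eps%:E)%E.
Proof.
move=> H; elim => [|p s IH] s'.
  by move=> ? ? ?; rewrite big_nil add0e lee_fin; exact: H.
rewrite /= => /andP[pin ins] /andP[pdis dis] len.
have pE : p.1 <= p.2 by case/and3P: pin.
have sum0 : (0 <= \sum_(p0 <- s) total_variation p0.1 p0.2 f)%E.
  rewrite big_seq; apply: sume_ge0 => q qs; apply: total_variation_ge0.
  have qss : q \in s ++ s' by rewrite mem_cat qs.
  by case/and3P: (allP ins _ qss).
have len' : total_length (s ++ s') < delta.
  apply: le_lt_trans len; rewrite {2}/total_length big_cons -/(total_length _).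
  by rewrite lerDr subr_ge0.
have fin1 : (\sum_(p0 <- s) total_variation p0.1 p0.2 f)%E \is a fin_num.
  rewrite ge0_fin_numE//; have := IH s' ins dis len'.
  rewrite -leeBrDr// => /le_lt_trans; apply.
  by rewrite -EFinB ltry.
rewrite big_cons -addeA -leeBrDr; last by rewrite fin_numD fin1.
apply: ge_ereal_sup => _ [x [l pl <-] <-].
rewrite leeBrDr; last by rewrite fin_numD fin1.
have [h1 h2 h3 h4] := piecesP pl.
have := IH (pieces p.1 p.2 l ++ s').
rewrite total_increment_cat h4 EFinD addeCA; apply.
- move: ins; rewrite !all_cat => /andP[-> ->] /=; rewrite andbT.
  by apply: sub_all h1 => q; exact: itv_within_trans.
- move: dis; rewrite !pairwise_cat => /and3P[d1 d2 d3].
  rewrite d2 d3 h2 /= andbT.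
  have sub q r : q \in pieces p.1 p.2 l -> r \in s ++ s' -> nonoverlap q r.
    move=> /(allP h1) /and3P[q1 q2 q3] /(allP pdis); rewrite /nonoverlap.
    by move=> /orP[] h; apply/orP; [left|right];
      [exact: le_trans h|exact: le_trans q1].
  apply/andP; split.
    apply/allrelP => q r qs; rewrite mem_cat => /orP[rp|rs].
      rewrite /nonoverlap orbC; apply: sub => //.
      by rewrite mem_cat qs.
    by move/allrelP: d1; apply.
  by apply/allrelP => q r qs rs; apply: sub => //; rewrite mem_cat rs orbT.
- move: len; rewrite /total_length big_cons -/(total_length _).
  rewrite -!/(total_length _) !total_length_cat h3.
  by apply: le_lt_trans; lra.
Qed.

End AbsoluteContinuityIntervals.

Section AbsolutelyContinuousVariation.
Context {R : realType}.
Implicit Types (f : R -> R).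

(** For eps = 1 absolute continuity gives a length below which the variation is at most 1; finitely
    many intervals of such a length cover [[a, c]]. *)
Lemma ac_on_total_variation_fin f a c : a <= c -> ac_on f a c ->
  total_variation a c f \is a fin_num.
Proof.
move=> ac acf; have [d d0 dP] := acf 1 ltr01.
have small u v : a <= u -> u <= v -> v <= c -> v - u < d ->
    (total_variation u v f <= 1)%E.
  move=> au uv vc uvd.
  have H s : all (itv_within a c) s -> pairwise nonoverlap s ->
    total_length s < d -> total_increment f s <= 1.
    by move=> h1 h2 h3; apply/ltW/dP.
  have := sum_total_variation_le H (s := [:: (u, v)]) (s' := [::]).
  rewrite big_seq1 /= /total_increment big_nil adde0; apply => //.
    by rewrite /itv_within /= au uv vc.
  by rewrite /total_length big_seq1.
have [N Nd] : exists N : nat, (c - a) < N%:R * d.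
  exists (Num.bound ((c - a) / d)).
  rewrite -ltr_pdivrMr//; apply: le_lt_trans (archi_boundP _).
    by [].
  by apply: divr_ge0; [rewrite subr_ge0|exact: ltW].
have N0 : (0 < N)%N.
  by case: N Nd => //; rewrite mul0r subr_lt0 ltNge ac.
have N0R : 0 < N%:R :> R by rewrite ltr0n.
pose h := (c - a) / N%:R.
have h0 : 0 <= h by apply: divr_ge0; [rewrite subr_ge0|exact: ltW].
have hd : h < d by rewrite /h ltr_pdivrMr// mulrC.
have hN : a + N%:R * h = c by rewrite /h; field; rewrite gt_eqF.
have step k : (k <= N)%N -> (total_variation a (a + k%:R * h) f <= k%:R%:E)%E.
  elim: k => [|k IH] kN.
    by rewrite mul0r addr0 total_variationxx.
  have kh : 0 <= k%:R * h by rewrite mulr_ge0.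
  have kS : a + k.+1%:R * h = (a + k%:R * h) + h by rewrite -natr1; ring.
  have kc : a + k.+1%:R * h <= c by rewrite -hN lerD2l ler_wpM2r// ler_nat.
  rewrite (@total_variationD _ _ _ (a + k%:R * h)) ?lerDl//; last first.
    by rewrite kS lerDl.
  have -> : (k.+1%:R : R)%:E = (k%:R%:E + 1%:E)%E by rewrite -EFinD natr1.
  apply: leeD; first exact: IH (ltnW kN).
  apply: small => //; rewrite ?lerDl//; first by rewrite kS lerDl.
  by rewrite kS addrAC subrr add0r.
rewrite ge0_fin_numE ?total_variation_ge0// -hN.
by apply: le_lt_trans (step N (leqnn _)) _; rewrite ltry.
Qed.

Lemma total_variation_fin_sub f a u v c : a <= u -> u <= v -> v <= c ->
  ac_on f a c -> total_variation u v f \is a fin_num.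
Proof. by move=> au uv vc /(ac_on_sub au vc); apply: ac_on_total_variation_fin. Qed.

Lemma fine_total_variationD f a u v c : a <= u -> u <= v -> v <= c ->
  ac_on f a c ->
  fine (total_variation a v f) =
  fine (total_variation a u f) + fine (total_variation u v f).
Proof.
move=> au uv vc acf; rewrite (total_variationD f au uv) fineD//.
- by apply: total_variation_fin_sub acf => //; exact: le_trans vc.
- exact: total_variation_fin_sub acf.
Qed.

(** The variations over a list are suprema of increments over refinements of the same total length,
    so the modulus of [f] serves again; [e / 2] restores the strict inequality lost in the
    supremum. *)
Lemma ac_on_total_variation f a c : ac_on f a c ->
  ac_on (fun x => fine (total_variation a x f)) a c.
Proof.
move=> acf e e0; have e20 : 0 < e / 2 by rewrite divr_gt0.
have [d d0 dP] := acf _ e20.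
exists d => // s ins dis len.
have H s' : all (itv_within a c) s' -> pairwise nonoverlap s' ->
    total_length s' < d -> total_increment f s' <= e / 2.
  by move=> h1 h2 h3; apply/ltW/dP.
have := sum_total_variation_le H (s := s) (s' := [::]).
rewrite cats0 [total_increment f [::]]/total_increment big_nil adde0 => /(_ ins dis len) le.
apply: (@le_lt_trans _ _ (e / 2)); last by lra.
rewrite -lee_fin; apply: le_trans le.
rewrite /total_increment -sumEFin le_eqVlt; apply/orP; left; apply/eqP.
rewrite !big_seq; apply: eq_bigr => p ps.
have /and3P[p1 p2 p3] := allP ins _ ps.
rewrite (fine_total_variationD p1 p2 p3 acf) addrAC subrr add0r.
have fp := total_variation_fin_sub p1 p2 p3 acf.
by rewrite ger0_norm ?fineK// fine_ge0// total_variation_ge0.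
Qed.

Lemma ac_onB f g a c : ac_on f a c -> ac_on g a c -> ac_on (f \- g) a c.
Proof.
move=> acf acg e e0; have e20 : 0 < e / 2 by rewrite divr_gt0.
have [d d0 dP] := acf _ e20; have [d' d'0 d'P] := acg _ e20.
exists (Num.min d d'); first by rewrite lt_min d0.
move=> s ins dis; rewrite lt_min => /andP[h1 h2].
have := ltrD (dP _ ins dis h1) (d'P _ ins dis h2).
rewrite -splitr; apply: le_lt_trans.
rewrite /total_increment -big_split /=; apply: ler_sum => p _.
have -> : f p.2 - g p.2 - (f p.1 - g p.1) = (f p.2 - f p.1) - (g p.2 - g p.1).
  by ring.
exact: ler_normB.
Qed.

End AbsolutelyContinuousVariation.

(** * Domination of Stieltjes measures by Lebesgue measure *)

Section MonotoneDensity.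
Context {R : realType}.
Implicit Types (p q : R * R) (s t : seq (R * R)).

(** Removing [r] cuts [p] into a part left of [r.1] and a part right of [r.2], and the induction
    removes the rest of the list from each. Half-open intervals make the covering exact. *)
Lemma itv_minus_list s p : all (fun r => r.1 <= r.2) s -> p.1 <= p.2 ->
  exists t, [/\ all (itv_within p.1 p.2) t, pairwise nonoverlap t,
    allrel nonoverlap t s, total_length t <= p.2 - p.1 &
    forall x, p.1 < x <= p.2 -> has (fun r => r.1 < x <= r.2) (t ++ s)].
Proof.
elim: s p => [|r s IH] p.
  move=> _ p12; exists [:: p]; split => //=.
  - by rewrite /itv_within !lexx p12.
  - by rewrite /total_length big_seq1.
  - by move=> x ->.
move=> /= /andP[r12 sle] p12.
(* The part of [p] to the left of [r]; the min and max give its right end and collapse to [p.1] when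
   it is empty. *)
have [t1 [a1 b1 c1 d1 e1]] : exists t,
  [/\ all (itv_within p.1 (Num.min p.2 (Num.max p.1 r.1))) t, pairwise nonoverlap t,
    allrel nonoverlap t (r :: s), total_length t <= Num.min p.2 (Num.max p.1 r.1) - p.1 &
    forall x, p.1 < x <= p.2 -> x <= r.1 ->
       has (fun r => r.1 < x <= r.2) (t ++ s)].
  have [pr|rp] := ltP p.1 r.1; last first.
    exists [::]; split => //.
    - by rewrite /total_length big_nil min_r ?subrr.
    - by move=> x /andP[px _] /(lt_le_trans px); rewrite ltNge rp.
  have := IH (p.1, Num.min p.2 r.1) sle.
  rewrite /= le_min p12 (ltW pr) => /(_ isT) [t [ta tb tc td te]].
  exists t; split => //.
  - rewrite allrel_consr tc andbT; apply/allP => q /(allP ta) /and3P[_ _].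
    by rewrite le_min /nonoverlap => /andP[_ ->].
  - by move=> x /andP[px xp] xr; apply: te; rewrite px le_min xp.
have [t2 [a2 b2 c2 d2 e2]] : exists t,
  [/\ all (itv_within (Num.max p.1 (Num.min p.2 r.2)) p.2) t, pairwise nonoverlap t,
    allrel nonoverlap t (r :: s), total_length t <= p.2 - Num.max p.1 (Num.min p.2 r.2) &
    forall x, p.1 < x <= p.2 -> r.2 < x ->
       has (fun r => r.1 < x <= r.2) (t ++ s)].
  have [rp|pr] := ltP r.2 p.2; last first.
    exists [::]; split => //.
    - by rewrite /total_length big_nil max_r ?subrr.
    - by move=> x /andP[_ px] rx; move: (lt_le_trans rx px); rewrite ltNge pr.
  have := IH (Num.max p.1 r.2, p.2) sle.
  rewrite /= ge_max p12 (ltW rp) => /(_ isT) [t [ta tb tc td te]].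
  exists t; split => //.
  - rewrite allrel_consr tc andbT; apply/allP => q /(allP ta) /and3P[].
    by rewrite ge_max /nonoverlap orbC => /andP[_ ->].
  - by move=> x /andP[px xp] xr; apply: te; rewrite xp gt_max px xr.
(* The left part ends no later than the right part begins, which rests on [r.1 <= r.2]. *)
have mid : Num.min p.2 (Num.max p.1 r.1) <= Num.max p.1 (Num.min p.2 r.2).
  rewrite ge_min !le_max !ge_max !le_min.
  by case: (leP p.1 r.1) => ?; case: (leP p.2 r.2) => ?; apply/orP; lra.
exists (t1 ++ t2); split.
- rewrite all_cat; apply/andP; split.
    apply: sub_all a1 => q /and3P[q1 q2]; rewrite le_min => /andP[q3 _].
    by apply/and3P; split.
  apply: sub_all a2 => q /and3P[]; rewrite ge_max => /andP[q1 _] q2 q3.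
  by apply/and3P; split.
- rewrite pairwise_cat b1 b2 !andbT; apply/allrelP => q q' /(allP a1) /and3P[qa qb qc].
  move=> /(allP a2) /and3P[qa' qb' qc'].
  rewrite /nonoverlap; apply/orP; left.
  by apply: le_trans qc _; apply: le_trans qa'.
- by rewrite allrel_catl c1 c2.
- rewrite total_length_cat; apply: le_trans (lerD d1 d2) _.
  by move: mid; lra.
- move=> x px; rewrite -catA has_cat.
  have [xr|rx] := leP x r.1.
    have := e1 x px xr; rewrite !has_cat /= => /orP[] ->; rewrite ?orbT //.
  have [xr|rx'] := leP x r.2; first by rewrite has_cat /= rx xr !orbT.
  by have := e2 x px rx'; rewrite !has_cat /= => /orP[] ->; rewrite ?orbT.
Qed.

(** The intervals of a cover may overlap, whereas absolute continuity speaks of nonoverlapping lists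
    only; this rewrites a finite cover without increasing its length. *)
Lemma disjoint_cover s : all (fun r => r.1 <= r.2) s ->
  exists t, [/\ all (fun r => r.1 <= r.2) t, pairwise nonoverlap t,
    total_length t <= total_length s &
    forall x, has (fun r => r.1 < x <= r.2) s -> has (fun r => r.1 < x <= r.2) t].
Proof.
elim: s => [|p s IH]; first by exists [::].
move=> /= /andP[p12 /IH[t [ta tb tc td]]].
have [t' [ta' tb' tc' td' te']] := itv_minus_list ta p12.
exists (t' ++ t); split.
- rewrite all_cat ta andbT; apply: sub_all ta' => q /and3P[]//.
- by rewrite pairwise_cat tc' tb tb'.
- by rewrite total_length_cat [leRHS]/total_length big_cons; exact: lerD.
- by move=> x /orP[/te'//|/td xt]; rewrite has_cat xt orbT.
Qed.

(** A version on the whole line, since a Stieltjes measure is built from a function on all of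
    [R]. *)
Definition ac_line (f : R -> R) := forall eps : R, 0 < eps ->
  exists2 delta : R, 0 < delta & forall s, all (fun p => p.1 <= p.2) s ->
    pairwise nonoverlap s -> total_length s < delta ->
    total_increment f s < eps.

Local Open Scope ereal_scope.

Lemma stieltjes_itv (F : cumulative R R) (a b : R) : (a <= b)%R ->
  lebesgue_stieltjes_measure F `]a, b]%classic = (F b - F a)%:E.
Proof.
move=> ab; rewrite /lebesgue_stieltjes_measure /measure_extension.
rewrite measurable_mu_extE/=; last exact: is_ocitv.
by rewrite wlength_itv_bnd.
Qed.

Lemma stieltjes_list (F : cumulative R R) t : all (fun r => r.1 <= r.2)%R t ->
  lebesgue_stieltjes_measure F [set x | has (fun r => r.1 < x <= r.2)%R t] <=
  (total_increment F t)%:E.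
Proof.
elim: t => [|p t IH] /=.
  move=> _; rewrite (_ : [set _ | _] = set0); last by apply/seteqP; split.
  by rewrite measure0 /total_increment big_nil.
move=> /andP[p12 tle].
rewrite (_ : [set _ | _] = `]p.1, p.2]%classic `|`
  [set x | has (fun r => r.1 < x <= r.2)%R t]); last first.
  by apply/seteqP; split => x /=; rewrite in_itv /=;
    [move=> /orP[] ?; [left|right]|move=> [->//|->]; rewrite orbT].
have mt : measurable ([set x | has (fun r => r.1 < x <= r.2)%R t] : set R).
  rewrite (_ : [set _ | _] = \big[setU/set0]_(r <- t) `]r.1, r.2]%classic).
    by apply: bigsetU_measurable.
  apply/seteqP; split => x /=.
    move=> /hasP[r rt rx]; rewrite -bigcup_seq; exists r => //=.
  rewrite -bigcup_seq => -[r /= rt]; rewrite in_itv /= => rx.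
  by apply/hasP; exists r.
apply: le_trans (measureU2 _ _ _) _ => //.
rewrite /total_increment big_cons EFinD; apply: leeD; last exact: IH.
rewrite [X in X <= _](_ : _ = (F p.2 - F p.1)%:E); last exact: stieltjes_itv.
by rewrite lee_fin ler_norm.
Qed.

(** A Lebesgue null set has countable covers by half-open intervals of arbitrarily small total
    length. Finite subfamilies are made nonoverlapping, so absolute continuity bounds their
    Stieltjes measure, and continuity from below passes to the whole cover. *)
Lemma ac_stieltjes_dominates (F : cumulative R R) : ac_line F ->
  lebesgue_stieltjes_measure F `<< lebesgue_measure.
Proof.
move=> acF; apply/null_content_dominatesP => A mA A0.
apply/eqP; rewrite eq_le measure_ge0 andbT.
apply/lee_addgt0Pr => e e0; rewrite add0e.
have [d d0 dP] := acF e e0.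
have : lebesgue_measure A < d%:E by rewrite A0 lte_fin.
(* Unfolds Lebesgue measure as an infimum over countable covers by half-open intervals. *)
move=> /ereal_inf_lt[_ [B [mB AB] <-] Bd].
have [p pP] : {p : nat -> R * R & forall k, (p k).1 <= (p k).2 /\
    B k = `](p k).1, (p k).2]%classic}%R.
  apply: (@choice _ _ (fun k p => (p.1 <= p.2)%R /\ B k = `]p.1, p.2]%classic)) => k.
  have /ocitvP[->|[q q12 ->]] := mB k.
    exists (0%R, 0%R); split => //; apply/esym/set_itv_ge.
    by rewrite bnd_simp ltxx.
  by exists q; split => //; exact: ltW.
have mB' k : measurable (B k : set R) by rewrite (pP k).2.
have mBn n : measurable (\big[setU/set0]_(k < n) B k : set R).
  by apply: bigsetU_measurable => k _; exact: mB'.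
apply: (@le_trans _ _ (lebesgue_stieltjes_measure F (\bigcup_k B k))).
  apply: le_measure => //; rewrite inE//.
  by apply: bigcup_measurable => k _; exact: mB'.
have BE : \bigcup_n (\big[setU/set0]_(k < n) B k) = \bigcup_k B k.
  apply/seteqP; split => x.
    by move=> [n _]; rewrite -bigcup_mkord => -[k _ Bx]; exists k.
  by move=> [k _ Bx]; exists k.+1 => //; rewrite -bigcup_mkord; exists k => /=.
have cv : lebesgue_stieltjes_measure F (\big[setU/set0]_(k < n) B k)
   @[n --> \oo] --> lebesgue_stieltjes_measure F (\bigcup_k B k).
  rewrite -BE; apply: nondecreasing_cvg_mu.
  - exact: mBn.
  - by apply: bigcup_measurable => n _; exact: mBn.
  - by move=> n m nm; apply/subsetPset; exact: subset_bigsetU.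
rewrite -(cvg_lim _ cv)//; apply: lime_le; first by apply/cvg_ex; eexists; exact: cv.
apply: nearW => n.
pose s := [seq p k | k <- iota 0 n].
have sle : all (fun r => r.1 <= r.2)%R s.
  by apply/allP => _ /mapP[k _ ->]; exact: (pP k).1.
have [t [ta tb tc td]] := disjoint_cover sle.
apply: (@le_trans _ _ (lebesgue_stieltjes_measure F
   [set x | has (fun r => r.1 < x <= r.2)%R t])).
  apply: le_measure; rewrite ?inE.
  - exact: mBn.
  - rewrite (_ : [set _ | _] = \big[setU/set0]_(r <- t) `]r.1, r.2]%classic).
      by apply: bigsetU_measurable.
    apply/seteqP; split => x /=.
      move=> /hasP[r rt rx]; rewrite -bigcup_seq; exists r => //=.
    rewrite -bigcup_seq => -[r /= rt]; rewrite in_itv /= => rx.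
    by apply/hasP; exists r.
  - move=> x; rewrite -bigcup_mkord => -[k /= kn]; rewrite (pP k).2 /= in_itv /= => xk.
    apply: td; apply/hasP; exists (p k) => //.
    by apply/mapP; exists k => //; rewrite mem_iota.
apply: le_trans (stieltjes_list _ ta) _.
rewrite lee_fin; apply/ltW/dP => //; apply: le_lt_trans tc _.
rewrite -lte_fin; apply: le_lt_trans Bd.
rewrite /total_length big_map -sumEFin.
rewrite [leLHS](_ : _ = \sum_(k <- iota 0 n) wlength idfun (B k)); last first.
  by apply: eq_bigr => k _; rewrite (pP k).2 wlength_itv_bnd ?(pP k).1.
rewrite (_ : iota 0 n = index_iota 0 n); last by rewrite /index_iota subn0.
apply: nneseries_lim_ge => k _.
by move=> _; rewrite (pP k).2 wlength_itv_bnd ?lee_fin ?subr_ge0 (pP k).1.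
Qed.

End MonotoneDensity.

Section AbsolutelyContinuousDensity.
Context {R : realType}.
Implicit Types (f : R -> R) (p : R * R) (s : seq (R * R)).
Local Notation mu := (@lebesgue_measure R).

Definition clamp (a c x : R) := Num.max a (Num.min x c).

Lemma clamp_itv a c x : a <= c -> a <= clamp a c x <= c.
Proof. by move=> ac; rewrite /clamp le_max lexx ge_max ac ge_min lexx orbT. Qed.

Lemma clamp_id a c x : a <= x <= c -> clamp a c x = x.
Proof. by move=> /andP[ax xc]; rewrite /clamp min_l// max_r. Qed.

Lemma clamp_homo a c : {homo clamp a c : x y / x <= y}.
Proof.
move=> x y xy; rewrite /clamp ge_max le_max lexx /= le_max; apply/orP; right.
by rewrite le_min !ge_min xy lexx orbT.
Qed.

Lemma clamp_contract a c x y : a <= c -> x <= y ->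
  clamp a c y - clamp a c x <= y - x.
Proof.
move=> ac xy; rewrite /clamp.
by case: (leP x c) => ?; case: (leP y c) => ?;
  rewrite /Order.max; do !case: ifP => ?; lra.
Qed.

Lemma ac_line_clamp f a c : a <= c -> ac_on f a c -> ac_line (f \o clamp a c).
Proof.
move=> ac acf e e0; have [d d0 dP] := acf e e0; exists d => // s sle dis len.
pose s' := [seq (clamp a c p.1, clamp a c p.2) | p <- s].
have := dP s'; rewrite /total_increment big_map; apply.
- apply/allP => _ /mapP[p ps ->]; rewrite /itv_within /=.
  have /andP[-> _] := clamp_itv p.1 ac; have /andP[_ ->] := clamp_itv p.2 ac.
  by rewrite andbT /= clamp_homo// (allP sle).
- rewrite pairwise_map; apply: sub_pairwise dis => p q /orP[] h;
    apply/orP; [left|right]; exact: clamp_homo.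
- apply: le_lt_trans len; rewrite /total_length big_map !big_seq.
  by apply: ler_sum => p ps; apply: clamp_contract => //; exact: (allP sle).
Qed.

Lemma ac_line_right_continuous f : ac_line f -> right_continuous f.
Proof.
move=> acf x; apply/cvgrPdist_lt => e e0; have [d d0 dP] := acf e e0.
near=> y; have xy : x <= y by near: y; exact: nbhs_right_ge.
have := dP [:: (x, y)]; rewrite /total_increment /total_length !big_seq1 /=.
rewrite distrC; apply => //; first by rewrite xy.
rewrite ltrBlDl; near: y; apply: nbhs_right_lt.
by rewrite ltrDl.
Unshelve. all: by end_near. Qed.

(** Clamping extends [f] to the line, constant outside [[a, c]]. The Stieltjes measure of the
    extension, restricted to []a, c]], is finite and dominated by Lebesgue measure; [psi] is its
    Radon-Nikodym density. *)
Lemma nondecreasing_density f a c : a <= c -> ac_on f a c ->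
    (forall x y, a <= x -> x <= y -> y <= c -> f x <= f y) ->
  exists2 psi : R -> R, mu.-integrable setT (EFin \o psi) &
    forall x, a <= x <= c -> f x - f a = (\int[mu]_(t in `[a, x]) psi t)%R.
Proof.
move=> ac acf ndf; pose g := f \o clamp a c.
have acg : ac_line g := ac_line_clamp ac acf.
have ndg : nondecreasing g.
  move=> x y xy; apply: ndf; last by case/andP: (clamp_itv y ac).
    by case/andP: (clamp_itv x ac).
  exact: clamp_homo.
pose F : cumulative R R :=
  HB.pack g (isCumulative.Build R _ R g ndg (ac_line_right_continuous acg)).
pose LS := lebesgue_stieltjes_measure F.
have mac : measurable (`]a, c]%classic : set (measurableTypeR R)).
  exact: measurable_itv.
have LSE x : a <= x <= c -> LS `]a, x]%classic = (f x - f a)%:E.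
  move=> axc; rewrite /LS; have /andP[ax xc] := axc.
  rewrite stieltjes_itv//= /g /=; by rewrite !clamp_id ?axc ?lexx//.
have fin : (LS `]a, c]%classic < +oo)%E by rewrite LSE ?ac ?lexx// ltry.
pose nu : {finite_measure set (measurableTypeR R) -> \bar R} := mfrestr mac fin.
have dom : nu `<< mu.
  apply/null_content_dominatesP => A mA A0; apply/eqP.
  rewrite eq_le measure_ge0 andbT /nu /mfrestr /mrestr.
  have /null_content_dominatesP H := ac_stieltjes_dominates (F := F) acg.
  rewrite -[leRHS](H A mA A0); apply: le_measure; rewrite ?inE//.
  exact: measurableI.
have [h [h0 hfin hint hE]] := radon_nikodym_sigma_finite dom.
have hf : EFin \o (fine \o h) = h by apply/funext => x /=; rewrite fineK.
exists (fine \o h); first by rewrite hf.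
move=> x axc; have /andP[ax xc] := axc.
(* The Stieltjes measure is known on half-open intervals; the missing end point has Lebesgue measure
   zero. *)
rewrite -Rintegral_itv_obnd_cbnd; last by rewrite hf; exact: integrableS hint.
rewrite /Rintegral -[X in integral _ _ X]/(EFin \o (fine \o h)) hf.
rewrite -hE//; suff -> : nu `]a, x]%classic = (f x - f a)%:E by [].
rewrite -(LSE x axc); transitivity (LS (`]a, x]%classic `&` `]a, c]%classic)); first by [].
congr LS; apply/setIidPl => t /=; rewrite !in_itv /= => /andP[-> tx] /=.
exact: le_trans xc.
Qed.

(** Jordan decomposition: [f] is its total variation [V] minus [V - f], both nondecreasing and
    absolutely continuous. *)
Lemma ac_on_density f a c : a <= c -> ac_on f a c ->
  exists2 psi : R -> R, mu.-integrable setT (EFin \o psi) &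
    forall x, a <= x <= c -> f x - f a = (\int[mu]_(t in `[a, x]) psi t)%R.
Proof.
move=> ac acf; pose V x := fine (total_variation a x f).
have acV : ac_on V a c := ac_on_total_variation acf.
have Vinc x y : a <= x -> x <= y -> y <= c -> `|f y - f x| <= V y - V x.
  move=> ax xy yc; rewrite /V (fine_total_variationD ax xy yc acf).
  rewrite addrAC subrr add0r -lee_fin fineK; last exact: total_variation_fin_sub acf.
  exact: total_variation_ge.
have [|p1 i1 e1] := nondecreasing_density ac acV.
  by move=> x y ax xy yc; rewrite -subr_ge0; apply: le_trans (Vinc x y ax xy yc).
have [|p2 i2 e2] := nondecreasing_density ac (ac_onB acV acf).
  move=> x y ax xy yc /=; have := Vinc x y ax xy yc.
  by rewrite ler_norml => /andP[_ ?]; lra.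
exists (p1 \- p2).
  have -> : EFin \o (p1 \- p2) = ((EFin \o p1) \- (EFin \o p2))%E by [].
  exact: integrableB.
move=> x axc; rewrite /= RintegralB//; last 2 first.
- exact: integrableS i1.
- exact: integrableS i2.
by rewrite -e1// -e2//=; ring.
Qed.

End AbsolutelyContinuousDensity.

(** * Primitives on [0, 1) *)

Section Primitives.
Context {R : realType}.
Implicit Types (f g : R -> R).
Local Notation mu := (@lebesgue_measure R).
Local Notation I01 := (`[0, 1[%classic : set R).

(** Integrability of [phi] on all of [[0, 1)], not only locally, is what gives [f] a bound and a
    limit at 1. *)
Definition prim f (phi : R -> R) := mu.-integrable I01 (EFin \o phi) /\
  forall t, 0 <= t < 1 -> f t = f 0 + (\int[mu]_(s in `[0, t]) phi s)%R.

Lemma ae_neq (a : R) : {ae mu, forall t, t != a}.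
Proof.
exists [set a]; split; [by []|exact: lebesgue_measure_set1|].
by move=> t /= /negP; rewrite negbK => /eqP.
Qed.

Lemma ae_imp (P Q : R -> Prop) : (forall t, P t -> Q t) ->
  {ae mu, forall t, P t} -> {ae mu, forall t, Q t}.
Proof. by move=> PQ; apply: negligibleS => t /= nQ /PQ. Qed.

Lemma ae_and (P Q : R -> Prop) : {ae mu, forall t, P t} ->
  {ae mu, forall t, Q t} -> {ae mu, forall t, P t /\ Q t}.
Proof.
move=> p q; apply: negligibleS (negligibleU p q) => t /= /not_andP[]; by [left|right].
Qed.

Lemma derive1_near_eq_cst f F (c t l : R) : (\forall s \near t, f s = F s + c) ->
  derivable F t 1 /\ derive1 F t = l -> derivable f t 1 /\ derive1 f t = l.
Proof.
move=> fF [dF F'].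
have Fl : is_derive t (1 : R) F l by split => //; rewrite -derive1E.
have : is_derive t (1 : R) f (l + 0).
  have Fc : is_derive t (1 : R) (F + cst c) (l + 0) by apply: is_deriveD.
  apply: near_eq_is_derive Fc.
  by apply: filterS fF => s ->.
by rewrite addr0 => -[df dfE]; rewrite derive1E.
Qed.

(** Lebesgue differentiation: near an interior point [f] is the integral of [psi] plus a
    constant. *)
Lemma integrable_primitive_derivable f (psi : R -> R) c : 0 <= c ->
  mu.-integrable setT (EFin \o psi) ->
  (forall t, 0 <= t < c -> f t = f 0 + (\int[mu]_(s in `[0, t]) psi s)%R) ->
  {ae mu, forall t, `]0, c[%classic t -> derivable f t 1 /\ derive1 f t = psi t}.
Proof.
move=> c0 ipsi fE.
have iy y : mu.-integrable [set` Interval (BLeft 0) (BRight y)] (EFin \o psi).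
  exact: integrableS ipsi.
have := FTC1 iy (open_integrable_locally openT ipsi).
apply: ae_imp => t H; rewrite /= in_itv /= => /andP[t0 tc].
have [|dF F'] := H; first by rewrite lte_fin.
apply: (derive1_near_eq_cst (c := f 0) _ (conj dF F')).
near=> s; rewrite addrC; apply: fE; apply/andP; split.
  by near: s; exact: lt_le_nbhsr.
by near: s; exact: lt_nbhsl.
Unshelve. all: by end_near. Qed.

Lemma prim_integrable0 f phi : prim f phi ->
  mu.-integrable setT (EFin \o (phi \_ I01)).
Proof. by move=> [iphi _]; rewrite -restrict_EFin; apply: (iffLR (integrable_mkcond _ _)) iphi. Qed.

Lemma prim_restrictE f phi t : prim f phi -> 0 <= t < 1 ->
  f t = f 0 + (\int[mu]_(s in `[0%R, t]) (phi \_ I01) s)%R.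
Proof.
move=> [iphi fE] t01; rewrite fE//; congr (_ + _); apply: eq_Rintegral => s.
rewrite inE /= in_itv /= => /andP[s0 st]; rewrite patchE ifT// inE /= in_itv /= s0 /=.
by case/andP: t01 => _; exact: le_lt_trans.
Qed.

Lemma prim_derivable f phi : prim f phi ->
  {ae mu, forall t, I01 t -> derivable f t 1 /\ derive1 f t = phi t}.
Proof.
move=> pf.
have := integrable_primitive_derivable ler01 (prim_integrable0 pf) (fun t => prim_restrictE pf).
move=> H; apply: ae_imp (ae_and H (ae_neq 0)) => t [{}H t0] It.
have /H : `]0, 1[%classic t.
  by move: It; rewrite /= !in_itv /= lt0r t0.
by rewrite patchE ifT// inE.
Qed.

Lemma Rintegral_ae_eq (D : set R) (f g : R -> R) : measurable D ->
  mu.-integrable D (EFin \o f) -> mu.-integrable D (EFin \o g) ->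
  {ae mu, forall t, D t -> f t = g t} ->
  (\int[mu]_(t in D) f t = \int[mu]_(t in D) g t)%R.
Proof.
move=> mD fi gi fg; congr fine; apply: ae_eq_integral => //.
- exact: measurable_int fi.
- exact: measurable_int gi.
- by apply: ae_imp fg => t h Dt /=; rewrite h.
Qed.

Lemma integrable_initial phi t : 0 <= t < 1 ->
  mu.-integrable I01 (EFin \o phi) -> mu.-integrable `[0, t] (EFin \o phi).
Proof.
move=> /andP[_ t1] iphi; apply: integrableS iphi => // s.
by rewrite /= !in_itv /= => /andP[-> ] /=; move=> st; exact: le_lt_trans t1.
Qed.

(** On each [[0, t]] there is a density that may depend on [t]; by Lebesgue differentiation it
    equals the derivative almost everywhere, hence [phi], so a single density serves for all [t]. *)
Lemma loc_abs_continuous_prim f phi : loc_abs_continuous f ->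
  mu.-integrable I01 (EFin \o phi) ->
  {ae mu, forall t, I01 t -> derive1 f t = phi t} -> prim f phi.
Proof.
move=> acf iphi df; split => // t /[dup] t01 /andP[t0 t1].
have [psi ipsi fE] := ac_on_density t0 (abs_continuous_ac_on (acf t t01)).
have tt : 0 <= t <= t by rewrite t0 lexx.
apply/eqP; rewrite addrC -subr_eq fE//; apply/eqP.
apply: Rintegral_ae_eq => //.
- exact: integrableS ipsi.
- exact: integrable_initial iphi.
have fE' s : 0 <= s < t -> f s = f 0 + (\int[mu]_(r in `[0%R, s]) psi r)%R.
  by move=> /andP[s0 st]; rewrite -fE ?s0 ?ltW//; ring.
have := integrable_primitive_derivable t0 ipsi fE'.
move=> H; apply: ae_imp (ae_and (ae_and H df) (ae_and (ae_neq 0) (ae_neq t))).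
move=> s [[h1 h2] [s0 st]]; rewrite /= in_itv /= => /andP[s0' st'].
have slt : s < t by rewrite lt_neqAle st.
have [|_ <-] := h1; first by rewrite /= in_itv /= lt0r s0 s0'.
by apply: h2; rewrite /= in_itv /= s0' (lt_trans slt t1).
Qed.

Lemma sum_integral_disjoint m (u v : 'I_m -> R) (h : R -> R) :
  mu.-integrable setT (EFin \o h) -> (forall i, u i <= v i) ->
  trivIset setT (fun i => `]u i, v i[%classic) ->
  \sum_i (\int[mu]_(s in `]u i, v i[) `|h s|)%R =
  (\int[mu]_(s in \big[setU/set0]_i `]u i, v i[%classic) `|h s|)%R.
Proof.
move=> ih uv dis; have ih' : mu.-integrable setT (EFin \o (fun s => `|h s|)).
  exact: integrable_abse ih.
rewrite [RHS]/Rintegral integral_bigsetU_EFin//.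
- rewrite /Rintegral sum_fine// => i _; apply: integrable_fin_num => //.
  exact: integrableS ih'.
- exact: index_enum_uniq.
- by apply: sub_trivIset dis.
- exact: (measurable_funS measurableT (@subsetT _ _) (measurable_int _ ih')).
Qed.

Lemma mu_disjoint m (u v : 'I_m -> R) : (forall i, u i <= v i) ->
  trivIset setT (fun i => `]u i, v i[%classic) ->
  mu (\big[setU/set0]_i `]u i, v i[%classic) = (\sum_i (v i - u i))%:E.
Proof.
move=> uv dis.
(* The measure is written as an integral of 1 to use finite additivity of the integral. *)
rewrite -[LHS]mul1e -integral_cst; last by apply: bigsetU_measurable.
rewrite ge0_integral_bigsetU//; last 2 first.
- exact: index_enum_uniq.
- by apply: sub_trivIset dis.
rewrite -sumEFin; apply: eq_bigr => i _; rewrite integral_cst// mul1e.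
transitivity (mu [set` `]u i, v i[]); first by [].
rewrite lebesgue_measure_itv /=; case: ifPn => //.
rewrite lte_fin -leNgt => vu; have -> : v i = u i by apply/eqP; rewrite eq_le uv vu.
by rewrite subrr.

Qed.

(** Absolute continuity of the integral: the increments are bounded by the integral of [|phi|] over
    the union of the intervals, a set of small measure. *)
Lemma prim_loc_abs_continuous f phi : prim f phi -> loc_abs_continuous f.
Proof.
move=> pf c /andP[c0 c1] e e0; have ih := prim_integrable0 pf.
set h := phi \_ I01 in ih.
have [d [d0 dP]] := integral_normr_continuous ih e0.
exists d => // m u v uv dis len.
have uv' i : u i <= v i by case: (uv i) => _ [].
have mU : measurable (\big[setU/set0]_i `]u i, v i[%classic : set R).
  by apply: bigsetU_measurable.
have muU : (mu (\big[setU/set0]_i `]u i, v i[%classic) < d%:E)%E.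
  by rewrite mu_disjoint// lte_fin.
apply: le_lt_trans (dP _ mU muU).
rewrite -sum_integral_disjoint//; apply: ler_sum => i _.
have [u0 [uvi vc]] := uv i.
have -> : f (v i) - f (u i) = (\int[mu]_(s in `]u i, v i[) h s)%R.
  rewrite (prim_restrictE pf (t := v i)); last first.
    by rewrite (le_trans u0)//= (le_lt_trans vc).
  rewrite (prim_restrictE pf (t := u i)); last first.
    by rewrite u0 (le_lt_trans (le_trans uvi vc)).
  rewrite opprD addrACA subrr add0r Rintegral_itvB//.
  - rewrite -Rintegral_itv_bndo_bndc//; exact: integrableS ih.
  - exact: integrableS ih.
by apply: le_normr_Rintegral => //; exact: integrableS ih.
Qed.

Lemma prim_bounded f phi : prim f phi ->
  exists2 M : R, 0 < M & forall t, 0 <= t < 1 -> `|f t| <= M.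
Proof.
move=> pf; have ih := prim_integrable0 pf; set h := phi \_ I01 in ih.
have ih' : mu.-integrable setT (EFin \o (fun s => `|h s|)).
  exact: integrable_abse ih.
have int0 : 0 <= (\int[mu]_s `|h s|)%R by apply: Rintegral_ge0.
exists (`|f 0| + (\int[mu]_s `|h s|)%R + 1) => [|t t01].
  by rewrite ltr_wpDl// addr_ge0.
rewrite (prim_restrictE pf)// (le_trans (ler_normD _ _))// -addrA lerD2l.
rewrite (le_trans (le_normr_Rintegral _ _))//; first exact: integrableS ih.
apply: ler_wpDr => //; rewrite /Rintegral; apply: fine_le.
- by apply: integrable_fin_num => //; exact: integrableS ih'.
- exact: integrable_fin_num.
- apply: ge0_subset_integral => //; exact: measurable_int ih'.
Qed.

Lemma loc_abs_continuousM f g Mf Mg : 0 < Mf -> 0 < Mg ->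
  (forall t, 0 <= t < 1 -> `|f t| <= Mf) -> (forall t, 0 <= t < 1 -> `|g t| <= Mg) ->
  loc_abs_continuous f -> loc_abs_continuous g ->
  loc_abs_continuous (fun t => f t * g t).
Proof.
move=> Mf0 Mg0 bf bg acf acg c c01 e e0.
have ef : 0 < e / (2 * Mg) by rewrite divr_gt0// mulr_gt0.
have eg : 0 < e / (2 * Mf) by rewrite divr_gt0// mulr_gt0.
have [d1 d10 d1P] := acf c c01 _ ef; have [d2 d20 d2P] := acg c c01 _ eg.
exists (Num.min d1 d2) => [|m u v uv dis]; first by rewrite lt_min d10.
rewrite lt_min => /andP[l1 l2]; have h1 := d1P m u v uv dis l1.
have h2 := d2P m u v uv dis l2.
have in01 i : (0 <= u i < 1) /\ (0 <= v i < 1).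
  have [u0 [uvi vc]] := uv i; have /andP[c0 c1] := c01.
  by split; rewrite ?u0 ?(le_trans u0 uvi) /= ?(le_lt_trans vc)// (le_lt_trans (le_trans uvi vc)).
apply: (@le_lt_trans _ _ (Mg * (\sum_i `|f (v i) - f (u i)|) +
    Mf * (\sum_i `|g (v i) - g (u i)|))).
  rewrite !mulr_sumr -big_split /=; apply: ler_sum => i _.
  have [ui vi] := in01 i.
  have -> : f (v i) * g (v i) - f (u i) * g (u i) =
    g (v i) * (f (v i) - f (u i)) + f (u i) * (g (v i) - g (u i)) by ring.
  apply: le_trans (ler_normD _ _) _; rewrite !normrM.
  by apply: lerD; apply: ler_wpM2r => //; [exact: bg|exact: bf].
move: h1 h2; rewrite !ltr_pdivlMr ?mulr_gt0//.
by move: (\sum_i `|f _ - _|) (\sum_i `|g _ - _|) => X Y; lra.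
Qed.

Lemma RintegrableZ (D : set R) (M : R) f : measurable D ->
  mu.-integrable D (EFin \o f) -> mu.-integrable D (EFin \o (fun t => M * f t)).
Proof. by move=> mD if_; have := @integrableZl _ _ _ mu D mD M _ if_. Qed.

Lemma RintegrableD (D : set R) f g : measurable D ->
  mu.-integrable D (EFin \o f) -> mu.-integrable D (EFin \o g) ->
  mu.-integrable D (EFin \o (fun t => f t + g t)).
Proof. by move=> mD if_ ig; have := @integrableD _ _ _ mu D mD _ _ if_ ig. Qed.

Lemma Rintegrable_norm (D : set R) f :
  mu.-integrable D (EFin \o f) -> mu.-integrable D (EFin \o (fun t => `|f t|)).
Proof. by move=> if_; have := integrable_abse if_. Qed.

Lemma le_integrableR (D : set R) f g : measurable D -> measurable_fun D f ->
  (forall t, D t -> `|f t| <= g t) -> mu.-integrable D (EFin \o g) ->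
  mu.-integrable D (EFin \o f).
Proof.
move=> mD mf fg; apply: le_integrable => //; first exact/measurable_EFinP.
by move=> t Dt /=; rewrite lee_fin; exact: le_trans (fg t Dt) (ler_norm _).
Qed.

Lemma bounded_integrableM (D : set R) f g (M : R) : measurable D ->
  measurable_fun D f -> (forall t, D t -> `|f t| <= M) ->
  mu.-integrable D (EFin \o g) ->
  mu.-integrable D (EFin \o (fun t => f t * g t)).
Proof.
move=> mD mf fM ig; have mg := measurable_int _ ig.
apply: (@le_integrableR _ _ (fun t => M * `|g t|)) => //.
- apply: measurable_funM => //; exact/measurable_EFinP.
- by move=> t Dt; rewrite normrM; apply: ler_wpM2r => //; exact: fM.
- by apply: RintegrableZ => //; exact: Rintegrable_norm.
Qed.

Lemma prim_measurable f phi : prim f phi -> measurable_fun I01 f.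
Proof.
move=> pf.
have i01 : mu.-integrable `[0, 1] (EFin \o (phi \_ I01)).
  exact: integrableS (prim_integrable0 pf).
have := parameterized_integral_continuous ler01 i01.
move=> /(subspace_continuous_measurable_fun (measurable_itv _)) mF.
apply: (@eq_measurable_fun _ _ _ _ _ (fun t => f 0 + parameterized_integral mu 0 t (phi \_ I01))).
  by move=> t; rewrite inE /= in_itv /= => It; rewrite [RHS](prim_restrictE pf).
apply: measurable_funD => //.
by apply: measurable_funS mF => //; apply: subset_itv => //; rewrite bnd_simp.
Qed.

Lemma is_derive_mul (f g : R -> R) (x df dg : R) : is_derive x (1 : R) f df ->
  is_derive x (1 : R) g dg ->
  is_derive x (1 : R) (fun s => f s * g s) (f x * dg + g x * df).
Proof. by move=> hf hg; exact: is_deriveM. Qed.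

(** Integration by parts without Fubini: a product of bounded absolutely continuous functions is
    absolutely continuous, and its derivative is given almost everywhere by the Leibniz rule. *)
Lemma primM f g phi psi : prim f phi -> prim g psi ->
  prim (fun t => f t * g t) (fun t => phi t * g t + f t * psi t).
Proof.
move=> pf pg; have [Mf Mf0 bf] := prim_bounded pf.
have [Mg Mg0 bg] := prim_bounded pg.
have bfI t : I01 t -> `|f t| <= Mf by rewrite /= in_itv; exact: bf.
have bgI t : I01 t -> `|g t| <= Mg by rewrite /= in_itv; exact: bg.
apply: loc_abs_continuous_prim.
- by apply: loc_abs_continuousM bf bg _ _ => //; [exact: prim_loc_abs_continuous pf|exact: prim_loc_abs_continuous pg].
- rewrite (_ : EFin \o _ = EFin \o (fun t => g t * phi t + f t * psi t)); last first.
    by apply/funext => t /=; rewrite [g t * _]mulrC.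
  apply: RintegrableD => //.
    by apply: bounded_integrableM bgI _ => //; [exact: prim_measurable pg|exact: pf.1].
  by apply: bounded_integrableM bfI _ => //; [exact: prim_measurable pf|exact: pg.1].
- apply: ae_imp (ae_and (prim_derivable pf) (prim_derivable pg)).
  move=> t [h1 h2] It; have [d1 e1] := h1 It; have [d2 e2] := h2 It.
  have D1 := DeriveDef d1 (etrans (esym (derive1E _ _)) e1).
  have D2 := DeriveDef d2 (etrans (esym (derive1E _ _)) e2).
  by have [_ D] := is_derive_mul D1 D2; rewrite derive1E D addrC [g t * _]mulrC.
Qed.

Lemma primD f g phi psi : prim f phi -> prim g psi ->
  prim (fun t => f t + g t) (fun t => phi t + psi t).
Proof.
move=> [if_ fE] [ig gE]; split.
  exact: RintegrableD.
move=> t t01; rewrite fE// gE// RintegralD//; first by ring.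
all: by apply: integrable_initial => //; (exact: if_ || exact: ig).
Qed.

Lemma primZ (c : R) f phi : prim f phi ->
  prim (fun t => c * f t) (fun t => c * phi t).
Proof.
move=> [if_ fE]; split.
  exact: RintegrableZ.
move=> t t01; rewrite fE// RintegralZl//; first by ring.
by apply: integrable_initial => //; (exact: if_ || exact: ig).
Qed.

Lemma prim_cst (c : R) : prim (fun=> c) (fun=> 0).
Proof.
split; first exact: integrable0.
by move=> t _; rewrite Rintegral_cst// mul0r addr0.
Qed.

Lemma prim_ae f phi psi : prim f phi -> mu.-integrable I01 (EFin \o psi) ->
  {ae mu, forall t, I01 t -> phi t = psi t} -> prim f psi.
Proof.
move=> pf ip pp; apply: loc_abs_continuous_prim => //.
  exact: prim_loc_abs_continuous pf.
apply: ae_imp (ae_and (prim_derivable pf) pp) => t [h1 h2] It.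
by rewrite -h2//; case: (h1 It).
Qed.

Lemma prim_cvg1 f phi : prim f phi ->
  f t @[t --> 1^'-] --> f 0 + (\int[mu]_(s in I01) phi s)%R.
Proof.
move=> pf; have ih := prim_integrable0 pf.
have i01 : mu.-integrable `[0, 1] (EFin \o (phi \_ I01)) by exact: integrableS ih.
have := parameterized_integral_cvg_at_left ltr01 i01.
rewrite {2}/parameterized_integral -Rintegral_itv_bndo_bndc; last exact: integrableS ih.
rewrite [X in _ --> X -> _](_ : _ = (\int[mu]_(s in I01) phi s)%R); last first.
  by apply: eq_Rintegral => s sI; rewrite patchE ifT.
move=> cv; apply: cvg_trans (cvgD (cvg_cst (f 0)) cv).
apply: near_eq_cvg; near=> t; rewrite [RHS](prim_restrictE pf)//.
by apply/andP; split; near: t; [exact: nbhs_left_ge|exact: nbhs_left_lt].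
Unshelve. all: by end_near. Qed.

End Primitives.

(** * Complex-valued functions on [0, 1) *)

Section ComplexParts.
Context {R : realType}.
Local Notation C := R[i].
Local Notation Re := (@complex.Re R).
Local Notation Im := (@complex.Im R).
Implicit Types (z w : C).

Lemma complex_eqP z w : Re z = Re w -> Im z = Im w -> z = w.
Proof. by case: z w => a b [c d] /= -> ->. Qed.

Lemma ReD z w : Re (z + w) = Re z + Re w. Proof. by case: z; case: w. Qed.
Lemma ImD z w : Im (z + w) = Im z + Im w. Proof. by case: z; case: w. Qed.
Lemma ReN z : Re (- z) = - Re z. Proof. by case: z. Qed.
Lemma ImN z : Im (- z) = - Im z. Proof. by case: z. Qed.
Lemma ReM z w : Re (z * w) = Re z * Re w - Im z * Im w.
Proof. by case: z; case: w. Qed.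
Lemma ImM z w : Im (z * w) = Re z * Im w + Im z * Re w.
Proof. by case: z; case: w. Qed.
Lemma ReJ z : Re (Num.conj z) = Re z. Proof. by case: z. Qed.
Lemma ImJ z : Im (Num.conj z) = - Im z. Proof. by case: z. Qed.

(** The norm of [R[i]] takes values in [R[i]]; a real squared modulus is what enters integrals and
    real inequalities. *)
Definition absq z : R := Re z ^+ 2 + Im z ^+ 2.

Lemma absq_ge0 z : 0 <= absq z. Proof. by rewrite addr_ge0 ?sqr_ge0. Qed.

Lemma normC_sqr z : `|z| ^+ 2 = (absq z)%:C%C.
Proof. by rewrite add_Re2_Im2. Qed.

Lemma absqJ z : absq (Num.conj z) = absq z.
Proof. by rewrite /absq ReJ ImJ sqrrN. Qed.

Lemma absqM z w : absq (z * w) = absq z * absq w.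
Proof. by rewrite /absq ReM ImM; ring. Qed.

Lemma absqD_le z w : absq (z + w) <= 2 * (absq z + absq w).
Proof.
rewrite /absq ReD ImD -subr_ge0.
rewrite (_ : _ - _ = (Re z - Re w) ^+ 2 + (Im z - Im w) ^+ 2); last by ring.
by rewrite addr_ge0 ?sqr_ge0.
Qed.

Lemma absq_eq0 z : absq z = 0 -> z = 0.
Proof.
move=> /eqP; rewrite paddr_eq0 ?sqr_ge0// !sqrf_eq0 => /andP[/eqP h1 /eqP h2].
exact: complex_eqP.
Qed.

Lemma normC_lt1 z : (`|z| < 1) = (absq z < 1).
Proof.
by rewrite -(@expr_lt1 _ 2)// normC_sqr ltcR.
Qed.

Lemma normC_eq1 z : absq z = 1 -> `|z| = 1.
Proof.
by move=> h; apply/eqP; rewrite -(@eqrXn2 _ 2)// expr1n normC_sqr h.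
Qed.

End ComplexParts.

Section ComplexIntegrals.
Context {R : realType}.
Local Notation C := R[i].
Local Notation Re := (@complex.Re R).
Local Notation Im := (@complex.Im R).
Local Notation mu := (@lebesgue_measure R).
Local Notation I01 := (`[0, 1[%classic : set R).
Implicit Types (f g h : R -> C).

Definition cmeasurable f := measurable_fun I01 (fun t => Re (f t)) /\
  measurable_fun I01 (fun t => Im (f t)).

Definition cintegrable f := mu.-integrable I01 (EFin \o (fun t => Re (f t))) /\
  mu.-integrable I01 (EFin \o (fun t => Im (f t))).

Definition cbounded f := exists M : R, forall t, I01 t -> absq (f t) <= M.

Definition square_integrable f :=
  cmeasurable f /\ mu.-integrable I01 (EFin \o (fun t => absq (f t))).


Lemma cmeasurable_cst (c : C) : cmeasurable (fun=> c).
Proof. by split; exact: measurable_cst. Qed.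

Lemma cmeasurableD f g : cmeasurable f -> cmeasurable g ->
  cmeasurable (fun t => f t + g t).
Proof.
move=> [f1 f2] [g1 g2]; split.
- by rewrite (funext (fun t => ReD (f t) (g t))); apply: measurable_funD.
- by rewrite (funext (fun t => ImD (f t) (g t))); apply: measurable_funD.
Qed.

Lemma cmeasurableM f g : cmeasurable f -> cmeasurable g ->
  cmeasurable (fun t => f t * g t).
Proof.
move=> [f1 f2] [g1 g2]; split.
- by rewrite (funext (fun t => ReM (f t) (g t))); apply: measurable_funB; apply: measurable_funM.
- by rewrite (funext (fun t => ImM (f t) (g t))); apply: measurable_funD; apply: measurable_funM.
Qed.

Lemma cmeasurableJ f : cmeasurable f -> cmeasurable (fun t => Num.conj (f t)).
Proof.
move=> [f1 f2]; split; first by rewrite (funext (fun t => ReJ (f t))).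
by rewrite (funext (fun t => ImJ (f t))); apply: measurable_funN.
Qed.

Lemma measurable_absq f : cmeasurable f -> measurable_fun I01 (fun t => absq (f t)).
Proof. by move=> [f1 f2]; apply: measurable_funD; apply: measurable_funX. Qed.

Lemma mu_I01 : mu I01 = 1%E.
Proof.
transitivity (mu [set` `[(0 : R), 1[]); first by [].
by rewrite lebesgue_measure_itv /= lte_fin ltr01 oppr0 adde0.
Qed.

Lemma integrable_I01_cst (c : R) : mu.-integrable I01 (EFin \o (fun=> c)).
Proof.
apply/integrableP; split; first exact: measurable_cst.
have -> : (\int[mu]_(x in I01) `|(EFin \o (fun=> c)) x| = \int[mu]_(x in I01) (cst `|c|%:E) x)%E by [].
by rewrite integral_cst// [X in (_ * X)%E]mu_I01 mule1 ltry.
Qed.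

Lemma cintegrable_le f (g : R -> R) : cmeasurable f ->
  (forall t, I01 t -> `|Re (f t)| <= g t /\ `|Im (f t)| <= g t) ->
  mu.-integrable I01 (EFin \o g) -> cintegrable f.
Proof.
move=> [f1 f2] fg ig; split; apply: le_integrableR ig => //; try exact: measurable_itv.
  by move=> t /fg[].
by move=> t /fg[].
Qed.

Lemma Re_Im_le_absq z : `|Re z| <= 1 + absq z /\ `|Im z| <= 1 + absq z :> R.
Proof.
have key (x y : R) : `|x| <= 1 + (x ^+ 2 + y ^+ 2).
  have h1 := sqr_ge0 (x + 1); have h2 := sqr_ge0 (x - 1); have h3 := sqr_ge0 x.
  by have h4 := sqr_ge0 y; rewrite ler_norml; apply/andP; split; nra.
by split; [exact: key|rewrite /absq [_ ^+ 2 + _]addrC; exact: key].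
Qed.

Lemma square_integrable_integrable f : square_integrable f -> cintegrable f.
Proof.
move=> [mf if_]; apply: (@cintegrable_le _ (fun t => 1 + absq (f t))) => //.
  by move=> t _; exact: Re_Im_le_absq.
by apply: RintegrableD => //; exact: integrable_I01_cst.
Qed.

Lemma Re_Im_mul_le (z w : C) :
  `|Re (z * w)| <= absq z + absq w /\ `|Im (z * w)| <= absq z + absq w.
Proof.
rewrite /absq ReM ImM; case: z w => a b [c d] /=.
have ha := sqr_ge0 (a + c); have hb := sqr_ge0 (a - c).
have hc := sqr_ge0 (b + d); have hd := sqr_ge0 (b - d).
have he := sqr_ge0 (a + d); have hf := sqr_ge0 (a - d).
have hg := sqr_ge0 (b + c); have hh := sqr_ge0 (b - c).
by rewrite !ler_norml; split; apply/andP; split; nra.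
Qed.

Lemma square_integrableM f g : square_integrable f -> square_integrable g ->
  cintegrable (fun t => f t * g t).
Proof.
move=> [mf if_] [mg ig].
apply: (@cintegrable_le _ (fun t => absq (f t) + absq (g t))) => //.
- exact: cmeasurableM.
- by move=> t _; exact: Re_Im_mul_le.
- by apply: RintegrableD => //.
Qed.

Lemma square_integrableJ f : square_integrable f ->
  square_integrable (fun t => Num.conj (f t)).
Proof.
move=> [mf if_]; split; first exact: cmeasurableJ.
by rewrite (funext (fun t => absqJ (f t))).
Qed.

Lemma square_integrableD f g : square_integrable f -> square_integrable g ->
  square_integrable (fun t => f t + g t).
Proof.
move=> [mf if_] [mg ig]; split; first exact: cmeasurableD.
apply: (@le_integrableR _ _ _ (fun t => 2 * (absq (f t) + absq (g t)))).
- exact: measurable_itv.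
- by apply: measurable_absq; exact: cmeasurableD.
- by move=> t _; rewrite ger0_norm ?absq_ge0//; exact: absqD_le.
- by apply: RintegrableZ; [exact: measurable_itv|apply: RintegrableD => //; exact: measurable_itv].
Qed.

Lemma bounded_square_integrableM f g : cmeasurable f -> cbounded f ->
  square_integrable g -> square_integrable (fun t => f t * g t).
Proof.
move=> mf [M fM] [mg ig]; split; first exact: cmeasurableM.
apply: (@le_integrableR _ _ _ (fun t => M * absq (g t))).
- exact: measurable_itv.
- by apply: measurable_absq; exact: cmeasurableM.
- move=> t It; rewrite ger0_norm ?absq_ge0// absqM.
  by apply: ler_wpM2r; [exact: absq_ge0|exact: fM].
- by apply: RintegrableZ => //.
Qed.

Lemma bounded_square_integrable f : cmeasurable f -> cbounded f ->
  square_integrable f.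
Proof.
move=> mf [M fM]; split => //; apply: (@le_integrableR _ _ _ (fun=> M)).
- exact: measurable_itv.
- exact: measurable_absq.
- by move=> t It; rewrite ger0_norm ?absq_ge0//; exact: fM.
- exact: integrable_I01_cst.
Qed.

Lemma cintegrableD f g : cintegrable f -> cintegrable g ->
  cintegrable (fun t => f t + g t).
Proof.
move=> [f1 f2] [g1 g2]; split.
- by rewrite (funext (fun t => ReD (f t) (g t))); apply: RintegrableD => //.
- by rewrite (funext (fun t => ImD (f t) (g t))); apply: RintegrableD => //.
Qed.

Lemma cintegrableZ (c : C) f : cintegrable f -> cintegrable (fun t => c * f t).
Proof.
move=> [f1 f2]; split.
- rewrite (funext (fun t => ReM c (f t))).
  rewrite (_ : (fun t => _) = (fun t => Re c * Re (f t) + (- Im c) * Im (f t))); last first.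
    by apply/funext => t; rewrite mulNr.
  by apply: RintegrableD; rewrite ?measurable_itv//; apply: RintegrableZ => //.
- rewrite (funext (fun t => ImM c (f t))).
  by apply: RintegrableD; rewrite ?measurable_itv//; apply: RintegrableZ => //.
Qed.

Lemma cintegrable0 : cintegrable (fun=> 0).
Proof. by split; exact: integrable_I01_cst. Qed.

Lemma cintegrable_sum n (F : 'I_n -> R -> C) : (forall i, cintegrable (F i)) ->
  cintegrable (fun t => \sum_i F i t).
Proof.
elim: n F => [|n IH] F iF.
  by under eq_fun do rewrite big_ord0; exact: cintegrable0.
by under eq_fun do rewrite big_ord_recl; apply: cintegrableD => //; exact: IH.
Qed.

Lemma square_integrable_sum n (F : 'I_n -> R -> C) :
  (forall i, square_integrable (F i)) ->
  square_integrable (fun t => \sum_i F i t).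
Proof.
elim: n F => [|n IH] F iF.
  under eq_fun do rewrite big_ord0.
  apply: bounded_square_integrable; first exact: cmeasurable_cst.
  by exists 0 => t _; rewrite /absq /= expr0n addr0.
by under eq_fun do rewrite big_ord_recl; apply: square_integrableD => //; exact: IH.
Qed.

End ComplexIntegrals.

(** * Primitives and end limits of complex and matrix functions *)

Section ComplexPrimitives.
Context {R : realType}.
Local Notation C := R[i].
Local Notation Re := (@complex.Re R).
Local Notation Im := (@complex.Im R).
Local Notation mu := (@lebesgue_measure R).
Local Notation I01 := (`[0, 1[%classic : set R).
Implicit Types (f g phi psi : R -> C).

Lemma prim_eq (f g phi psi : R -> R) : prim f phi -> f =1 g -> phi =1 psi -> prim g psi.
Proof. by move=> pf /funext <- /funext <-. Qed.

Definition cprim f phi := prim (fun t => Re (f t)) (fun t => Re (phi t)) /\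
  prim (fun t => Im (f t)) (fun t => Im (phi t)).

Lemma cprim_eq f g phi psi : cprim f phi -> f =1 g -> phi =1 psi -> cprim g psi.
Proof. by move=> pf /funext <- /funext <-. Qed.

Lemma cprim_cst (c : C) : cprim (fun=> c) (fun=> 0).
Proof. by split; exact: prim_cst. Qed.

Lemma cprimD f g phi psi : cprim f phi -> cprim g psi ->
  cprim (fun t => f t + g t) (fun t => phi t + psi t).
Proof.
move=> [f1 f2] [g1 g2]; split.
  by apply: prim_eq (primD f1 g1) _ _ => t; rewrite ReD.
by apply: prim_eq (primD f2 g2) _ _ => t; rewrite ImD.
Qed.

Lemma cprimM f g phi psi : cprim f phi -> cprim g psi ->
  cprim (fun t => f t * g t) (fun t => phi t * g t + f t * psi t).
Proof.
move=> [f1 f2] [g1 g2]; split.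
  apply: prim_eq (primD (primM f1 g1) (primZ (-1) (primM f2 g2))) _ _ => t;
    rewrite ?ReD !ReM; ring.
apply: prim_eq (primD (primM f1 g2) (primM f2 g1)) _ _ => t;
  rewrite ?ImD !ImM; ring.
Qed.

Lemma cprimJ f phi : cprim f phi ->
  cprim (fun t => Num.conj (f t)) (fun t => Num.conj (phi t)).
Proof.
move=> [f1 f2]; split; first by apply: prim_eq f1 _ _ => t; rewrite ReJ.
by apply: prim_eq (primZ (-1) f2) _ _ => t; rewrite ImJ mulN1r.
Qed.

Lemma cprim_sum n (F Phi : 'I_n -> R -> C) : (forall i, cprim (F i) (Phi i)) ->
  cprim (fun t => \sum_i F i t) (fun t => \sum_i Phi i t).
Proof.
elim: n F Phi => [|n IH] F Phi pF.
  by apply: cprim_eq (cprim_cst 0) _ _ => t; rewrite big_ord0.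
apply: cprim_eq (cprimD (pF ord0) (IH _ _ (fun i => pF (lift ord0 i)))) _ _;
  by move=> t; rewrite big_ord_recl.
Qed.

Lemma cprim_ae f phi psi : cprim f phi -> cintegrable psi ->
  {ae mu, forall t, I01 t -> phi t = psi t} -> cprim f psi.
Proof.
move=> [f1 f2] [i1 i2] pp; split.
  by apply: prim_ae f1 _ _ => //; apply: ae_imp pp => t h /h ->.
by apply: prim_ae f2 _ _ => //; apply: ae_imp pp => t h /h ->.
Qed.

Lemma cprim_measurable f phi : cprim f phi -> cmeasurable f.
Proof. by move=> [f1 f2]; split; [exact: prim_measurable f1|exact: prim_measurable f2]. Qed.

Lemma cprim_bounded f phi : cprim f phi -> cbounded f.
Proof.
move=> [/prim_bounded[M1 M10 f1] /prim_bounded[M2 M20 f2]].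
exists (M1 ^+ 2 + M2 ^+ 2) => t; rewrite /= in_itv /= => It.
rewrite /absq -(real_normK (num_real (Re _))) -(real_normK (num_real (Im _))).
have h1 := f1 t It; have h2 := f2 t It.
by apply: lerD; rewrite lerXn2r// nnegrE ltW.
Qed.

Lemma cprim_const f phi : cprim f phi -> {ae mu, forall t, I01 t -> phi t = 0} ->
  forall t, 0 <= t < 1 -> f t = f 0.
Proof.
move=> pf p0 t t01.
have [[_ f1] [_ f2]] := cprim_ae pf cintegrable0 p0.
by apply: complex_eqP; [rewrite (f1 t t01)|rewrite (f2 t t01)];
  rewrite Rintegral_cst//= mul0r addr0.
Qed.

Definition cint (phi : R -> C) (t : R) : C :=
  ((\int[mu]_(s in `[0, t]) Re (phi s))%R +i* (\int[mu]_(s in `[0, t]) Im (phi s))%R)%C.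

Lemma cint0 phi : cint phi 0 = 0.
Proof. by rewrite /cint set_itv1 !Rintegral_set1. Qed.

Lemma cprim_cint phi : cintegrable phi -> cprim (cint phi) phi.
Proof.
by move=> [i1 i2]; split; split => // t _; rewrite cint0 add0r.
Qed.

Definition cint1 (phi : R -> C) : C :=
  ((\int[mu]_(s in I01) Re (phi s))%R +i* (\int[mu]_(s in I01) Im (phi s))%R)%C.

Definition clim1 f (l : C) := Re (f t) @[t --> 1^'-] --> Re l /\
  Im (f t) @[t --> 1^'-] --> Im l.

Lemma cprim_clim1 f phi : cprim f phi -> clim1 f (f 0 + cint1 phi).
Proof.
move=> [f1 f2]; split.
  by rewrite ReD; exact: prim_cvg1 f1.
by rewrite ImD; exact: prim_cvg1 f2.
Qed.

Lemma clim1_unique f l l' : clim1 f l -> clim1 f l' -> l = l'.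
Proof.
move=> [a b] [c d]; apply: complex_eqP.
  by rewrite -(cvg_lim (@Rhausdorff R) a) -(cvg_lim (@Rhausdorff R) c).
by rewrite -(cvg_lim (@Rhausdorff R) b) -(cvg_lim (@Rhausdorff R) d).
Qed.

Lemma clim1_cst (c : C) : clim1 (fun=> c) c.
Proof. by split; exact: cvg_cst. Qed.

Lemma clim1D f g l m : clim1 f l -> clim1 g m -> clim1 (fun t => f t + g t) (l + m).
Proof.
move=> [a b] [c d]; split.
  by rewrite ReD (funext (fun t => ReD (f t) (g t))); exact: cvgD.
by rewrite ImD (funext (fun t => ImD (f t) (g t))); exact: cvgD.
Qed.

Lemma clim1M f g l m : clim1 f l -> clim1 g m -> clim1 (fun t => f t * g t) (l * m).
Proof.
move=> [a b] [c d]; split.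
  by rewrite ReM (funext (fun t => ReM (f t) (g t))); apply: cvgB; exact: cvgM.
by rewrite ImM (funext (fun t => ImM (f t) (g t))); apply: cvgD; exact: cvgM.
Qed.

Lemma clim1J f l : clim1 f l -> clim1 (fun t => Num.conj (f t)) (Num.conj l).
Proof.
move=> [a b]; split.
  by rewrite ReJ (funext (fun t => ReJ (f t))).
by rewrite ImJ (funext (fun t => ImJ (f t))); exact: cvgN.
Qed.

Lemma clim1_sum n (F : 'I_n -> R -> C) (l : 'I_n -> C) :
  (forall i, clim1 (F i) (l i)) -> clim1 (fun t => \sum_i F i t) (\sum_i l i).
Proof.
elim: n F l => [|n IH] F l Fl.
  by rewrite big_ord0; under eq_fun do rewrite big_ord0; exact: clim1_cst.
rewrite big_ord_recl; under eq_fun do rewrite big_ord_recl.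
by apply: clim1D => //; apply: IH.
Qed.

Section MatrixPrimitives.
Implicit Types (m n p : nat).

Definition mprim m n (G Phi : R -> 'M[C]_(m, n)) :=
  forall i j, cprim (fun t => G t i j) (fun t => Phi t i j).

Definition mlim1 m n (G : R -> 'M[C]_(m, n)) (L : 'M[C]_(m, n)) :=
  forall i j, clim1 (fun t => G t i j) (L i j).

Lemma mprim_eq m n (G H Phi Psi : R -> 'M[C]_(m, n)) :
  mprim G Phi -> G =1 H -> Phi =1 Psi -> mprim H Psi.
Proof. by move=> pf /funext <- /funext <-. Qed.

Lemma mprimM m n p (G Phi : R -> 'M[C]_(m, n)) (H Psi : R -> 'M[C]_(n, p)) :
  mprim G Phi -> mprim H Psi ->
  mprim (fun t => G t *m H t) (fun t => Phi t *m H t + G t *m Psi t).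
Proof.
move=> pG pH i j; apply: cprim_eq (cprim_sum (fun k => cprimM (pG i k) (pH k j))) _ _.
  by move=> t; rewrite !mxE.
by move=> t; rewrite !mxE big_split.
Qed.

Lemma mprimD m n (G Phi H Psi : R -> 'M[C]_(m, n)) :
  mprim G Phi -> mprim H Psi ->
  mprim (fun t => G t + H t) (fun t => Phi t + Psi t).
Proof.
move=> pG pH i j; apply: cprim_eq (cprimD (pG i j) (pH i j)) _ _ => t;
  by rewrite !mxE.
Qed.

Lemma mprim_cst m n (M : 'M[C]_(m, n)) : mprim (fun=> M) (fun=> 0).
Proof.
by move=> i j; apply: cprim_eq (cprim_cst (M i j)) _ _ => t; rewrite ?mxE.
Qed.

Lemma mprim_ae m n (G Phi Psi : R -> 'M[C]_(m, n)) : mprim G Phi ->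
  (forall i j, cintegrable (fun t => Psi t i j)) ->
  {ae mu, forall t, I01 t -> Phi t = Psi t} -> mprim G Psi.
Proof.
move=> pG iP pp i j; apply: cprim_ae (pG i j) _ _ => //.
by apply: ae_imp pp => t h /h ->.
Qed.

(** This takes the place of a uniqueness theorem for linear equations: an identity between solutions
    holds because a suitable combination has derivative zero almost everywhere. *)
Lemma mprim_const m n (G Phi : R -> 'M[C]_(m, n)) : mprim G Phi ->
  {ae mu, forall t, I01 t -> Phi t = 0} -> forall t, 0 <= t < 1 -> G t = G 0.
Proof.
move=> pG p0 t t01; apply/matrixP => i j; apply: (cprim_const (pG i j)) => //.
by apply: ae_imp p0 => s h /h ->; rewrite mxE.
Qed.

Definition mint1 m n (Phi : R -> 'M[C]_(m, n)) : 'M[C]_(m, n) :=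
  \matrix_(i, j) cint1 (fun t => Phi t i j).

Definition mint m n (Phi : R -> 'M[C]_(m, n)) (t : R) : 'M[C]_(m, n) :=
  \matrix_(i, j) cint (fun s => Phi s i j) t.

Lemma mint0 m n (Phi : R -> 'M[C]_(m, n)) : mint Phi 0 = 0.
Proof. by apply/matrixP => i j; rewrite !mxE cint0. Qed.

Lemma mprim_mint m n (Phi : R -> 'M[C]_(m, n)) :
  (forall i j, cintegrable (fun t => Phi t i j)) -> mprim (mint Phi) Phi.
Proof.
by move=> iP i j; apply: cprim_eq (cprim_cint (iP i j)) _ _ => // t; rewrite mxE.
Qed.

Lemma mprim_mlim1 m n (G Phi : R -> 'M[C]_(m, n)) : mprim G Phi ->
  mlim1 G (G 0 + mint1 Phi).
Proof. by move=> pG i j; rewrite !mxE; exact: cprim_clim1. Qed.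

Lemma mlim1_unique m n (G : R -> 'M[C]_(m, n)) L L' :
  mlim1 G L -> mlim1 G L' -> L = L'.
Proof. by move=> h h'; apply/matrixP => i j; exact: clim1_unique (h i j) (h' i j). Qed.

Lemma mlim1M m n p (G : R -> 'M[C]_(m, n)) (H : R -> 'M[C]_(n, p)) K L :
  mlim1 G K -> mlim1 H L -> mlim1 (fun t => G t *m H t) (K *m L).
Proof.
move=> hG hH i j; rewrite mxE; under eq_fun do rewrite mxE.
by apply: clim1_sum => k; exact: clim1M.
Qed.

Lemma mlim1D m n (G H : R -> 'M[C]_(m, n)) K L :
  mlim1 G K -> mlim1 H L -> mlim1 (fun t => G t + H t) (K + L).
Proof.
by move=> hG hH i j; rewrite mxE; under eq_fun do rewrite mxE; exact: clim1D.
Qed.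

Lemma mlim1_cst m n (M : 'M[C]_(m, n)) : mlim1 (fun=> M) M.
Proof. by move=> i j; exact: clim1_cst. Qed.

End MatrixPrimitives.

End ComplexPrimitives.

(** * The weighted space *)

Section StepFunctions.
Context {R : realType}.
Local Notation C := R[i].
Local Notation Re := (@complex.Re R).
Local Notation Im := (@complex.Im R).
Local Notation I01 := (`[0, 1[%classic : set R).
Variables (n : nat) (n_gt0 : (0 < n)%N).

Definition step_index (t : R) : nat := Num.truncn (n%:R * t).

Lemma step_indexE t k : 0 <= t ->
  (step_index t == k) = (k%:R / n%:R <= t < k.+1%:R / n%:R).
Proof.
move=> t0; have n0 : 0 < n%:R :> R by rewrite ltr0n.
by rewrite /step_index truncn_eq ?mulr_ge0// ler_pdivrMr// ltr_pdivlMr// [t * _]mulrC.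
Qed.

Lemma step_index_lt t : I01 t -> (step_index t < n)%N.
Proof.
rewrite /= in_itv /= => /andP[t0 t1]; have n0 : 0 < n%:R :> R by rewrite ltr0n.
by rewrite truncn_lt_nat ?mulr_ge0// gtr_pMr.
Qed.

Lemma measurable_step (F : nat -> R) : measurable_fun I01 (fun t => F (step_index t)).
Proof.
move=> _ Y mY.
rewrite (_ : _ `&` _ = \bigcup_(k in [set k | Y (F k)])
   (I01 `&` `[k%:R / n%:R, k.+1%:R / n%:R[%classic)).
  by apply: bigcup_measurable => k _; apply: measurableI.
apply/seteqP; split => t.
  move=> [It Yt]; exists (step_index t) => //; split => //.
  rewrite /= in_itv /= -step_indexE//.
  by move: It; rewrite /= in_itv /= => /andP[].
move=> [k Yk [It]]; rewrite /= in_itv /= -step_indexE; last first.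
  by move: It; rewrite /= in_itv /= => /andP[].
by move=> /eqP tk; split => //=; rewrite tk.
Qed.

Lemma step_bounded (F : nat -> R) :
  exists M : R, forall t, I01 t -> F (step_index t) <= M.
Proof.
exists (\sum_(k < n) `|F k|) => t /step_index_lt h.
rewrite (bigD1 (Ordinal h)) //= (le_trans (ler_norm _))// lerDl.
exact: sumr_ge0.
Qed.

Lemma cmeasurable_step (F : nat -> C) : cmeasurable (fun t => F (step_index t)).
Proof.
split; first exact: (measurable_step (fun k => Re (F k))).
exact: (measurable_step (fun k => Im (F k))).
Qed.

Lemma cbounded_step (F : nat -> C) : cbounded (fun t => F (step_index t)).
Proof. exact: (step_bounded (fun k => absq (F k))). Qed.

End StepFunctions.

Section WeightForm.
Context {R : realType}.
Local Notation C := R[i].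
Local Notation Re := (@complex.Re R).
Local Notation Im := (@complex.Im R).
Local Open Scope sesquilinear_scope.

Definition colsq (u : 'cV[C]_2) : R := absq (u 0 0) + absq (u 1 0).

Lemma colsq_ge0 u : 0 <= colsq u.
Proof. by rewrite addr_ge0 ?absq_ge0. Qed.

Lemma colsq_eq0 u : colsq u = 0 -> u = 0.
Proof.
move=> /eqP; rewrite paddr_eq0 ?absq_ge0// => /andP[/eqP/absq_eq0 h0 /eqP/absq_eq0 h1].
apply/matrixP => i j; rewrite !mxE ord1.
have : i \in [:: 0; 1] by case: i => -[|[|]].
by rewrite !inE => /orP[] /eqP ->.
Qed.

Definition wform (b : C) (u v : 'cV[C]_2) : C := (u^t* *m weight b *m v) 0 0.

Lemma wformE (b : C) (u v : 'cV[C]_2) : wform b u v =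
  (2 * (1 - absq b))^-1%:C%C * (
   (1 + absq b)%:C%C * (Num.conj (u 0 0) * v 0 0 + Num.conj (u 1 0) * v 1 0)
   - 2 * (b * (Num.conj (u 0 0) * v 1 0) + Num.conj b * (Num.conj (u 1 0) * v 0 0))).
Proof.
rewrite /wform !mxE !big_ord_recl !big_ord0 !mxE !big_ord_recl !big_ord0 !mxE /=.
rewrite !normC_sqr -!rmorphB -!rmorphD.
have -> : (2 : C) = (2 : R)%:C%C by rewrite rmorph_nat.
rewrite -!rmorphM -fmorphV.
have -> : lift (0 : 'I_2) 0 = 1 by apply/val_inj.
have -> : (ord0 : 'I_2) = 0 by apply/val_inj.
by rewrite /=; ring.
Qed.

(** Completing squares gives two squared moduli, so that positivity for [absq b < 1] becomes
    visible. *)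
Lemma wform_sqE (b : C) (u : 'cV[C]_2) : Re (wform b u u) =
  (2 * (1 - absq b))^-1 * (absq (u 0 0 - b * u 1 0) + absq (u 1 0 - Num.conj b * u 0 0)).
Proof.
rewrite wformE; move: (u 0 0) (u 1 0) => x y.
rewrite ReM /= mul0r subr0; congr (_ * _).
have two_re : Re (2 : C) = 2 by rewrite -[2 : C](rmorph_nat (real_complex R)).
have two_im : Im (2 : C) = 0 by rewrite -[2 : C](rmorph_nat (real_complex R)).
move: two_re two_im; move: (2 : C) => two two_re two_im.
rewrite ReD ReN !(ReM, ReD, ImM, ImD, ReJ, ImJ) two_re two_im /absq.
rewrite !(ReD, ImD, ReN, ImN, ReM, ImM, ReJ, ImJ) /=.
by ring.
Qed.

Lemma absq_lt1_gt0 (b : C) : absq b < 1 -> 0 < 2 * (1 - absq b).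
Proof. by move=> b1; rewrite mulr_gt0// subr_gt0. Qed.

Lemma wform_sq_ge0 (b : C) (u : 'cV[C]_2) : absq b < 1 -> 0 <= Re (wform b u u).
Proof.
move=> b1; rewrite wform_sqE; apply: mulr_ge0; last by apply: addr_ge0; exact: absq_ge0.
by rewrite invr_ge0 ltW// absq_lt1_gt0.
Qed.

Lemma wform_sq_upper (b : C) (u : 'cV[C]_2) : absq b < 1 ->
  Re (wform b u u) <= 2 / (1 - absq b) * colsq u.
Proof.
move=> b1; have b0 := absq_ge0 b; have d0 : 0 < 1 - absq b by rewrite subr_gt0.
rewrite wform_sqE /colsq; move: (u 0 0) (u 1 0) => x y.
have h1 := absqD_le x (- (b * y)); have h2 := absqD_le y (- (Num.conj b * x)).
have N z : absq (- z) = absq z by rewrite /absq ReN ImN !sqrrN.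
rewrite !N !absqM absqJ in h1 h2.
have := absq_ge0 x; have := absq_ge0 y => y0 x0.
have i0 : 0 <= (1 - absq b)^-1 by rewrite invr_ge0 ltW.
have hS : absq (x - b * y) + absq (y - Num.conj b * x) <= 4 * (absq x + absq y).
  by nra.
by rewrite invfM; have := ler_wpM2l i0 hS; lra.
Qed.

(** With [p] and [q] the two combinations of [wform_sqE], inverting a system of determinant
    [1 - absq b] gives [(1 - absq b) x = p + b q], and likewise for [y]. *)
Lemma wform_sq_lower (b : C) (u : 'cV[C]_2) : absq b < 1 ->
  colsq u <= 8 / (1 - absq b) * Re (wform b u u).
Proof.
move=> b1; have b0 := absq_ge0 b; have d0 : 0 < 1 - absq b by rewrite subr_gt0.
rewrite wform_sqE /colsq; move: (u 0 0) (u 1 0) => x y.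
set p := x - b * y; set q := y - Num.conj b * x.
have bb : b * Num.conj b = (absq b)%:C%C.
  by apply: complex_eqP; rewrite /absq ?(ReM, ImM) ReJ ImJ /=; ring.
have ob : (1 - absq b)%:C%C = 1 - b * Num.conj b by rewrite bb rmorphB rmorph1.
have hx : (1 - absq b)%:C%C * x = p + b * q.
  by rewrite /p /q ob; ring.
have hy : (1 - absq b)%:C%C * y = q + Num.conj b * p.
  by rewrite /p /q ob; ring.
have sx : (1 - absq b) ^+ 2 * absq x <= 2 * (absq p + absq b * absq q).
  have := absqD_le p (b * q); rewrite -hx !absqM; apply: le_trans.
  by rewrite /absq /= expr0n addr0.
have sy : (1 - absq b) ^+ 2 * absq y <= 2 * (absq q + absq b * absq p).
  have := absqD_le q (Num.conj b * p); rewrite -hy !absqM absqJ; apply: le_trans.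
  by rewrite /absq /= expr0n addr0.
have := absq_ge0 p; have := absq_ge0 q => q0 p0.
rewrite (_ : 8 / (1 - absq b) * _ = 4 * (absq p + absq q) / (1 - absq b) ^+ 2); last first.
  by field; rewrite gt_eqF.
rewrite ler_pdivlMr ?exprn_gt0// mulrC mulrDr.
by nra.
Qed.

Lemma weight_herm (b : C) : (weight b)^t* = weight b.
Proof.
have cr (x : R) : Num.conj (x%:C%C : C) = x%:C%C by exact: conjc_real.
have c2 : Num.conj (2 : C) = 2 by rewrite rmorph_nat.
apply/matrixP => i j; rewrite !mxE normC_sqr.
have -> : (2 * (1 - (absq b)%:C%C) : C)^-1 = ((2 * (1 - absq b))^-1)%:C%C.
  by rewrite fmorphV rmorphM rmorphB rmorph_nat rmorph1.
have -> : 1 + (absq b)%:C%C = (1 + absq b)%:C%C :> C.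
  by apply: complex_eqP; rewrite ?ReD ?ImD /= ?addr0.
rewrite rmorphM /= cr; congr (_ * _).
by case: (i == 0); case: (j == 0); rewrite ?cr ?rmorphM /= ?rmorphN /= ?c2 ?conjCK.
Qed.

End WeightForm.

Lemma cmeasurable_sum {R : realType} m (F : 'I_m -> R -> R[i]) :
  (forall i, cmeasurable (F i)) -> cmeasurable (fun t => \sum_i F i t).
Proof.
elim: m F => [|m IH] F mF.
  by under eq_fun do rewrite big_ord0; exact: cmeasurable_cst.
by under eq_fun do rewrite big_ord_recl; apply: cmeasurableD => //; exact: IH.
Qed.

Section WeightedSpace.
Context {R : realType}.
Local Notation C := R[i].
Local Notation Re := (@complex.Re R).
Local Notation Im := (@complex.Im R).
Local Notation mu := (@lebesgue_measure R).
Local Notation I01 := (`[0, 1[%classic : set R).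
Local Notation fct := (R -> 'cV[C]_2).
Local Open Scope sesquilinear_scope.
Variables (n : nat) (n_gt0 : (0 < n)%N) (beta : nat -> C).
Hypothesis beta_lt1 : forall k, (k < n)%N -> absq (beta k) < 1.
Local Notation b := (fun t : R => beta (step_index n t)).
Implicit Types (g h u v : fct).

Definition vsquare_integrable g := forall i, square_integrable (fun t => g t i 0).

Lemma step_absq_lt1 t : I01 t -> absq (b t) < 1.
Proof. by move=> It; apply: beta_lt1; exact: step_index_lt. Qed.

Lemma vsquare_integrable_mul (F : nat -> 'M[C]_2) g : vsquare_integrable g ->
  vsquare_integrable (fun t => F (step_index n t) *m g t).
Proof.
move=> sg i; rewrite (_ : (fun t => _) =
  (fun t => \sum_j F (step_index n t) i j * g t j 0)); last first.
  by apply/funext => t; rewrite mxE.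
apply: square_integrable_sum => j; apply: bounded_square_integrableM => //.
- exact: (cmeasurable_step n_gt0 (fun k => F k i j)).
- exact: (cbounded_step n_gt0 (fun k => F k i j)).
Qed.

Lemma vsquare_integrable_dot u v : vsquare_integrable u -> vsquare_integrable v ->
  cintegrable (fun t => ((u t)^t* *m v t) 0 0).
Proof.
move=> su sv; rewrite (_ : (fun t => _) =
  (fun t => \sum_j Num.conj (u t j 0) * v t j 0)); last first.
  by apply/funext => t; rewrite mxE; apply: eq_bigr => j _; rewrite !mxE.
apply: cintegrable_sum => j; apply: square_integrableM => //.
exact: square_integrableJ.
Qed.

Lemma vsquare_integrable_wdot u v : vsquare_integrable u -> vsquare_integrable v ->
  cintegrable (wdot b u v).
Proof.
move=> su sv.
have := vsquare_integrable_dot su (vsquare_integrable_mul (fun k => weight (beta k)) sv).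
by rewrite /wdot; under eq_fun do rewrite mulmxA.
Qed.

(** The constant is uniform because [beta] is evaluated only at the finitely many indices below
    [n]. *)
Lemma colsq_le_wdot : exists2 K : R, 0 < K &
  forall g t, I01 t -> colsq (g t) <= K * Re (wdot b g g t).
Proof.
have [M MP] := step_bounded n_gt0 (fun k => 8 / (1 - absq (beta k))).
exists (`|M| + 1); first by rewrite ltr_wpDl.
move=> g t It; apply: le_trans (wform_sq_lower _ (step_absq_lt1 It)) _.
apply: ler_wpM2r; first exact: wform_sq_ge0 (step_absq_lt1 It).
by apply: le_trans (MP t It) _; apply: ler_wpDr => //; exact: ler_norm.
Qed.

Lemma wdot_le_colsq : exists2 K : R, 0 < K &
  forall g t, I01 t -> Re (wdot b g g t) <= K * colsq (g t).
Proof.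
have [M MP] := step_bounded n_gt0 (fun k => 2 / (1 - absq (beta k))).
exists (`|M| + 1); first by rewrite ltr_wpDl.
move=> g t It; apply: le_trans (wform_sq_upper _ (step_absq_lt1 It)) _.
apply: ler_wpM2r; first exact: colsq_ge0.
by apply: le_trans (MP t It) _; apply: ler_wpDr => //; exact: ler_norm.
Qed.

Lemma wdot_sq_ge0 g t : I01 t -> 0 <= Re (wdot b g g t).
Proof. by move=> It; exact: wform_sq_ge0 (step_absq_lt1 It). Qed.

Lemma integral_norm_wdot_sq g :
  (\int[mu]_(t in I01) `|(Re (wdot b g g t))%:E| =
   \int[mu]_(t in I01) (Re (wdot b g g t))%:E)%E.
Proof.
apply: eq_integral => t; rewrite inE => It /=.
by rewrite ger0_norm// wdot_sq_ge0.
Qed.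

Lemma L2W_P g : L2W b g <-> vsquare_integrable g.
Proof.
split=> [[mg ig] i|sg].
  have mg' j : cmeasurable (fun t => g t j 0) by exact: mg.
  have [K K0 KP] := colsq_le_wdot.
  have mw : measurable_fun I01 (fun t => Re (wdot b g g t)).
    rewrite (_ : (fun t => _) = (fun t => Re (\sum_j (\sum_k Num.conj (g t k 0) *
        weight (beta (step_index n t)) k j) * g t j 0))); last first.
      apply/funext => t; rewrite /wdot mxE; congr Re; apply: eq_bigr => j _.
      by rewrite mxE; congr (_ * _); apply: eq_bigr => k _; rewrite !mxE.
    suff [] : cmeasurable (fun t => \sum_j (\sum_k Num.conj (g t k 0) *
        weight (beta (step_index n t)) k j) * g t j 0) by [].
    have mW k j : cmeasurable (fun t => weight (beta (step_index n t)) k j).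
      exact: (cmeasurable_step n_gt0 (fun m => weight (beta m) k j)).
    apply: cmeasurable_sum => j; apply: cmeasurableM => //.
    by apply: cmeasurable_sum => k; apply: cmeasurableM => //; exact: cmeasurableJ.
  split; first exact: mg'.
  apply: (@le_integrableR _ _ _ (fun t => K * Re (wdot b g g t))) => //.
  - exact: measurable_absq.
  - move=> t It; rewrite ger0_norm ?absq_ge0//; apply: le_trans (KP g t It).
    have : i \in [:: 0; 1] by case: i => -[|[|]].
    by rewrite !inE => /orP[] /eqP ->; rewrite /colsq ?lerDl ?lerDr absq_ge0.
  - apply: RintegrableZ => //; apply/integrableP; split; first exact/measurable_EFinP.
    by rewrite integral_norm_wdot_sq.
split; first by move=> i; have [[m1 m2] _] := sg i.
have [iw _] := vsquare_integrable_wdot sg sg.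
have /integrableP[_] := iw; apply: le_lt_trans; apply: ge0_le_integral => //.
- by move=> t It; rewrite lee_fin wdot_sq_ge0.
- exact: measurable_int iw.
- by apply: measurableT_comp => //; exact: measurable_int iw.
- by move=> t It; rewrite /= lee_fin ler_norm.
Qed.

Lemma L2W_wdot u v : L2W b u -> L2W b v -> cintegrable (wdot b u v).
Proof. by move=> /L2W_P su /L2W_P sv; exact: vsquare_integrable_wdot. Qed.

Lemma L2WD u v : L2W b u -> L2W b v -> L2W b (u + v).
Proof.
move=> /L2W_P su /L2W_P sv; apply/L2W_P => i.
rewrite (_ : (fun t => _) = (fun t => u t i 0 + v t i 0)); last first.
  by apply/funext => t; rewrite mxE.
exact: square_integrableD.
Qed.

Lemma L2WZ (c : C) u : L2W b u -> L2W b (c *: u).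
Proof.
move=> /L2W_P su; apply/L2W_P => i.
rewrite (_ : (fun t => _) = (fun t => c * u t i 0)); last first.
  by apply/funext => t; rewrite mxE.
apply: (@bounded_square_integrableM _ (fun=> c) (fun t => u t i 0)) => //.
by exists (absq c).
Qed.

Lemma L2WB u v : L2W b u -> L2W b v -> L2W b (u - v).
Proof.
move=> su sv; rewrite -scaleN1r; apply: L2WD => //; exact: L2WZ.
Qed.

Lemma ipWE u v : ipW b u v = cint1 (wdot b u v). Proof. by []. Qed.

Lemma cint1D (f g : R -> C) : cintegrable f -> cintegrable g ->
  cint1 (fun t => f t + g t) = cint1 f + cint1 g.
Proof.
move=> [f1 f2] [g1 g2]; apply: complex_eqP; rewrite ?ReD ?ImD /=.
  by rewrite (funext (fun t => ReD (f t) (g t))) RintegralD.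
by rewrite (funext (fun t => ImD (f t) (g t))) RintegralD.
Qed.

Lemma cint1Z (c : C) (f : R -> C) : cintegrable f ->
  cint1 (fun t => c * f t) = c * cint1 f.
Proof.
move=> [f1 f2]; have i1 r : mu.-integrable I01 (EFin \o (fun t => r * Re (f t))).
  exact: RintegrableZ.
have i2 r : mu.-integrable I01 (EFin \o (fun t => r * Im (f t))).
  exact: RintegrableZ.
apply: complex_eqP; rewrite ?ReM ?ImM /=.
  by rewrite (funext (fun t => ReM c (f t))) RintegralB// !RintegralZl.
by rewrite (funext (fun t => ImM c (f t))) RintegralD// !RintegralZl.
Qed.

Lemma ipWDr u v w : L2W b u -> L2W b v -> L2W b w ->
  ipW b u (v + w) = ipW b u v + ipW b u w.
Proof.
move=> hu hv hw; rewrite !ipWE -cint1D; [|exact: L2W_wdot..].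
by congr cint1; apply/funext => t; rewrite /wdot mulmxDr mxE.
Qed.

Lemma ipWDl u v w : L2W b u -> L2W b v -> L2W b w ->
  ipW b (u + v) w = ipW b u w + ipW b v w.
Proof.
move=> hu hv hw; rewrite !ipWE -cint1D; [|exact: L2W_wdot..].
congr cint1; apply/funext => t; rewrite /wdot.
by rewrite linearD /= map_mxD !mulmxDl mxE.
Qed.

Lemma ipWZr (c : C) u v : L2W b u -> L2W b v -> ipW b u (c *: v) = c * ipW b u v.
Proof.
move=> hu hv; rewrite !ipWE -cint1Z; last exact: L2W_wdot.
by congr cint1; apply/funext => t; rewrite /wdot -scalemxAr mxE.
Qed.

Lemma ipWZl (c : C) u v : L2W b u -> L2W b v ->
  ipW b (c *: u) v = Num.conj c * ipW b u v.
Proof.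
move=> hu hv; rewrite !ipWE -cint1Z; last exact: L2W_wdot.
congr cint1; apply/funext => t; rewrite /wdot.
have -> : ((c *: u) t)^t* = Num.conj c *: (u t)^t*.
  by apply/matrixP => i j; rewrite !mxE rmorphM.
by rewrite -!scalemxAl mxE.
Qed.

Lemma hnorm_ge0 u : 0 <= hnorm (ipW b) u.
Proof. exact: sqrtr_ge0. Qed.

Lemma hnorm_sqE u : hnorm (ipW b) u ^+ 2 = (\int[mu]_(t in I01) Re (wdot b u u t))%R.
Proof. by rewrite sqr_sqrtr//; apply: Rintegral_ge0 => t; exact: wdot_sq_ge0. Qed.

Lemma hnorm_ae0 u : L2W b u -> {ae mu, forall t, I01 t -> u t = 0} ->
  hnorm (ipW b) u = 0.
Proof.
move=> hu u0; apply/eqP; rewrite -sqrf_eq0 hnorm_sqE; apply/eqP.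
rewrite -[RHS](mul0r (fine (mu I01))) -Rintegral_cst//.
apply: Rintegral_ae_eq => //; first by case: (L2W_wdot hu hu).
  exact: integrable_I01_cst.
by apply: ae_imp u0 => t h /h ut; rewrite /wdot ut mulmx0 mxE.
Qed.

Lemma hnorm_eq0_ae u : L2W b u -> hnorm (ipW b) u = 0 ->
  {ae mu, forall t, I01 t -> u t = 0}.
Proof.
move=> hu /eqP; rewrite -sqrf_eq0 hnorm_sqE => /eqP h0.
have [iw _] := L2W_wdot hu hu.
have : (\int[mu]_(t in I01) `|(Re (wdot b u u t))%:E| = 0)%E.
  rewrite integral_norm_wdot_sq -[LHS]fineK; first by congr EFin.
  exact: integrable_fin_num.
move/(iffLR (ae_eq_integral_abs mu (measurable_itv _) (measurable_int _ iw))).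
have [K K0 KP] := colsq_le_wdot.
apply: ae_imp => t h It; have {}h := h It.
apply: colsq_eq0; apply/eqP; rewrite eq_le colsq_ge0 andbT.
apply: le_trans (KP u t It) _; case: h => ->.
by rewrite mulr0.
Qed.

End WeightedSpace.

(** * The fundamental matrix *)

Section ClampedPrimitives.
Context {R : realType}.
Local Notation C := R[i].
Local Notation Re := (@complex.Re R).
Local Notation Im := (@complex.Im R).

Lemma lipschitz_abs_continuous (f : R -> R) (M a c : R) :
  (forall x y, x <= y -> `|f y - f x| <= M * (y - x)) -> abs_continuous f a c.
Proof.
move=> fM e e0; have M1 : 0 < `|M| + 1 by rewrite ltr_wpDl.
exists (e / (`|M| + 1)); first by rewrite divr_gt0.
move=> m u v uv _; rewrite ltr_pdivlMr// => len.
apply: le_lt_trans len; rewrite mulr_suml; apply: ler_sum => i _.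
have [_ [uvi _]] := uv i; apply: le_trans (fM _ _ uvi) _.
rewrite mulrC; apply: ler_wpM2l; first by rewrite subr_ge0.
by apply: ler_wpDr => //; exact: ler_norm.
Qed.

Lemma derive1_near_cst (f : R -> R) (c t : R) : (\forall s \near t, f s = c) ->
  derive1 f t = 0.
Proof.
move=> fc; rewrite derive1E (near_eq_derive (g := cst c))//.
exact: derive_cst.
Qed.

(** The extreme value and mean value theorems make [f] Lipschitz on [[a, c]], so the clamped
    function is Lipschitz on the line; off the two points [a] and [c] its derivative is [f'] inside
    and 0 outside. *)
Lemma prim_clamp (f f' : R -> R) a c : a <= c ->
  (forall x, is_derive x (1 : R) f (f' x)) -> continuous f' ->
  prim (fun t => f (clamp a c t)) (fun t => \1_(`[a, c[%classic : set R) t * f' t).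
Proof.
move=> ac df cf'.
have [x0 _ x0P] : exists2 x0, x0 \in `[a, c] & forall t, t \in `[a, c] -> `|f' t| <= `|f' x0|.
  apply: (@EVT_max _ (fun t => `|f' t|)) => //.
  apply: continuous_subspaceT => x; apply: continuous_comp; first exact: cf'.
  exact: norm_continuous.
set M := `|f' x0| in x0P.
have lipf x y : a <= x -> x <= y -> y <= c -> `|f y - f x| <= M * (y - x).
  move=> ax xy yc.
  have [|t txy ->] := MVT_segment xy (fun t _ => df t).
    apply: continuous_subspaceT => t; apply: differentiable_continuous.
    by apply/derivable1_diffP; case: (df t).
  rewrite normrM [ `|y - x|]ger0_norm ?subr_ge0//.
  apply: ler_wpM2r; first by rewrite subr_ge0.
  apply: x0P; move: txy; rewrite !in_itv /= => /andP[xt ty].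
  by rewrite (le_trans ax xt) (le_trans ty yc).
apply: loc_abs_continuous_prim.
- move=> d _; apply: (@lipschitz_abs_continuous _ M) => x y xy.
  have /andP[h1 h2] := clamp_itv x ac; have /andP[h3 h4] := clamp_itv y ac.
  apply: le_trans (lipf _ _ h1 (clamp_homo _ _ xy) h4) _.
  by apply: ler_wpM2l; [exact: normr_ge0|exact: clamp_contract].
- apply: (@le_integrableR _ _ _ (fun=> M)) => //; last exact: integrable_I01_cst.
    apply: measurable_funM; first exact: measurable_indic.
    apply: measurable_funTS; exact: continuous_measurable_fun.
  move=> t _; rewrite indicE; case: (boolP (t \in _)) => [|_]; last first.
    by rewrite mul0r normr0 normr_ge0.
  rewrite inE /= in_itv /= mul1r => /andP[h1 h2]; apply: x0P.
  by rewrite in_itv /= h1 ltW.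
- apply: ae_imp (ae_and (ae_neq a) (ae_neq c)) => t [ta tc] _.
  rewrite indicE; have [lta|gta] := ltP t a.
    rewrite memNset ?mul0r; last by rewrite /= in_itv /= leNgt lta.
    apply: (@derive1_near_cst _ (f a)); near=> s.
    have sa : s <= a by near: s; exact: lt_le_nbhsl.
    by rewrite /clamp max_l// ge_min sa.
  have {gta}ta' : a < t by rewrite lt_neqAle eq_sym ta.
  have [ltc|gtc] := ltP t c.
    rewrite mem_set ?mul1r; last by rewrite /= in_itv /= ltW.
    rewrite derive1E (near_eq_derive (g := f)); first by case: (df t).
    near=> s; rewrite clamp_id//; apply/andP; split.
      by near: s; exact: lt_le_nbhsr.
    by near: s; exact: lt_le_nbhsl.
  have {gtc}tc' : c < t by rewrite lt_neqAle eq_sym tc.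
  rewrite memNset ?mul0r; last by rewrite /= in_itv /= (ltNge t c) (ltW tc') andbF.
  apply: (@derive1_near_cst _ (f c)); near=> s.
  have sa : c <= s by near: s; exact: lt_le_nbhsr.
  by rewrite /clamp min_r// max_r.
Unshelve. all: by end_near. Qed.

Lemma clamp_cvg1 (f : R -> R) a c : continuous f ->
  f (clamp a c t) @[t --> 1^'-] --> f (clamp a c 1).
Proof.
move=> cf; apply: cvg_at_left_filter.
apply: continuous_comp; last exact: cf.
apply: continuous_max; first exact: cst_continuous.
apply: continuous_min; last exact: cst_continuous.
exact: cvg_id.
Qed.

(* [cexp c s] is e^(c s), with the real variable [s] as a separate argument. *)
Definition cexp (c : C) (s : R) : C :=
  (expR (Re c * s) * cos (Im c * s) +i* (expR (Re c * s) * sin (Im c * s)))%C.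

Lemma cexp0 (c : C) : cexp c 0 = 1.
Proof. by rewrite /cexp !mulr0 expR0 cos0 sin0 mulr0 mul1r. Qed.

Lemma cexpD (c d : C) (s : R) : cexp (c + d) s = cexp c s * cexp d s.
Proof.
apply: complex_eqP; rewrite ?ReM ?ImM /= ReD ImD !mulrDl expRD ?cosD ?sinD; ring.
Qed.

Lemma cexpDr (c : C) (s t : R) : cexp c (s + t) = cexp c s * cexp c t.
Proof.
apply: complex_eqP; rewrite ?ReM ?ImM /= !mulrDr expRD ?cosD ?sinD; ring.
Qed.

Lemma cexpN (c : C) (s : R) : cexp (- c) s * cexp c s = 1.
Proof.
by rewrite -cexpD addNr /cexp /= !mul0r expR0 cos0 sin0 mulr0 mul1r.
Qed.

Lemma cexp_neq0 (c : C) (s : R) : cexp c s != 0.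
Proof.
apply/eqP => h; have := cexpN c s; rewrite h mulr0 => /eqP.
by rewrite eq_sym oner_eq0.
Qed.

Lemma is_derive_linear (p x : R) : is_derive x (1 : R) (fun s : R => p * s) p.
Proof.
have H : is_derive x (1 : R) (p \*: (@id R)) (p *: (1 : R)) by apply: is_deriveZ.
by rewrite /GRing.scale /= mulr1 in H.
Qed.

Lemma is_derive_exp_linear (p x : R) :
  is_derive x (1 : R) (fun s => expR (p * s)) (p * expR (p * x)).
Proof.
have := is_derive1_comp (is_derive_expR (p * x)) (is_derive_linear p x).
by rewrite mulrC.
Qed.

Lemma is_derive_cos_linear (q x : R) :
  is_derive x (1 : R) (fun s => cos (q * s)) (- q * sin (q * x)).
Proof.
have := is_derive1_comp (is_derive_cos (q * x)) (is_derive_linear q x).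
by rewrite mulNr mulrC -mulNr.
Qed.

Lemma is_derive_sin_linear (q x : R) :
  is_derive x (1 : R) (fun s => sin (q * s)) (q * cos (q * x)).
Proof.
have := is_derive1_comp (is_derive_sin (q * x)) (is_derive_linear q x).
by rewrite mulrC.
Qed.

Lemma is_derive_cexp_Re (c : C) (x : R) :
  is_derive x (1 : R) (fun s => Re (cexp c s)) (Re (c * cexp c x)).
Proof.
have := is_derive_mul (is_derive_exp_linear (Re c) x) (is_derive_cos_linear (Im c) x).
by rewrite ReM /= => H; apply: is_derive_eq; ring.
Qed.

Lemma is_derive_cexp_Im (c : C) (x : R) :
  is_derive x (1 : R) (fun s => Im (cexp c s)) (Im (c * cexp c x)).
Proof.
have := is_derive_mul (is_derive_exp_linear (Re c) x) (is_derive_sin_linear (Im c) x).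
by rewrite ImM /= => H; apply: is_derive_eq; ring.
Qed.

Lemma is_derive_continuous (f f' : R -> R) :
  (forall x, is_derive x (1 : R) f (f' x)) -> continuous f.
Proof.
move=> df t; apply: differentiable_continuous.
by apply/derivable1_diffP; case: (df t).
Qed.

Lemma continuous_cexp_Re (c : C) : continuous (fun s => Re (cexp c s)).
Proof. exact: is_derive_continuous (is_derive_cexp_Re c). Qed.

Lemma continuous_cexp_Im (c : C) : continuous (fun s => Im (cexp c s)).
Proof. exact: is_derive_continuous (is_derive_cexp_Im c). Qed.

Lemma continuous_scale_cexp_Re (c d : C) : continuous (fun s => Re (d * cexp c s)).
Proof.
rewrite (funext (fun s => ReM d (cexp c s))) => t.
by apply: cvgB; apply: cvgM; (exact: cvg_cst || exact: continuous_cexp_Re || exact: continuous_cexp_Im).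
Qed.

Lemma continuous_scale_cexp_Im (c d : C) : continuous (fun s => Im (d * cexp c s)).
Proof.
rewrite (funext (fun s => ImM d (cexp c s))) => t.
by apply: cvgD; apply: cvgM; (exact: cvg_cst || exact: continuous_cexp_Re || exact: continuous_cexp_Im).
Qed.

Lemma cprim_cexp_clamp (c : C) (a d : R) : a <= d ->
  cprim (fun t => cexp c (clamp a d t))
    (fun t => (\1_(`[a, d[%classic : set R) t : R)%:C%C * (c * cexp c t)).
Proof.
move=> ad; split.
  have H := @prim_clamp (fun s => Re (cexp c s)) (fun s => Re (c * cexp c s)) a d ad (is_derive_cexp_Re c) (@continuous_scale_cexp_Re c c).
  apply: (prim_eq H) => // t.
  by rewrite [RHS]ReM /= mul0r subr0.
have H := @prim_clamp (fun s => Im (cexp c s)) (fun s => Im (c * cexp c s)) a d ad (is_derive_cexp_Im c) (@continuous_scale_cexp_Im c c).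
apply: (prim_eq H) => // t.
by rewrite [RHS]ImM /= mul0r addr0.
Qed.

Lemma clim1_cexp_clamp (c : C) (a d : R) :
  clim1 (fun t => cexp c (clamp a d t)) (cexp c (clamp a d 1)).
Proof.
split; first exact: (@clamp_cvg1 (fun s => Re (cexp c s)) a d (@continuous_cexp_Re c)).
exact: (@clamp_cvg1 (fun s => Im (cexp c s)) a d (@continuous_cexp_Im c)).
Qed.

End ClampedPrimitives.

(** * Matrices of the Dirac system *)

Section TwoByTwo.
Context {R : realType}.
Local Notation C := R[i].
Local Open Scope sesquilinear_scope.

Lemma ord2_cases (P : 'I_2 -> Prop) : P 0 -> P 1 -> forall i, P i.
Proof.
move=> p0 p1 i; have : i \in [:: 0; 1] by case: i => -[|[|]].
by rewrite !inE => /orP[] /eqP ->.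
Qed.

Lemma sum2E (F : 'I_2 -> C) : \sum_i F i = F 0 + F 1.
Proof.
rewrite !big_ord_recl big_ord0 addr0; congr (_ + F _); exact/val_inj.
Qed.

Lemma mx2_mul (a b c d a' b' c' d' : C) : mx2 a b c d *m mx2 a' b' c' d' =
  mx2 (a * a' + b * c') (a * b' + b * d') (c * a' + d * c') (c * b' + d * d').
Proof.
apply/matrixP => i j; rewrite !mxE sum2E !mxE /=.
by elim/ord2_cases: i; elim/ord2_cases: j.
Qed.

Lemma mx2_mul_cv (a b c d x y : C) : mx2 a b c d *m cv2 x y =
  cv2 (a * x + b * y) (c * x + d * y).
Proof.
apply/matrixP => i j; rewrite !mxE sum2E !mxE /=.
by elim/ord2_cases: i.
Qed.

Lemma mx2_scale (k a b c d : C) : k *: mx2 a b c d = mx2 (k * a) (k * b) (k * c) (k * d).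
Proof.
apply/matrixP => i j; rewrite !mxE /=.
by elim/ord2_cases: i; elim/ord2_cases: j.
Qed.

Lemma mx2_tr (a b c d : C) : (mx2 a b c d)^T = mx2 a c b d.
Proof.
apply/matrixP => i j; rewrite !mxE /=.
by elim/ord2_cases: i; elim/ord2_cases: j.
Qed.

Lemma mx2_opp (a b c d : C) : - mx2 a b c d = mx2 (- a) (- b) (- c) (- d).
Proof.
apply/matrixP => i j; rewrite !mxE /=.
by elim/ord2_cases: i; elim/ord2_cases: j.
Qed.

Lemma mx2_1 : mx2 1 0 0 1 = 1%:M :> 'M[C]_2.
Proof.
apply/matrixP => i j; rewrite !mxE /=.
by elim/ord2_cases: i; elim/ord2_cases: j.
Qed.

Lemma cv2_scale (k x y : C) : k *: cv2 x y = cv2 (k * x) (k * y).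
Proof. by apply/matrixP => i j; rewrite !mxE; elim/ord2_cases: i. Qed.

Lemma cv2_eta (v : 'cV[C]_2) : v = cv2 (v 0 0) (v 1 0).
Proof. by apply/matrixP => i j; rewrite !mxE ord1; elim/ord2_cases: i. Qed.

Lemma i_sq : 'i * 'i = -1 :> C.
Proof. by rewrite -expr2 sqrCi. Qed.

(* D = diag(-i, i), so that the equation tau g = f reads g' = D^-1 W f. *)
Definition dmat : 'M[C]_2 := mx2 (- 'i) 0 0 'i.
Definition dinv : 'M[C]_2 := mx2 'i 0 0 (- 'i).
Definition jmat : 'M[C]_2 := mx2 0 (- 1) 1 0.
Definition dirac_coef (b : C) : 'M[C]_2 := dinv *m weight b.
Definition tmat (b : C) : 'M[C]_2 := mx2 1 b (Num.conj b) 1.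
Definition tinv (b : C) : 'M[C]_2 :=
  (1 - `|b| ^+ 2)^-1 *: mx2 1 (- b) (- Num.conj b) 1.

Lemma dmatK : dinv *m dmat = 1%:M.
Proof.
by rewrite mx2_mul -mx2_1 !(mulr0, mul0r, addr0, add0r, mulrN, mulNr) i_sq opprK.
Qed.

Lemma dinvK : dmat *m dinv = 1%:M.
Proof. exact: mulmx1C dmatK. Qed.

Lemma jmatK : (- jmat) *m jmat = 1%:M.
Proof.
by rewrite mx2_opp mx2_mul -mx2_1 !(mulr0, mul0r, addr0, add0r, oppr0, opprK, mulr1, mulN1r).
Qed.

Lemma one_sub_normC (b : C) : 1 - `|b| ^+ 2 = (1 - absq b)%:C%C.
Proof. by rewrite normC_sqr; apply: complex_eqP; rewrite ?ReD ?ImD ?ReN ?ImN /= ?subr0. Qed.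

Lemma one_sub_normC_neq0 (b : C) : absq b < 1 -> 1 - `|b| ^+ 2 != 0.
Proof.
move=> b1; rewrite one_sub_normC fmorph_eq0 gt_eqF//.
by rewrite subr_gt0.
Qed.

Lemma conj_mul_normC (b : C) : b * Num.conj b = `|b| ^+ 2.
Proof. by rewrite normCK. Qed.

Lemma tmatK (b : C) : absq b < 1 -> tmat b *m tinv b = 1%:M.
Proof.
move=> /one_sub_normC_neq0 b1; rewrite /tinv -scalemxAr mx2_mul mx2_scale -mx2_1.
have := conj_mul_normC b => bb.
by congr mx2; field: bb; rewrite b1.
Qed.

(** The columns of [tmat b] are eigenvectors of the coefficient, with eigenvalues ['i / 2] and
    [- 'i / 2] whatever [b] is. Hence the same diagonal exponential [emat] serves on every
    interval. *)
Lemma dirac_coef_tmat (b : C) : absq b < 1 ->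
  dirac_coef b *m tmat b = 2^-1 *: (tmat b *m dinv).
Proof.
move=> /one_sub_normC_neq0 b1; rewrite /dirac_coef /weight -mulmxA -scalemxAl.
rewrite -scalemxAr !mx2_mul !mx2_scale.
have := conj_mul_normC b => bb.
have b2 : (2 : C) != 0 by rewrite pnatr_eq0.
by congr mx2; field: bb; rewrite b1.
Qed.

(** For 2 by 2 matrices, [A^T J = - J A] is the condition that [A] has trace zero. *)
Lemma dirac_coef_trace0 (b : C) : (dirac_coef b)^T *m jmat = - (jmat *m dirac_coef b).
Proof.
rewrite /dirac_coef /weight -scalemxAr mx2_mul mx2_scale mx2_tr !mx2_mul mx2_opp.
by congr mx2; ring.
Qed.

Lemma weightK (b : C) : absq b < 1 ->
  (2 / (1 - `|b| ^+ 2)) *: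
    (mx2 (1 + `|b| ^+ 2) (2 * b) (2 * Num.conj b) (1 + `|b| ^+ 2) *m weight b) = 1%:M.
Proof.
move=> /one_sub_normC_neq0 b1; rewrite /weight -scalemxAr mx2_mul !mx2_scale -mx2_1.
have := conj_mul_normC b => bb.
have b2 : (2 : C) != 0 by rewrite pnatr_eq0.
by congr mx2; field: bb; rewrite b1.
Qed.

Lemma dirac_eqP (b : C) (f d : 'cV[C]_2) : absq b < 1 ->
  f = (2 / (1 - `|b| ^+ 2)) *:
    (mx2 (1 + `|b| ^+ 2) (2 * b) (2 * Num.conj b) (1 + `|b| ^+ 2) *m
       mx2 (- 'i) 0 0 'i *m d) <->
  d = dirac_coef b *m f.
Proof.
move=> b1; rewrite -/dmat; set X := mx2 (1 + _) _ _ _.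
have XW := weightK b1; rewrite -/X in XW.
have WX : weight b *m ((2 / (1 - `|b| ^+ 2)) *: X) = 1%:M.
  by apply: mulmx1C; rewrite -scalemxAl.
split=> ->.
  rewrite /dirac_coef -!mulmxA scalemxAl [weight b *m _]mulmxA WX mul1mx.
  by rewrite mulmxA dmatK mul1mx.
rewrite /dirac_coef -!mulmxA [dmat *m _]mulmxA dinvK mul1mx.
by rewrite mulmxA scalemxAl XW mul1mx.
Qed.

(* e^(s z D^-1 / 2) *)
Definition emat (z : C) (s : R) : 'M[C]_2 :=
  mx2 (cexp (z * 'i / 2) s) 0 0 (cexp (- (z * 'i / 2)) s).

Lemma emat0 z : emat z 0 = 1%:M.
Proof. by rewrite /emat !cexp0 mx2_1. Qed.

Lemma ematD z s t : emat z (s + t) = emat z s *m emat z t.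
Proof. by rewrite /emat mx2_mul !cexpDr !(mulr0, mul0r, addr0, add0r). Qed.

Lemma ematK z s : emat z s *m emat z (- s) = 1%:M.
Proof. by rewrite -ematD subrr emat0. Qed.

End TwoByTwo.

Section FundamentalMatrix.
Context {R : realType}.
Local Notation C := R[i].

Lemma intertwine_scale (z : C) (A T B E F : 'M[C]_2) : A *m T = 2^-1 *: (T *m B) ->
  T *m ((z / 2) *: (B *m E)) *m F = z *: (A *m (T *m E *m F)).
Proof.
by move=> AT; rewrite !mulmxA AT -scalemxAr -!scalemxAl scalerA !mulmxA.
Qed.

Lemma bool1C : ((true%:R : R)%:C)%C = 1 :> C. Proof. by []. Qed.
Lemma bool0C : ((false%:R : R)%:C)%C = 0 :> C. Proof. by []. Qed.

Local Notation I01 := (`[0, 1[%classic : set R).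
Variables (n : nat) (n_gt0 : (0 < n)%N) (beta : nat -> C).
Hypothesis beta_lt1 : forall k, (k < n)%N -> absq (beta k) < 1.
Variable z : C.

Let node (k : nat) : R := k%:R / n%:R.

Let n0 : 0 < n%:R :> R. Proof. by rewrite ltr0n. Qed.

Let node_le k : node k <= node k.+1.
Proof. by rewrite ler_pM2r ?invr_gt0// ler_nat. Qed.

Let node_ge0 k : 0 <= node k.
Proof. by rewrite divr_ge0. Qed.

Let node_le1 k : (k <= n)%N -> node k <= 1.
Proof. by move=> kn; rewrite ler_pdivrMr// mul1r ler_nat. Qed.

(* Clamping the time to the k-th interval makes this the identity before that
   interval and constant after it, so that the fundamental matrix is a plain
   product of the pieces. *)
Definition propagator_piece (k : nat) (t : R) : 'M[C]_2 :=
  tmat (beta k) *m emat z (clamp (node k) (node k.+1) t) *m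
    (emat z (- node k) *m tinv (beta k)).

Fixpoint propagator (m : nat) (t : R) : 'M[C]_2 :=
  if m is m'.+1 then propagator_piece m' t *m propagator m' t else 1%:M.

Lemma mprim_propagator_piece k : (k < n)%N ->
  mprim (propagator_piece k) (fun t =>
    (\1_(`[node k, node k.+1[%classic : set R) t : R)%:C%C *:
      (z *: (dirac_coef (beta k) *m propagator_piece k t))).
Proof.
move=> kn; set X := fun t => (\1_(`[node k, node k.+1[%classic : set R) t : R)%:C%C : C.
have pe : mprim (fun t => emat z (clamp (node k) (node k.+1) t))
    (fun t => X t *: ((z / 2) *: (dinv *m emat z t))).
  have h c : cprim (fun t => cexp c (clamp (node k) (node k.+1) t))
      (fun t => X t * (c * cexp c t)).
    exact: (cprim_cexp_clamp c (node_le k)).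
  move=> i j; rewrite /emat /dinv.
  elim/ord2_cases: i; elim/ord2_cases: j.
  - apply: (cprim_eq (h (z * 'i / 2))) => t;
      rewrite ?mx2_mul !mxE //=; ring.
  - apply: (cprim_eq (cprim_cst 0)) => t;
      rewrite ?mx2_mul !mxE //=; ring.
  - apply: (cprim_eq (cprim_cst 0)) => t;
      rewrite ?mx2_mul !mxE //=; ring.
  - apply: (cprim_eq (h (- (z * 'i / 2)))) => t;
      rewrite ?mx2_mul !mxE //=; ring.
have H := mprimM (mprimM (mprim_cst (tmat (beta k))) pe)
  (mprim_cst (emat z (- node k) *m tinv (beta k))).
apply: (mprim_eq H) => // t.
rewrite mulmx0 addr0 mul0mx add0r /propagator_piece /X indicE.
(* Outside the interval the indicator annihilates both sides; inside, the clamped time is [t]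
   itself. *)
have [tI|_] := boolP (t \in _); last first.
  by rewrite bool0C !scale0r mulmx0 mul0mx.
rewrite bool1C !scale1r clamp_id; last first.
  by move: tI; rewrite inE /= in_itv /= => /andP[-> /ltW].
exact: (intertwine_scale z (emat z t) _ (dirac_coef_tmat (beta_lt1 kn))).
Qed.

Lemma propagator_piece_before k t : (k < n)%N -> t <= node k ->
  propagator_piece k t = 1%:M.
Proof.
move=> kn tk; rewrite /propagator_piece /clamp max_l; last by rewrite ge_min tk.
by rewrite -mulmxA [X in _ *m X]mulmxA ematK mul1mx tmatK// beta_lt1.
Qed.

(** Before the node [m] the new factor is the identity; between the nodes [m] and [m + 1] the
    earlier factors are constant and only the new one contributes to the derivative; afterwards all
    factors are constant. *)
Lemma mprim_propagator m : (m <= n)%N ->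
  exists2 Phi, mprim (propagator m) Phi & forall t, I01 t ->
    Phi t = if t < node m
      then z *: (dirac_coef (beta (step_index n t)) *m propagator m t) else 0.
Proof.
elim: m => [|m IH] mn.
  exists (fun=> 0); first exact: mprim_cst.
  by move=> t; rewrite /= in_itv /node /= mul0r => /andP[t0 _]; rewrite ltNge t0.
have [Phi pP PhiE] := IH (ltnW mn).
exists (fun t => (\1_(`[node m, node m.+1[%classic : set R) t : R)%:C%C *:
      (z *: (dirac_coef (beta m) *m propagator_piece m t)) *m propagator m t
      + propagator_piece m t *m Phi t).
  exact: (mprimM (mprim_propagator_piece mn) pP).
move=> t It; rewrite PhiE//; have t0 : 0 <= t.
  by move: It; rewrite /= in_itv /= => /andP[].
have [tm|mt] := ltP t (node m).
  rewrite (lt_le_trans tm (node_le m)) indicE memNset; last first.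
    by rewrite /= in_itv /= leNgt tm.
  rewrite bool0C scale0r mul0mx add0r /= propagator_piece_before ?ltW// !mul1mx//.
rewrite mulmx0 addr0 indicE.
have [tm|mt'] := ltP t (node m.+1).
  rewrite mem_set; last by rewrite /= in_itv /= mt.
  have /eqP -> : step_index n t == m by rewrite step_indexE// -/(node m) mt.
  rewrite bool1C scale1r -[propagator m.+1 t]/(propagator_piece m t *m propagator m t).
  move: (propagator_piece m t) (propagator m t) (dirac_coef _) => P Q A.
  by rewrite -scalemxAl mulmxA.
rewrite memNset; last by rewrite /= in_itv /= ltNge mt' andbF.
by rewrite bool0C scale0r mul0mx.
Qed.

Lemma propagator0 m : (m <= n)%N -> propagator m 0 = 1%:M.
Proof.
elim: m => [//|m IH] mn /=.
by rewrite propagator_piece_before// IH ?mulmx1// ltnW.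
Qed.

Lemma mlim1_propagator m : mlim1 (propagator m) (propagator m 1).
Proof.
elim: m => [|m IH] /=; first exact: mlim1_cst.
apply: mlim1M IH; apply: mlim1M; last exact: mlim1_cst.
apply: mlim1M; first exact: mlim1_cst.
move=> i j; rewrite !mxE; under eq_fun do rewrite mxE.
by elim/ord2_cases: i; elim/ord2_cases: j => /=;
  (exact: clim1_cexp_clamp || exact: clim1_cst).
Qed.

Lemma propagator_piece1 k : (k < n)%N -> propagator_piece k 1 =
  tmat (beta k) *m emat z n%:R^-1 *m tinv (beta k).
Proof.
move=> kn; rewrite /propagator_piece.
have -> : clamp (node k) (node k.+1) 1 = n%:R^-1 + node k.
  rewrite /clamp min_r ?node_le1// max_r//.
  by rewrite /node -natr1 mulrDl mul1r addrC.
by rewrite ematD -!mulmxA [emat z (node k) *m _]mulmxA ematK mul1mx.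
Qed.

End FundamentalMatrix.

(** * Resolvent and eigenvalues *)

Section Resolvent.
Context {R : realType}.
Local Notation C := R[i].
Local Notation Re := (@complex.Re R).
Local Notation Im := (@complex.Im R).
Local Notation mu := (@lebesgue_measure R).
Local Notation I01 := (`[0, 1[%classic : set R).
Local Notation fct := (R -> 'cV[C]_2).

Lemma integrable_eq_in (f g : R -> R) : mu.-integrable I01 (EFin \o f) ->
  (forall t, I01 t -> f t = g t) -> mu.-integrable I01 (EFin \o g).
Proof.
move=> if_ fg; apply: eq_integrable if_ => //= t.
by rewrite inE => It; rewrite fg.
Qed.

Lemma prim_eq_in (f phi psi : R -> R) : prim f phi ->
  (forall t, I01 t -> phi t = psi t) -> prim f psi.
Proof.
move=> pf pp; apply: prim_ae (pf) _ _.
  exact: integrable_eq_in pf.1 pp.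
by exists set0; split => // t /= /not_implyP[It /(_ (pp t It))].
Qed.

Lemma mprim_eq_in m p (G Phi Psi : R -> 'M[C]_(m, p)) : mprim G Phi ->
  (forall t, I01 t -> Phi t = Psi t) -> mprim G Psi.
Proof.
move=> pG pp i j; have [h1 h2] := pG i j; split.
  by apply: prim_eq_in h1 _ => t It; rewrite pp.
by apply: prim_eq_in h2 _ => t It; rewrite pp.
Qed.

Lemma mprim_tr m p (G Phi : R -> 'M[C]_(m, p)) : mprim G Phi ->
  mprim (fun t => (G t)^T) (fun t => (Phi t)^T).
Proof.
by move=> pG i j; apply: cprim_eq (pG j i) _ _ => t; rewrite mxE.
Qed.

Lemma mlim1_left_lim1 (g : fct) l : mlim1 g l <-> left_lim1 g l.
Proof.
split=> [h i|h i j]; first exact: h i 0.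
by rewrite ord1; exact: h i.
Qed.

(** Expand the nonnegative integral of [(|f| - c)^2], where [c] is the mean of [|f|] on a space of
    measure 1. *)
Lemma norm_integral_sq_le (f : R -> R) : measurable_fun I01 f ->
  mu.-integrable I01 (EFin \o (fun t => f t ^+ 2)) ->
  (\int[mu]_(t in I01) `|f t|)%R ^+ 2 <= (\int[mu]_(t in I01) f t ^+ 2)%R.
Proof.
move=> mf if2.
have i1 : mu.-integrable I01 (EFin \o (fun t => `|f t|)).
  apply: (@le_integrableR _ _ _ (fun t => 1 + f t ^+ 2)) => //.
  - by apply: measurableT_comp => //; exact: measurable_normr.
  - move=> t _; rewrite normr_id ler_norml.
    have h1 := sqr_ge0 (f t + 1); have h2 := sqr_ge0 (f t - 1); have h3 := sqr_ge0 (f t).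
    by apply/andP; split; nra.
  - by apply: RintegrableD => //; exact: integrable_I01_cst.
set c := (\int[mu]_(t in I01) `|f t|)%R.
have : 0 <= (\int[mu]_(t in I01) (f t ^+ 2 + (- (2 * c) * `|f t| + c ^+ 2)))%R.
  apply: Rintegral_ge0 => t _; rewrite -[f t ^+ 2]real_normK ?num_real//.
  by have := sqr_ge0 (`|f t| - c); rewrite sqrrB; lra.
have i2 : mu.-integrable I01 (EFin \o (fun t => - (2 * c) * `|f t|)).
  exact: RintegrableZ.
have i3 := integrable_I01_cst (c ^+ 2).
rewrite RintegralD//; last exact: RintegrableD.
rewrite RintegralD// RintegralZl// Rintegral_cst// -/c.
by rewrite [X in fine X]mu_I01 /= mulr1; lra.
Qed.

(** Turns parallelism to [(b1, 1)] into one scalar linear equation, which can be solved and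
    estimated. *)
Definition end_form (b1 : C) (v : 'cV[C]_2) : C := v 0 0 - b1 * v 1 0.

Lemma end_formD b1 u v : end_form b1 (u + v) = end_form b1 u + end_form b1 v.
Proof. by rewrite /end_form !mxE; ring. Qed.

Lemma end_formZ b1 c u : end_form b1 (c *: u) = c * end_form b1 u.
Proof. by rewrite /end_form !mxE; ring. Qed.

Lemma parallel_end_form b1 v : parallel v (cv2 b1 1) <-> end_form b1 v = 0.
Proof.
split=> [[c ->]|h]; first by rewrite end_formZ /end_form !mxE /=; ring.
exists (v 1 0); rewrite [LHS]cv2_eta cv2_scale mulr1; congr cv2.
by move: h; rewrite /end_form => /eqP; rewrite subr_eq0 mulrC => /eqP.
Qed.

Variables (n : nat) (n_gt0 : (0 < n)%N) (beta : nat -> C).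
Hypothesis beta_lt1 : forall k, (k < n)%N -> absq (beta k) < 1.
Local Notation b := (fun t : R => beta (step_index n t)).
Local Notation A := (fun t : R => dirac_coef (beta (step_index n t))).

Lemma b1E : b 1 = beta n.
Proof. by rewrite /step_index mulr1 natrK. Qed.

(** The derivative is expressed through [f] because [tau b g] is determined only almost everywhere;
    [f] is square integrable, so [A f] is integrable up to 1. *)
Lemma dirac_domain_mprim g f : loc_ac_fct g -> vsquare_integrable f ->
  ae_eq01 f (tau b g) -> mprim g (fun t => A t *m f t).
Proof.
move=> acg sf fg i j; rewrite ord1.
have sAf := vsquare_integrable_mul n_gt0 (fun k => dirac_coef (beta k)) sf i.
have [i1 i2] := square_integrable_integrable sAf.
have dg : {ae mu, forall t, I01 t -> deriv_fct g t = A t *m f t}.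
  apply: ae_imp fg => t h It; apply/dirac_eqP; last exact: h.
  exact: (step_absq_lt1 n_gt0 beta_lt1).
have [ac1 ac2] := acg i.
split.
  by apply: (loc_abs_continuous_prim ac1) => //; apply: ae_imp dg => t h /h <-; rewrite mxE.
by apply: (loc_abs_continuous_prim ac2) => //; apply: ae_imp dg => t h /h <-; rewrite mxE.
Qed.

Lemma mprim_dirac_domain g f : mprim g (fun t => A t *m f t) ->
  [/\ loc_ac_fct g, vsquare_integrable g & ae_eq01 f (tau b g)].
Proof.
move=> pg; split.
- by move=> i; have [p1 p2] := pg i 0; split;
    [exact: prim_loc_abs_continuous p1|exact: prim_loc_abs_continuous p2].
- move=> i; apply: bounded_square_integrable.
    exact: cprim_measurable (pg i 0).
  exact: cprim_bounded (pg i 0).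
- have [p00 p01] := pg 0 0; have [p10 p11] := pg 1 0.
  apply: ae_imp (ae_and (ae_and (prim_derivable p00) (prim_derivable p01))
    (ae_and (prim_derivable p10) (prim_derivable p11))).
  move=> t [[h1 h2] [h3 h4]] It.
  apply/dirac_eqP; first exact: (step_absq_lt1 n_gt0 beta_lt1).
  apply/matrixP => i j; rewrite ord1 [LHS]mxE.
  have [[_ e1] [_ e2]] := (h1 It, h2 It); have [[_ e3] [_ e4]] := (h3 It, h4 It).
  by elim/ord2_cases: i; apply: complex_eqP.
Qed.

Variable z : C.
Local Notation U := (propagator n beta z n).
(* The coefficient has trace zero, hence det U = 1 and U^-1 = - J U^T J. *)
Local Notation Y := (fun t => (- jmat) *m (U t)^T *m jmat).

Lemma mprim_U : mprim U (fun t => z *: (A t *m U t)).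
Proof.
have [Phi pU PhiE] := mprim_propagator n_gt0 beta_lt1 z (leqnn n).
apply: mprim_eq_in pU _ => t It; rewrite PhiE// divff ?pnatr_eq0 -?lt0n//.
by move: It; rewrite /= in_itv /= => /andP[_ ->].
Qed.

Lemma adjoint_intertwine (B V J J' : 'M[C]_2) : B^T *m J = - (J *m B) ->
  J' *m (V^T *m B^T) *m J = - (J' *m V^T *m J *m B).
Proof. by move=> e; rewrite -!mulmxA e !mulmxN. Qed.

Lemma mprim_Y : mprim Y (fun t => - z *: (Y t *m A t)).
Proof.
have H := mprimM (mprimM (mprim_cst (- jmat)) (mprim_tr mprim_U)) (mprim_cst (@jmat R)).
apply: (mprim_eq H) => // t.
rewrite mul0mx add0r mulmx0 addr0 linearZ /= trmx_mul -scalemxAr -scalemxAl scaleNr -scalerN.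
congr (_ *: _); exact/adjoint_intertwine/dirac_coef_trace0.
Qed.

Lemma U0 : U 0 = 1%:M.
Proof. exact: propagator0. Qed.

Lemma Y0 : Y 0 = 1%:M.
Proof. by rewrite /= U0 trmx1 mulmx1 jmatK. Qed.

Lemma YU t : I01 t -> Y t *m U t = 1%:M.
Proof.
move=> It; have H := mprimM mprim_Y mprim_U.
rewrite (mprim_const H) ?Y0 ?U0 ?mul1mx//.
exists set0; split => // s /= /not_implyP[Is]; case.
by rewrite -scalemxAl -scalemxAr scaleNr -mulmxA addNr.
Qed.

Lemma UY t : I01 t -> U t *m Y t = 1%:M.
Proof. by move=> It; apply: mulmx1C; exact: YU. Qed.

(** The integrand [U^-1 A h] of the variation of constants formula for [g' = A (z g + h)]. *)
Definition source (h : fct) (t : R) : 'cV[C]_2 := Y t *m (A t *m h t).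

Lemma source_integrable h : vsquare_integrable h ->
  forall i j, cintegrable (fun t => source h t i j).
Proof.
move=> sh i j; rewrite ord1.
rewrite (_ : (fun t => _) = (fun t => \sum_k Y t i k * (A t *m h t) k 0)); last first.
  by apply/funext => t; rewrite mxE.
apply: cintegrable_sum => k; apply: square_integrableM.
  apply: bounded_square_integrable; first exact: cprim_measurable (mprim_Y i k).
  exact: cprim_bounded (mprim_Y i k).
exact: (vsquare_integrable_mul n_gt0 (fun k => dirac_coef (beta k)) sh).
Qed.

Lemma variation_of_constants (B V V' : 'M[C]_2) (v k : 'cV[C]_2) :
  V *m V' = 1%:M ->
  z *: (B *m V) *m v + V *m (0 + V' *m (B *m k)) = B *m (z *: (V *m v) + k).
Proof.
move=> VV; rewrite add0r mulmxA VV mul1mx mulmxDr -scalemxAr -scalemxAl.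
by rewrite mulmxA.
Qed.

Lemma cancel_homogeneous (B V' : 'M[C]_2) (v k w : 'cV[C]_2) :
  - z *: (V' *m B) *m v + V' *m (B *m (z *: v + k)) +
    (0 *m w + - 1%:M *m (V' *m (B *m k))) = 0.
Proof.
rewrite mul0mx add0r mulNmx mul1mx !mulmxDr -!scalemxAr -scalemxAl scaleNr.
by rewrite !mulmxA addrA addNr add0r subrr.
Qed.

Lemma recover_solution (V V' : 'M[C]_2) (v w : 'cV[C]_2) : V *m V' = 1%:M ->
  v = V *m (V' *m v + - 1%:M *m w + w).
Proof. by move=> VV; rewrite mulNmx mul1mx subrK mulmxA VV mul1mx. Qed.

Lemma solution_exists h c : vsquare_integrable h ->
  mprim (fun t => U t *m (c + mint (source h) t))
    (fun t => A t *m (z *: (U t *m (c + mint (source h) t)) + h t)).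
Proof.
move=> sh; have pw := mprim_mint (source_integrable sh).
have H := mprimM mprim_U (mprimD (mprim_cst c) pw).
apply: mprim_eq_in H _ => t It.
exact: variation_of_constants (UY It).
Qed.

(** [Y g] minus the integral of the source has derivative zero, so it keeps its initial value [g 0];
    the subtraction is encoded as a product with [- 1%:M]. *)
Lemma solution_unique h g : vsquare_integrable h ->
  mprim g (fun t => A t *m (z *: g t + h t)) ->
  forall t, I01 t -> g t = U t *m (g 0 + mint (source h) t).
Proof.
move=> sh pg t It; have pw := mprim_mint (source_integrable sh).
have H := mprimD (mprimM mprim_Y pg) (mprimM (mprim_cst (- 1%:M)) pw).
have t01 : 0 <= t < 1 by move: It; rewrite /= in_itv.
have := mprim_const H _ t01; rewrite Y0 mint0 mulmx0 addr0 mul1mx => <-.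
  exact: recover_solution (UY It).
exists set0; split => // s /= /not_implyP[Is]; case.
exact: cancel_homogeneous.
Qed.

Lemma mlim1_solution h c : vsquare_integrable h ->
  mlim1 (fun t => U t *m (c + mint (source h) t)) (U 1 *m (c + mint1 (source h))).
Proof.
move=> sh; apply: mlim1M; first exact: mlim1_propagator.
apply: mlim1D; first exact: mlim1_cst.
have := mprim_mlim1 (mprim_mint (source_integrable sh)).
by rewrite mint0 add0r.
Qed.


Definition l2sq (u : fct) : R := (\int[mu]_(t in I01) colsq (u t))%R.

Lemma colsq_integrable u : vsquare_integrable u ->
  mu.-integrable I01 (EFin \o (fun t => colsq (u t))).
Proof. by move=> su; apply: RintegrableD => //; [exact: (su 0).2|exact: (su 1).2]. Qed.

Lemma l2sq_ge0 u : 0 <= l2sq u.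
Proof. by apply: Rintegral_ge0 => t _; exact: colsq_ge0. Qed.

Lemma colsq_mulmx (M : R -> 'M[C]_2) : (forall i j, cbounded (fun t => M t i j)) ->
  exists2 K : R, 0 < K & forall t v, I01 t -> colsq (M t *m v) <= K * colsq v.
Proof.
move=> bM; have [K00 h00] := bM 0 0; have [K01 h01] := bM 0 1.
have [K10 h10] := bM 1 0; have [K11 h11] := bM 1 1.
exists (2 * (`|K00| + `|K01| + `|K10| + `|K11|) + 1).
  by rewrite ltr_wpDl// mulr_ge0// !addr_ge0.
move=> t v It; rewrite /colsq !mxE !sum2E.
have := absq_ge0 (v 0 0); have := absq_ge0 (v 1 0).
have := absqD_le (M t 0 0 * v 0 0) (M t 0 1 * v 1 0).
have := absqD_le (M t 1 0 * v 0 0) (M t 1 1 * v 1 0).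
rewrite !absqM.
have := le_trans (h00 t It) (ler_norm _); have := le_trans (h01 t It) (ler_norm _).
have := le_trans (h10 t It) (ler_norm _); have := le_trans (h11 t It) (ler_norm _).
have := normr_ge0 K00; have := normr_ge0 K01.
have := normr_ge0 K10; have := normr_ge0 K11.
have := absq_ge0 (M t 0 0); have := absq_ge0 (M t 0 1).
have := absq_ge0 (M t 1 0); have := absq_ge0 (M t 1 1).
move: (absq (M t 0 0)) (absq (M t 0 1)) (absq (M t 1 0)) (absq (M t 1 1)).
move: `|K00| `|K01| `|K10| `|K11| (absq (v 0 0)) (absq (v 1 0)).
move: (absq (_ + _)) (absq (_ + _)) => e1 e2 k00 k01 k10 k11 x y m00 m01 m10 m11.
move=> p11 p10 p01 p00 q11 q10 q01 q00 r11 r10 r01 r00 s1 s2 y0 x0.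
have a00 : m00 * x <= k00 * x by rewrite ler_wpM2r.
have a01 : m01 * y <= k01 * y by rewrite ler_wpM2r.
have a10 : m10 * x <= k10 * x by rewrite ler_wpM2r.
have a11 : m11 * y <= k11 * y by rewrite ler_wpM2r.
have := mulr_ge0 q00 y0; have := mulr_ge0 q10 y0.
have := mulr_ge0 q01 x0; have := mulr_ge0 q11 x0.
by lra.
Qed.

Lemma sq_initial_integral_le (f : R -> R) t : 0 <= t < 1 -> measurable_fun I01 f ->
  mu.-integrable I01 (EFin \o f) ->
  mu.-integrable I01 (EFin \o (fun t => f t ^+ 2)) ->
  (\int[mu]_(s in `[0, t]) f s)%R ^+ 2 <= (\int[mu]_(s in I01) f s ^+ 2)%R.
Proof.
move=> t01 mf if_ if2; apply: le_trans (norm_integral_sq_le mf if2).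
have it := integrable_initial t01 if_.
rewrite -[leLHS]real_normK ?num_real// lerXn2r ?nnegrE ?Rintegral_ge0//.
apply: le_trans (le_normr_Rintegral _ it) _ => //.
have if' := Rintegrable_norm if_.
rewrite /Rintegral; apply: fine_le.
- by apply: integrable_fin_num => //; exact: integrable_initial t01 if'.
- exact: integrable_fin_num.
- apply: ge0_subset_integral => //.
    exact: measurable_int if'.
  move=> s; rewrite /= !in_itv /= => /andP[-> st] /=.
  by case/andP: t01 => _; exact: le_lt_trans.
Qed.

Lemma sq_integral_le (f : R -> R) : measurable_fun I01 f ->
  mu.-integrable I01 (EFin \o f) ->
  mu.-integrable I01 (EFin \o (fun t => f t ^+ 2)) ->
  (\int[mu]_(s in I01) f s)%R ^+ 2 <= (\int[mu]_(s in I01) f s ^+ 2)%R.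
Proof.
move=> mf if_ if2; apply: le_trans (norm_integral_sq_le mf if2).
rewrite -[leLHS]real_normK ?num_real// lerXn2r ?nnegrE ?Rintegral_ge0//.
exact: le_normr_Rintegral.
Qed.

Lemma square_integrable_parts (f : R -> C) : square_integrable f ->
  mu.-integrable I01 (EFin \o (fun t => Re (f t) ^+ 2)) /\
  mu.-integrable I01 (EFin \o (fun t => Im (f t) ^+ 2)).
Proof.
move=> [[m1 m2] if_]; split; apply: le_integrableR if_ => //; try exact: measurable_funX.
  by move=> t _; rewrite ger0_norm ?sqr_ge0// lerDl sqr_ge0.
by move=> t _; rewrite ger0_norm ?sqr_ge0// lerDr sqr_ge0.
Qed.

Lemma absq_cint_le (f : R -> C) t : 0 <= t < 1 -> square_integrable f ->
  absq (cint f t) <= (\int[mu]_(s in I01) absq (f s))%R.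
Proof.
move=> t01 sf; have [i1 i2] := square_integrable_integrable sf.
have [j1 j2] := square_integrable_parts sf; have [[m1 m2] _] := sf.
by rewrite RintegralD//; apply: lerD; exact: sq_initial_integral_le.
Qed.

Lemma absq_cint1_le (f : R -> C) : square_integrable f ->
  absq (cint1 f) <= (\int[mu]_(s in I01) absq (f s))%R.
Proof.
move=> sf; have [i1 i2] := square_integrable_integrable sf.
have [j1 j2] := square_integrable_parts sf; have [[m1 m2] _] := sf.
by rewrite RintegralD//; apply: lerD; exact: sq_integral_le.
Qed.

Lemma colsq_mint_le (u : fct) t : 0 <= t < 1 -> vsquare_integrable u ->
  colsq (mint u t) <= l2sq u.
Proof.
move=> t01 su; rewrite /colsq !mxE /l2sq RintegralD//; [|exact: (su 0).2|exact: (su 1).2].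
by apply: lerD; exact: absq_cint_le.
Qed.

Lemma colsq_mint1_le (u : fct) : vsquare_integrable u -> colsq (mint1 u) <= l2sq u.
Proof.
move=> su; rewrite /colsq !mxE /l2sq RintegralD//; [|exact: (su 0).2|exact: (su 1).2].
by apply: lerD; exact: absq_cint1_le.
Qed.

Lemma vsquare_integrable_source h : vsquare_integrable h -> vsquare_integrable (source h).
Proof.
move=> sh i.
rewrite (_ : (fun t => _) = (fun t => \sum_k Y t i k * (A t *m h t) k 0)); last first.
  by apply/funext => t; rewrite mxE.
apply: square_integrable_sum => k; apply: bounded_square_integrableM.
- exact: cprim_measurable (mprim_Y i k).
- exact: cprim_bounded (mprim_Y i k).
- exact: (vsquare_integrable_mul n_gt0 (fun k => dirac_coef (beta k)) sh).
Qed.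

Lemma l2sq_source_le : exists2 K : R, 0 < K &
  forall h, vsquare_integrable h -> l2sq (source h) <= K * l2sq h.
Proof.
have [K1 K10 h1] := colsq_mulmx (fun i j => cprim_bounded (mprim_Y i j)).
have [K2 K20 h2] := @colsq_mulmx A
  (fun i j => cbounded_step n_gt0 (fun k => dirac_coef (beta k) i j)).
exists (K1 * K2); first exact: mulr_gt0.
move=> h sh; rewrite /l2sq -RintegralZl//; last exact: colsq_integrable.
apply: le_Rintegral => //.
- exact/colsq_integrable/vsquare_integrable_source.
- by apply: RintegrableZ => //; exact: colsq_integrable.
- move=> t It; apply: le_trans (h1 t _ It) _.
  by rewrite -mulrA ler_pM2l//; exact: h2.
Qed.

Lemma absq_end_form_le b1 v : absq (end_form b1 v) <= 2 * (1 + absq b1) * colsq v.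
Proof.
rewrite /end_form /colsq; have := absqD_le (v 0 0) (- (b1 * v 1 0)).
have -> : absq (- (b1 * v 1 0)) = absq b1 * absq (v 1 0).
  by rewrite -absqM /absq ReN ImN !sqrrN.
have := absq_ge0 b1; have := absq_ge0 (v 0 0); have := absq_ge0 (v 1 0).
move: (absq _) (absq _) (absq _) (absq _) => x y c d.
by move=> x0 y0 c0; have := mulr_ge0 c0 y0; lra.
Qed.

Lemma colsqD_le (u v : 'cV[C]_2) : colsq (u + v) <= 2 * (colsq u + colsq v).
Proof.
rewrite /colsq !mxE; have := absqD_le (u 0 0) (v 0 0).
by have := absqD_le (u 1 0) (v 1 0); lra.
Qed.

Lemma colsqZ (c : C) (u : 'cV[C]_2) : colsq (c *: u) = absq c * colsq u.
Proof. by rewrite /colsq mulrDr -!absqM !mxE. Qed.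

Variable b1 : C.
Let Delta := end_form b1 (U 1 *m cv2 1 1).

(** Write [g 0] as [c] times [(1, 1)]. The end condition reads [c * Delta = - end_form b1 (U 1 *m
    mint1 (source h))], so [c] is controlled by the L2 norm of [h] once [Delta] is nonzero; the
    solution formula then bounds [g] at every point. *)
Lemma solution_bound : Delta != 0 -> exists2 K : R, 0 < K & forall h g l,
  vsquare_integrable h -> mprim g (fun t => A t *m (z *: g t + h t)) ->
  parallel (g 0) (cv2 1 1) -> mlim1 g l -> end_form b1 l = 0 ->
  forall t, I01 t -> colsq (g t) <= K * l2sq h.
Proof.
move=> D0; have [K1 K10 h1] := l2sq_source_le.
have [K2 K20 h2] := colsq_mulmx (fun i j => cprim_bounded (mprim_U i j)).
have [K3 K30 h3] := @colsq_mulmx (fun=> U 1) (fun i j => cprim_bounded (cprim_cst (U 1 i j))).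
have aD : 0 < absq Delta.
  rewrite lt_neqAle absq_ge0 andbT eq_sym; apply: contra D0 => /eqP/absq_eq0 ->//.
(* Collects the bound of the end form, the bound of [U 1] and the division by [Delta]. *)
pose Kc := 2 * (1 + absq b1) * K3 / absq Delta.
have b0 := absq_ge0 b1.
have Kc0 : 0 < Kc by rewrite divr_gt0// !mulr_gt0// ltr_wpDr.
pose e : 'cV[C]_2 := cv2 1 1.
have e0 : 0 <= colsq e := colsq_ge0 e.
(* [X] adds the contributions of the initial value and of the integrated source. *)
have [X X0 XE] : exists2 X : R, 0 < X & X = Kc * colsq e + 1.
  by exists (Kc * colsq e + 1) => //; rewrite ltr_wpDl// mulr_ge0// ltW.
exists (K2 * (2 * (X * K1))); first by rewrite !mulr_gt0.
move=> h g l sh pg [c g0] gl el t It.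
have gE := solution_unique sh pg.
have ss := vsquare_integrable_source sh.
have lE : l = U 1 *m (g 0 + mint1 (source h)).
  (* A limit at 1 depends only on [t] near 1, where [g] is given by the solution formula. *)
  apply: mlim1_unique gl _ => i j.
  have [a1 a2] := mlim1_solution (g 0) sh i j; split.
    apply: cvg_trans a1; apply: near_eq_cvg; near=> s.
    have Is : I01 s.
      rewrite /= in_itv /=; apply/andP; split; near: s; last exact: nbhs_left_lt.
      exact: nbhs_left_ge.
    by rewrite (gE s Is).
  apply: cvg_trans a2; apply: near_eq_cvg; near=> s.
  have Is : I01 s.
    rewrite /= in_itv /=; apply/andP; split; near: s; last exact: nbhs_left_lt.
    exact: nbhs_left_ge.
  by rewrite (gE s Is).
have cD : c * Delta = - end_form b1 (U 1 *m mint1 (source h)).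
  apply/eqP; rewrite -subr_eq0 opprK -end_formZ scalemxAr -g0 -end_formD -mulmxDr.
  by rewrite -lE el.
have ac : absq c <= Kc * l2sq (source h).
  rewrite /Kc mulrAC ler_pdivlMr// -absqM cD.
  rewrite (_ : absq (- _) = absq (end_form b1 (U 1 *m mint1 (source h)))); last first.
    by rewrite /absq ReN ImN !sqrrN.
  apply: le_trans (absq_end_form_le _ _) _; rewrite -!mulrA.
  rewrite ler_pM2l// ler_pM2l ?ltr_wpDr//.
  apply: le_trans (h3 0 _ _) _; first by rewrite /= in_itv /= lexx ltr01.
  by rewrite ler_pM2l//; exact: colsq_mint1_le.
rewrite (gE t It); apply: le_trans (h2 t _ It) _.
rewrite -mulrA ler_pM2l//; apply: le_trans (colsqD_le _ _) _.
rewrite -mulrA ler_pM2l//; have t01 : 0 <= t < 1 by move: It; rewrite /= in_itv.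
apply: (@le_trans _ _ (X * l2sq (source h))); last first.
  by rewrite -mulrA ler_pM2l//; exact: h1.
rewrite XE mulrDl mul1r; apply: lerD; last exact: colsq_mint_le.
by rewrite g0 colsqZ mulrAC ler_wpM2r.
Unshelve. all: by end_near. Qed.


Lemma end_form_solution (h : fct) : Delta != 0 ->
  exists c : C, end_form b1 (U 1 *m (c *: cv2 1 1 + mint1 (source h))) = 0.
Proof.
move=> D0; exists (- end_form b1 (U 1 *m mint1 (source h)) / Delta).
by rewrite mulmxDr -scalemxAr end_formD end_formZ divfK// addNr.
Qed.

Lemma solution_with_initial_value (h : fct) c : vsquare_integrable h ->
  exists g, [/\ mprim g (fun t => A t *m (z *: g t + h t)), g 0 = c &
    mlim1 g (U 1 *m (c + mint1 (source h)))].
Proof.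
move=> sh; exists (fun t => U t *m (c + mint (source h) t)); split.
- exact: solution_exists.
- by rewrite mint0 addr0 U0 mul1mx.
- exact: mlim1_solution.
Qed.

End Resolvent.

Section DiracOperator.
Context {R : realType}.
Local Notation C := R[i].
Local Notation Re := (@complex.Re R).
Local Notation mu := (@lebesgue_measure R).
Local Notation I01 := (`[0, 1[%classic : set R).
Variables (n : nat) (n_gt0 : (0 < n)%N) (beta : nat -> C).
Hypothesis beta_lt1 : forall k, (k < n)%N -> absq (beta k) < 1.
Local Notation b := (fun t : R => beta (step_index n t)).
Local Notation A := (fun t : R => dirac_coef (beta (step_index n t))).
Local Notation H := (L2W b).
Local Notation ip := (ipW b).
Local Notation G := (dirac_op b).

Definition discriminant (z : C) : C :=
  end_form (beta n) (propagator n beta z n 1 *m cv2 1 1).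

Lemma ae_all (P : R -> Prop) : (forall t, P t) -> {ae mu, forall t, P t}.
Proof. by move=> p; exists set0; split => // t /=; case. Qed.

(** The graph is saturated under almost everywhere equality, so boundary conditions make sense only
    for the absolutely continuous representative [g] of [p.1]. *)
Lemma dirac_op_mprim p : G p -> [/\ H p.1, H p.2 & exists g, 
  [/\ ae_eq01 p.1 g, mprim g (fun t => A t *m p.2 t), parallel (g 0) (cv2 1 1) &
    exists2 l, mlim1 g l & end_form (beta n) l = 0]].
Proof.
move=> [H1 H2 [g [acg Lg _ g0 [l gl pl]] [e1 e2]]]; split => //.
exists g; split => //.
- by apply: dirac_domain_mprim e2 => //; apply/(L2W_P n_gt0 beta_lt1).
- exists l; first exact/mlim1_left_lim1.
  by apply/parallel_end_form; move: pl; rewrite b1E.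
Qed.

Lemma mprim_dirac_op g f l : H f -> mprim g (fun t => A t *m f t) ->
  parallel (g 0) (cv2 1 1) -> mlim1 g l -> end_form (beta n) l = 0 -> G (g, f).
Proof.
move=> Hf pg g0 gl el; have [acg sg fg] := mprim_dirac_domain n_gt0 beta_lt1 pg.
have Lg : H g by apply/(L2W_P n_gt0 beta_lt1).
split => //; exists g; last by split => //; apply: ae_all.
split => //; first by exists f.
exists l; first exact/mlim1_left_lim1.
by move/parallel_end_form: el; rewrite b1E.
Qed.

Lemma dirac_op_surj z h : discriminant z != 0 -> H h ->
  exists2 p, G p & p.2 = z *: p.1 + h.
Proof.
move=> D0 Hh; have sh := iffLR (L2W_P n_gt0 beta_lt1 h) Hh.
have [c cE] := end_form_solution h D0.
have [g [pg g0 gl]] := solution_with_initial_value n_gt0 beta_lt1 z (c *: cv2 1 1) sh.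
have [_ sg _] := mprim_dirac_domain n_gt0 beta_lt1 pg.
have Hg := iffRL (L2W_P n_gt0 beta_lt1 g) sg.
have Hf : H (z *: g + h).
  exact: (L2WD n_gt0 beta_lt1 (L2WZ n_gt0 beta_lt1 z Hg) Hh).
exists (g, z *: g + h); last reflexivity.
by apply: (mprim_dirac_op Hf pg _ gl cE); exists c.
Qed.

Lemma hnorm0 : hnorm ip 0 = 0.
Proof.
apply: (hnorm_ae0 n_gt0 beta_lt1); last by apply: ae_all.
apply/(L2W_P n_gt0 beta_lt1) => i; apply: bounded_square_integrable.
  rewrite (_ : (fun t => _) = (fun=> 0)); first exact: cmeasurable_cst.
  by apply/funext => t; rewrite mxE.
by exists 0 => t _; rewrite mxE /absq /= expr0n addr0.
Qed.

Lemma dirac_op_bound z : discriminant z != 0 -> exists M : R, forall p, G p ->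
  hnorm ip p.1 <= M * hnorm ip (p.2 - z *: p.1).
Proof.
move=> D0; have [K K0 KP] := solution_bound n_gt0 beta_lt1 D0.
have [K1 K10 h1] := wdot_le_colsq n_gt0 beta_lt1.
have [K2 K20 h2] := colsq_le_wdot n_gt0 beta_lt1.
(* [K2] bounds the L2 size of [h] by its weighted norm, [K] bounds the solution pointwise and [K1]
   returns to the weighted norm; the root undoes the squares. *)
exists (Num.sqrt (K1 * (K * K2))) => p Gp.
have [H1 H2 [g [pg1 pg g0 [l gl el]]]] := dirac_op_mprim Gp.
pose h := p.2 - z *: p.1.
have Hh : H h := L2WB n_gt0 beta_lt1 H2 (L2WZ n_gt0 beta_lt1 z H1).
have sh := iffLR (L2W_P n_gt0 beta_lt1 h) Hh.
have pg' : mprim g (fun t => A t *m (z *: g t + h t)).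
  have [_ sg _] := mprim_dirac_domain n_gt0 beta_lt1 pg.
  have Hg : H (z *: g + h).
    have Hg := iffRL (L2W_P n_gt0 beta_lt1 g) sg.
    exact: (L2WD n_gt0 beta_lt1 (L2WZ n_gt0 beta_lt1 z Hg) Hh).
  apply: mprim_ae pg _ _.
    move=> i j; rewrite ord1.
    have sgh := iffLR (L2W_P n_gt0 beta_lt1 _) Hg.
    exact/square_integrable_integrable/(vsquare_integrable_mul n_gt0 (fun k => dirac_coef (beta k)) sgh).
  apply: ae_imp pg1 => t e It; congr (_ *m _); rewrite -e// /h.
  by rewrite -[RHS]/(z *: p.1 t + (p.2 t - z *: p.1 t)) [RHS]addrC subrK.
have bound := KP h g l sh pg' g0 gl el.
have l2h : l2sq h <= K2 * hnorm ip h ^+ 2.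
  rewrite (hnorm_sqE n_gt0 beta_lt1) -RintegralZl//; last first.
    by case: (L2W_wdot n_gt0 beta_lt1 Hh Hh).
  apply: le_Rintegral => //.
  - exact: colsq_integrable.
  - by apply: RintegrableZ => //; case: (L2W_wdot n_gt0 beta_lt1 Hh Hh).
  - by move=> t It; exact: h2.
have p1le : hnorm ip p.1 ^+ 2 <= K1 * (K * K2) * hnorm ip h ^+ 2.
  rewrite (hnorm_sqE n_gt0 beta_lt1).
  have [iw _] := L2W_wdot n_gt0 beta_lt1 H1 H1.
  have i2 := integrable_I01_cst (K1 * (K * l2sq h)).
  apply: (@le_trans _ _ (K1 * (K * l2sq h))); last first.
    by rewrite -!mulrA ler_pM2l// ler_pM2l.
  have cE : (\int[mu]_(t in I01) (K1 * (K * l2sq h)))%R = K1 * (K * l2sq h).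
    by rewrite Rintegral_cst// [X in fine X]mu_I01 mulr1.
  rewrite -cE.
  (* [p.1] agrees with [g] only almost everywhere, so the pointwise bound can fail on a null set;
     the minimum with the bound repairs this without changing the integral. *)
  have : {ae mu, forall t, I01 t -> Re (wdot b p.1 p.1 t) = Num.min (Re (wdot b p.1 p.1 t)) (K1 * (K * l2sq h))}.
    apply: ae_imp pg1 => t e It; rewrite min_l//.
    apply: le_trans (h1 p.1 t It) _; rewrite ler_pM2l// e//.
    exact: bound.
  move=> aeE.
  have im : mu.-integrable I01 (EFin \o (fun t => Num.min (Re (wdot b p.1 p.1 t)) (K1 * (K * l2sq h)))).
    apply: (le_integrableR _ _ _ iw) => //.
      apply: measurable_minr => //; apply/measurable_EFinP; exact: measurable_int iw.
    move=> t It; rewrite ger0_norm ?ge_min ?lexx//.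
    rewrite le_min (wdot_sq_ge0 n_gt0 beta_lt1)//= mulr_ge0 ?mulr_ge0 ?l2sq_ge0// ltW//.
  rewrite (Rintegral_ae_eq _ iw im aeE)//; apply: le_Rintegral => // t _.
  by rewrite ge_min lexx orbT.
rewrite -(@ler_pXn2r _ 2)// ?nnegrE ?mulr_ge0 ?sqrtr_ge0//.
have sq : Num.sqrt (K1 * (K * K2)) ^+ 2 = K1 * (K * K2).
  by rewrite sqr_sqrtr// mulr_ge0 ?mulr_ge0// ltW.
by rewrite exprMn sq.
Qed.

Lemma dirac_op_resolvent z : discriminant z != 0 -> resolvent_set H ip G z.
Proof.
move=> D0; have [M MP] := dirac_op_bound D0; split.
- move=> h Hh; have [p Gp pE] := dirac_op_surj D0 Hh; exists p => //.
  have -> : p.2 - z *: p.1 - h = 0 by rewrite pE [z *: _ + h]addrC addrK subrr.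
  exact: hnorm0.
- move=> p Gp p0; apply/eqP; rewrite eq_le hnorm_ge0 andbT.
  by have := MP p Gp; rewrite p0 mulr0.
- by exists M.
Qed.

(** The eigenfunction is [U] applied to [(1, 1)]. It vanishes nowhere on [[0, 1)] because [U] is
    invertible there, so its norm could be zero only if [[0, 1)] were a null set. *)
Lemma dirac_op_eigenvalue z : discriminant z = 0 -> ~ resolvent_set H ip G z.
Proof.
move=> D0 [_ inj _]; pose g t := propagator n beta z n t *m cv2 1 1.
have pg : mprim g (fun t => A t *m (z *: g t)).
  have H0 := mprimM (mprim_U n_gt0 beta_lt1 z) (mprim_cst (cv2 1 1)).
  apply: (mprim_eq H0) => // t; rewrite mulmx0 addr0 /g.
  by rewrite -scalemxAl -scalemxAr mulmxA.
have Hg : H g.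
  by apply/(L2W_P n_gt0 beta_lt1); have [] := mprim_dirac_domain n_gt0 beta_lt1 pg.
have gl : mlim1 g (propagator n beta z n 1 *m cv2 1 1).
  by apply: mlim1M; [exact: mlim1_propagator|exact: mlim1_cst].
have Gp : G (g, z *: g).
  apply: (mprim_dirac_op (L2WZ n_gt0 beta_lt1 z Hg) pg _ gl D0).
  by exists 1; rewrite /g propagator0// mul1mx scale1r.
have := inj _ Gp; rewrite subrr hnorm0 => /(_ erefl) /(hnorm_eq0_ae n_gt0 beta_lt1 Hg) g0.
have : mu I01 = 0%E.
  have [N [mN N0 sub]] := g0.
  apply: (subset_measure0 _ _ _ N0) => //; apply: subset_trans sub => t It /= /(_ It) gt0.
  have := YU n_gt0 beta_lt1 z It => /(congr1 (fun M => M *m cv2 1 1)).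
  rewrite -mulmxA -/(g t) gt0 mulmx0 mul1mx => /matrixP /(_ 0 0).
  by rewrite !mxE /= => /eqP; rewrite eq_sym oner_eq0.
by rewrite mu_I01 => /eqP; rewrite eqe oner_eq0.
Qed.

End DiracOperator.

(** * Self-adjointness *)

Section SelfAdjoint.
Context {R : realType}.
Local Notation C := R[i].
Local Open Scope sesquilinear_scope.

Lemma mprimJ m p (G Phi : R -> 'M[C]_(m, p)) : mprim G Phi ->
  mprim (fun t => (G t)^t*) (fun t => (Phi t)^t*).
Proof.
by move=> pG i j; apply: cprim_eq (cprimJ (pG j i)) _ _ => t; rewrite !mxE.
Qed.

Lemma mlim1J m p (G : R -> 'M[C]_(m, p)) L : mlim1 G L ->
  mlim1 (fun t => (G t)^t*) (L^t*).
Proof.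
move=> hG i j; rewrite !mxE; under eq_fun do rewrite !mxE.
exact: clim1J.
Qed.

Lemma trC_mul m p q (M : 'M[C]_(m, p)) (N : 'M[C]_(p, q)) :
  (M *m N)^t* = N^t* *m M^t*.
Proof. by rewrite trmx_mul map_mxM. Qed.

Lemma conj_i : Num.conj ('i : C) = - 'i.
Proof. exact: conjCi. Qed.

Lemma mx11_sub (M N : 'M[C]_1) : M - N = (M 0 0 + - 1 * N 0 0)%:M.
Proof. by apply/matrixP => i j; rewrite !mxE !ord1 mulr1n mulN1r. Qed.

(** On multiples of [(x, 1)] the boundary form carries the factor [1 - |x|^2]; this is where
    [|b(1)| = 1] enters the symmetry. *)
Lemma dirac_form_parallel (x : C) (u v : 'cV[C]_2) : absq x = 1 ->
  parallel u (cv2 x 1) -> parallel v (cv2 x 1) -> u^t* *m dmat *m v = 0.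
Proof.
move=> x1 [c ->] [d ->]; apply/matrixP => i j.
rewrite !mxE sum2E !mxE !sum2E !mxE /= !rmorphM /= rmorph1.
have xx : x * Num.conj x = 1 by rewrite conj_mul_normC normC_sqr x1.
by ring: xx.
Qed.

(** The left side is the derivative of [h^* D g] when [g' = A p] and [h' = A q]; the identity rests
    on the weight being Hermitian and on [dinv^* D = -1]. *)
Lemma weight_lagrange (b : C) (h g p q : 'cV[C]_2) :
  (dirac_coef b *m q)^t* *m dmat *m g + h^t* *m dmat *m (dirac_coef b *m p) =
  h^t* *m weight b *m p - q^t* *m weight b *m g.
Proof.
have dj : (@dinv R)^t* *m dmat = - 1%:M.
  have -> : (@dinv R)^t* = dmat.
    apply/matrixP => i j; rewrite !mxE /=.
    by elim/ord2_cases: i; elim/ord2_cases: j; rewrite /= ?rmorph0 ?rmorphN /= ?conj_i ?opprK.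
  rewrite mx2_mul -mx2_1 mx2_opp.
  by congr mx2; rewrite ?mulrN ?mulNr ?i_sq ?(mulr0, mul0r, addr0, add0r, oppr0, opprK).
have dd := @dinvK R; have wh := weight_herm b; rewrite /dirac_coef.
move: (weight b) (@dinv R) (@dmat R) dj dd wh => W Di D dj dd wh.
rewrite !trC_mul wh -!mulmxA [_^t* *m (D *m g)]mulmxA dj [D *m (Di *m _)]mulmxA dd.
by rewrite mul1mx mulNmx mul1mx !mulmxN addrC.
Qed.

Variables (n : nat) (n_gt0 : (0 < n)%N) (beta : nat -> C).
Hypothesis beta_lt1 : forall k, (k < n)%N -> absq (beta k) < 1.
Hypothesis beta_end : absq (beta n) = 1.
Local Notation b := (fun t : R => beta (step_index n t)).
Local Notation H := (L2W b).
Local Notation ip := (ipW b).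
Local Notation G := (dirac_op b).

Lemma dirac_op_symmetric p q : G p -> G q -> ip q.1 p.2 = ip q.2 p.1.
Proof.
move=> /(dirac_op_mprim n_gt0 beta_lt1)[Hp1 Hp2 [g [pg1 pg g0 [lg gl eg]]]].
move=> /(dirac_op_mprim n_gt0 beta_lt1)[Hq1 Hq2 [h [qh1 qh h0 [lh hl eh]]]].
have i1 := L2W_wdot n_gt0 beta_lt1 Hq1 Hp2.
have i2 := L2W_wdot n_gt0 beta_lt1 Hq2 Hp1.
have i12 : cintegrable (fun t => wdot b q.1 p.2 t + - 1 * wdot b q.2 p.1 t).
  by apply: cintegrableD => //; exact: cintegrableZ.
apply/eqP; rewrite -subr_eq0 -mulN1r !ipWE -cint1Z// -cint1D//; last exact: cintegrableZ.
have pF := mprimM (mprimM (mprimJ qh) (mprim_cst dmat)) pg.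
have pF' : mprim (fun t => (h t)^t* *m dmat *m g t)
    (fun t => (wdot b q.1 p.2 t + - 1 * wdot b q.2 p.1 t)%:M).
  apply: mprim_ae pF _ _.
    by move=> i j; rewrite !ord1; under eq_fun do rewrite mxE mulr1n.
  apply: ae_imp (ae_and pg1 qh1) => t [e1 e2] It.
  rewrite mulmx0 addr0 weight_lagrange.
  rewrite mx11_sub.
  by rewrite -(e1 It) -(e2 It) /wdot.
have l1 : mlim1 (fun t => (h t)^t* *m dmat *m g t) (lh^t* *m dmat *m lg).
  by apply: mlim1M gl; apply: mlim1M; [exact: mlim1J|exact: mlim1_cst].
have l2 := mprim_mlim1 pF'.
(* The limit of the boundary form at 1 is computed from the integral of its derivative and from the
   limits of [g] and [h]; both boundary values vanish. *)
have /(congr1 (fun M : 'M[C]_1 => M 0 0)) := mlim1_unique l2 l1.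
have absq1 : absq (1 : C) = 1 by rewrite /absq /= expr1n expr0n addr0.
rewrite (dirac_form_parallel absq1 h0 g0) add0r.
rewrite (dirac_form_parallel beta_end (iffRL (parallel_end_form _ _) eh) (iffRL (parallel_end_form _ _) eg)).
rewrite !mxE => <-.
by apply/eqP; congr cint1; apply/funext => t; rewrite mxE mulr1n.
Qed.

Lemma dirac_op_saturated p q : G p -> H q.1 -> H q.2 ->
  ae_eq01 q.1 p.1 -> ae_eq01 q.2 p.2 -> G q.
Proof.
move=> [H1 H2 [g dg [e1 e2]]] Hq1 Hq2 q1 q2; split => //; exists g => //; split.
  by apply: ae_imp (ae_and e1 q1) => t [h h'] It; rewrite h' ?h.
by apply: ae_imp (ae_and e2 q2) => t [h h'] It; rewrite h' ?h.
Qed.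

Hypothesis disc_i : discriminant n beta 'i != 0.
Hypothesis disc_Ni : discriminant n beta (- 'i) != 0.

(* For q in the adjoint graph, pick p in the graph with
   p.2 - i p.1 = q.2 - i q.1; then q.1 - p.1 is orthogonal to the range of
   tau + i, which is the whole space. *)
Lemma dirac_op_adjoint : adjoint H ip G = G.
Proof.
apply/seteqP; split=> [q [Hq1 Hq2 adj]|q Gq]; last first.
  have [Hq1 Hq2 _] := Gq.
  exact: And3 Hq1 Hq2 (fun p Gp => dirac_op_symmetric Gp Gq).
have Hh : H (q.2 - 'i *: q.1) := L2WB n_gt0 beta_lt1 Hq2 (L2WZ n_gt0 beta_lt1 'i Hq1).
have [p Gp pE] := dirac_op_surj n_gt0 beta_lt1 disc_i Hh.
have [Hp1 Hp2 _] := Gp.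
pose u := q.1 - p.1.
have Hu : H u := L2WB n_gt0 beta_lt1 Hq1 Hp1.
have [r Gr rE] := dirac_op_surj n_gt0 beta_lt1 disc_Ni Hu.
have [Hr1 Hr2 _] := Gr.
have qp : q.2 = p.2 + 'i *: u.
  by rewrite pE /u scalerBr [_ *: p.1 + _]addrC -addrA [_ *: p.1 + _]addrC subrK subrK.
have e1 := adj r Gr.
have e2 := dirac_op_symmetric Gr Gp.
have q1E : q.1 = p.1 + u by rewrite /u addrC subrK.
have Hiu : H ('i *: u) := L2WZ n_gt0 beta_lt1 'i Hu.
rewrite q1E qp (ipWDl n_gt0 beta_lt1 Hp1 Hu Hr2) (ipWDl n_gt0 beta_lt1 Hp2 Hiu Hr1) e2 in e1.
move: e1 => /addrI.
rewrite (ipWZl n_gt0 beta_lt1 'i Hu Hr1) conj_i {1}rE.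
rewrite (ipWDr n_gt0 beta_lt1 Hu (L2WZ n_gt0 beta_lt1 (- 'i) Hr1) Hu).
rewrite (ipWZr n_gt0 beta_lt1 (- 'i) Hu Hr1) => /eqP.
rewrite addrC -subr_eq0 addrK => /eqP uu.
have u0 : hnorm ip u = 0 by rewrite /hnorm uu sqrtr0.
have uae := hnorm_eq0_ae n_gt0 beta_lt1 Hu u0.
apply: (dirac_op_saturated Gp Hq1 Hq2).
  by apply: ae_imp uae => t h /h ut; rewrite q1E -[LHS]/(p.1 t + u t) ut addr0.
by apply: ae_imp uae => t h /h ut; rewrite qp -[LHS]/(p.2 t + 'i *: u t) ut scaler0 addr0.
Qed.

End SelfAdjoint.

(** * Density of the domain *)

Section LipschitzDensity.
Context {R : realType}.
Implicit Types (f g : R -> R).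
Local Notation mu := (@lebesgue_measure R).
Local Notation I01 := (`[0, 1[%classic : set R).

Lemma derive1_lipschitz f (M t : R) :
  (forall x y, x <= y -> `|f y - f x| <= M * (y - x)) ->
  derivable f t 1 -> `|derive1 f t| <= M.
Proof.
move=> fM df.
have fM' h : `|f (h + t) - f t| <= M * `|h|.
  have [h0|/ltW h0] := leP 0 h.
    by have := fM t (h + t); rewrite addrK (ger0_norm h0) lerDr => /(_ h0).
  have := fM (h + t) t; rewrite distrC (ler0_norm h0) gerDr => /(_ h0).
  by rewrite opprD addrCA subrr addr0.
rewrite derive1E; apply: (cvgr_to_le (cvg_norm df)).
near=> h; have h0 : h != 0 by near: h; exact: nbhs_dnbhs_neq.
by rewrite /= /GRing.scale /= mulr1 normrM normfV mulrC ler_pdivrMr ?normr_gt0.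
Unshelve. all: by end_near. Qed.

(** The derivative of a Lipschitz function is bounded by [M] where it exists, so cutting the density
    off at [M] changes it on a null set only. A bounded density keeps [tau] of the approximant
    square integrable. *)
Lemma lipschitz_prim f (M : R) :
  (forall x y, x <= y -> `|f y - f x| <= M * (y - x)) ->
  exists phi, [/\ prim f phi, measurable_fun I01 phi & forall t, `|phi t| <= M].
Proof.
move=> fM; have M0 : 0 <= M.
  by have := fM 0 1 ler01; rewrite subr0 mulr1; exact: le_trans.
have ac01 := lipschitz_abs_continuous (0 : R) 1 fM.
have [psi ipsi psiE] := ac_on_density ler01 (abs_continuous_ac_on ac01).
have pf : prim f psi.
  split; first exact: integrableS ipsi.
  by move=> t /andP[t0 /ltW t1]; rewrite -psiE ?t0//; ring.
pose phi t := Num.max (- M) (Num.min M (psi t)).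
have mphi : measurable_fun I01 phi.
  apply: measurable_maxr => //; apply: measurable_minr => //.
  by apply/measurable_EFinP; exact: measurable_int pf.1.
have bphi t : `|phi t| <= M.
  by rewrite ler_norml /phi le_max lexx /= ge_max ge_min lexx /= andbT; lra.
exists phi; split => //; apply: prim_ae (pf) _ _.
  apply: (@le_integrableR _ _ _ (fun=> M)) => //.
  exact: integrable_I01_cst.
apply: ae_imp (prim_derivable pf) => t h /h[df dE].
have /ler_normlP[h1 h2] := derive1_lipschitz fM df.
by rewrite /phi -dE min_r// max_r//; lra.
Qed.

Lemma dominated_Rintegral_cvg0 (u : nat -> R -> R) h :
  (forall m, measurable_fun I01 (u m)) -> mu.-integrable I01 (EFin \o h) ->
  (forall m t, I01 t -> `|u m t| <= h t) ->
  {ae mu, forall t, I01 t -> u m t @[m --> \oo] --> 0} ->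
  forall eps : R, 0 < eps -> exists m, (\int[mu]_(t in I01) u m t)%R < eps.
Proof.
move=> mu_ ih uh u0 eps eps0.
have u0' : {ae mu, forall t, I01 t -> (u m t)%:E @[m --> \oo] --> 0%E}.
  by apply: ae_imp u0 => t u0 It; apply/fine_cvgP; split; [exact: nearW|exact: u0].
have uh' : {ae mu, forall t m, I01 t -> (`|(u m t)%:E| <= (EFin \o h) t)%E}.
  by apply: ae_all => t m It; rewrite lee_fin; exact: uh.
have [_ _] := @dominated_convergence _ _ _ mu I01 (measurable_itv _)
  (fun m => EFin \o u m) (cst 0%E) (EFin \o h)
  (fun m => iffRL (measurable_EFinP _ _) (mu_ m)) (measurable_cst _) u0' ih uh'.
rewrite integral0 => /fine_cvgP[_ cv].
have := cvgr_lt _ cv eps eps0 => -[m _ /(_ m (leqnn m))]; by exists m.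
Qed.

Definition l2dist f g : R := (\int[mu]_(t in I01) (f t - g t) ^+ 2)%R.

Lemma bounded_sub_integrable f g (M : R) : measurable_fun I01 f ->
  measurable_fun I01 g ->
  (forall t, I01 t -> `|f t| <= M) -> (forall t, I01 t -> `|g t| <= M) ->
  mu.-integrable I01 (EFin \o (fun t => (f t - g t) ^+ 2)).
Proof.
move=> mf mg fM gM; apply: (@le_integrableR _ _ _ (fun=> (2 * M) ^+ 2)) => //.
- by apply: measurable_funX; exact: measurable_funB.
- move=> t It; rewrite ger0_norm ?sqr_ge0// -[leLHS]real_normK ?num_real//.
  rewrite ler_pXn2r ?nnegrE//; last first.
    by rewrite mulr_ge0//; apply: le_trans (fM t It).
  apply: le_trans (ler_normB _ _) _; have := fM t It; have := gM t It; lra.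
- exact: integrable_I01_cst.
Qed.

(** One parameter cuts off both the large values and a neighbourhood of 1. At every [t < 1] the
    error is eventually zero, and the square of [f] dominates it throughout. *)
Lemma l2dist_truncate f : measurable_fun I01 f ->
  mu.-integrable I01 (EFin \o (fun t => f t ^+ 2)) -> forall eps : R, 0 < eps ->
  exists g (k : nat), [/\ measurable_fun I01 g, (0 < k)%N,
    forall t, `|g t| <= k%:R, forall t, 1 - k%:R^-1 <= t -> g t = 0 &
    mu.-integrable I01 (EFin \o (fun t => (f t - g t) ^+ 2)) /\
    l2dist f g < eps].
Proof.
move=> mf if2 eps eps0.
pose g (k : nat) t := \1_(`]-oo, 1 - k.+1%:R^-1[%classic : set R) t *
  Num.max (- k.+1%:R) (Num.min k.+1%:R (f t)).
have mg k : measurable_fun I01 (g k).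
  apply: measurable_funM; first exact: measurable_indic.
  by apply: measurable_maxr => //; exact: measurable_minr.
have gk k t : `|g k t| <= k.+1%:R.
  rewrite /g indicE; case: (_ \in _); rewrite /= ?mul0r ?normr0 ?mul1r//.
  by rewrite ler_norml le_max lexx /= ge_max ge_min lexx /= andbT ge0_cp.
have fg k t : (f t - g k t) ^+ 2 <= f t ^+ 2.
  rewrite /g indicE; case: (_ \in _); rewrite /= ?mul0r ?subr0 ?mul1r//.
  have k0 : 0 <= k.+1%:R :> R by [].
  move: (k.+1%:R : R) k0 => c c0.
  case: (leP c (f t)) => h1; first by rewrite max_r; [nra|lra].
  by case: (leP (- c) (f t)) => h2; [rewrite subrr; nra|nra].
have ifg k : mu.-integrable I01 (EFin \o (fun t => (f t - g k t) ^+ 2)).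
  apply: (@le_integrableR _ _ _ _ _ _ _ if2) => //.
  - by apply: measurable_funX; exact: measurable_funB.
  - by move=> t _; rewrite ger0_norm ?sqr_ge0.
have [k kE] : exists k, (\int[mu]_(t in I01) (f t - g k t) ^+ 2)%R < eps.
  apply: (dominated_Rintegral_cvg0 _ if2) => //.
  - by move=> k; apply: measurable_funX; exact: measurable_funB.
  - by move=> k t _; rewrite ger0_norm ?sqr_ge0.
  apply: ae_all => t; rewrite /= in_itv /= => /andP[t0 t1].
  have t1' : 0 < 1 - t by rewrite subr_gt0.
  apply: cvg_near_cst; near=> k; rewrite /g indicE mem_set /=; last first.
    rewrite in_itv /= ltrBrDl -ltrBrDr; near: k.
    exact: (near_infty_natSinv_lt (PosNum t1')).
  have : `|f t| <= k.+1%:R.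
    apply: (@le_trans _ _ k%:R); last by rewrite ler_nat.
    by near: k; exact: nbhs_infty_ger.
  rewrite mul1r => /ler_normlP[h1 h2]; rewrite min_r// max_r ?subrr ?expr0n//; lra.
exists (g k), k.+1; split => // t kt.
rewrite /g indicE memNset ?mul0r//= in_itv /=; apply/negP; rewrite -leNgt//.
Unshelve. all: by end_near. Qed.

Lemma mu_itv_oc (z w : R) : z <= w -> mu `]z, w]%classic = (w - z)%:E.
Proof.
move=> zw; transitivity (mu [set` `]z, w]]); first by [].
rewrite lebesgue_measure_itv /= lte_fin; case: ltP => // wz.
have /eqP -> : z == w by rewrite eq_le zw wz.
by rewrite subrr.
Qed.

Lemma lipschitz_primitive g (c : R) : mu.-integrable setT (EFin \o g) ->
  (forall t, `|g t| <= c) -> forall x y, x <= y ->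
  `|(\int[mu]_(s in `[0%R, y]) g s)%R - (\int[mu]_(s in `[0%R, x]) g s)%R| <= c * (y - x).
Proof.
move=> ig gc x y xy; have c0 : 0 <= c by apply: le_trans (gc 0).
have igi (i : interval R) : mu.-integrable [set` i] (EFin \o g).
  exact: integrableS ig.
have le0 z w : z <= w -> `|(\int[mu]_(s in `]z, w]) g s)%R| <= c * (w - z).
  move=> zw; apply: le_trans (le_normr_Rintegral _ (igi _)) _ => //.
  apply: le_trans (le_Rintegral (f2 := fun=> c) _ _ _ _) _ => //.
  - exact/Rintegrable_norm/igi.
  - apply/integrableP; split; first exact: measurable_cst.
    have -> : (\int[mu]_(x in `]z, w]) `|(EFin \o (fun=> c)) x| =
      \int[mu]_(x in `]z, w]) (cst `|c|%:E) x)%E by [].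
    by rewrite integral_cst// [X in (_ * X)%E](mu_itv_oc zw) -EFinM ltry.
  - by rewrite Rintegral_cst// [X in fine X](mu_itv_oc zw).
(* For a negative argument the interval is empty and the primitive is 0; averages near 0 do reach
   back to such arguments. *)
have [x0|x0] := leP 0 x.
  by rewrite Rintegral_itvB//; exact: le0.
have -> : (\int[mu]_(s in `[0%R, x]) g s)%R = 0.
  by rewrite set_itv_ge ?Rintegral_set0// bnd_simp -ltNge.
rewrite subr0; have [y0|y0] := leP 0 y; last first.
  by rewrite set_itv_ge ?Rintegral_set0 ?bnd_simp -?ltNge// normr0 mulr_ge0// subr_ge0.
rewrite -Rintegral_itv_obnd_cbnd//.
by apply: le_trans (le0 _ _ y0) _; apply: ler_wpM2l => //; lra.
Qed.

(* The averages of g over [t - 1/N, t] are Lipschitz, vanish at 0, and vanish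
   at 1 because g does so near 1. *)
Lemma l2dist_lipschitz g (k : nat) : measurable_fun I01 g -> (0 < k)%N ->
  (forall t, `|g t| <= k%:R) -> (forall t, 1 - k%:R^-1 <= t -> g t = 0) ->
  forall eps : R, 0 < eps -> exists q (M : R),
    [/\ forall x y, x <= y -> `|q y - q x| <= M * (y - x), q 0 = 0, q 1 = 0,
      forall t, I01 t -> `|q t| <= k%:R & l2dist g q < eps].
Proof.
move=> mg k0 gk g1 eps eps0; pose psi := g \_ I01.
have psik t : `|psi t| <= k%:R.
  by rewrite /psi patchE; case: ifP => // _; rewrite normr0.
have ipsi : mu.-integrable setT (EFin \o psi).
  rewrite -restrict_EFin; apply: (iffLR (integrable_mkcond _ _)) => //.
  apply: (@le_integrableR _ _ _ (fun=> k%:R)) => //.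
  exact: integrable_I01_cst.
pose F t := (\int[mu]_(s in `[0%R, t]) psi s)%R.
have FL := lipschitz_primitive ipsi psik.
have F0 t : t <= 0 -> F t = 0.
  rewrite le_eqVlt => /orP[/eqP ->|t0]; first by rewrite /F set_itv1 Rintegral_set1.
  by rewrite /F set_itv_ge ?Rintegral_set0// bnd_simp -ltNge.
(* The summand [k] keeps the averaging window at 1 inside the stretch where [g] vanishes; [j.+1]
   lets its length tend to 0. *)
pose N j : R := (j.+1 + k)%:R.
have N0 j : 0 < N j by rewrite ltr0n.
have Nk j : (N j)^-1 <= k%:R^-1 by rewrite lef_pV2 ?posrE ?ltr0n// ler_nat leq_addl.
have Nj j : (N j)^-1 <= j.+1%:R^-1 by rewrite lef_pV2 ?posrE ?ltr0n// ler_nat leq_addr.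
pose q j t := N j * (F t - F (t - (N j)^-1)).
have qL j x y : x <= y -> `|q j y - q j x| <= 2 * N j * k%:R * (y - x).
  move=> xy; rewrite /q -mulrBr normrM (gtr0_norm (N0 j)).
  have -> : 2 * N j * k%:R * (y - x) = N j * (2 * (k%:R * (y - x))) by ring.
  rewrite ler_pM2l//; have h1 := FL x y xy.
  have := FL (x - (N j)^-1) (y - (N j)^-1); rewrite lerD2r => /(_ xy) h2.
  have -> : F y - F (y - (N j)^-1) - (F x - F (x - (N j)^-1)) =
    (F y - F x) - (F (y - (N j)^-1) - F (x - (N j)^-1)) by ring.
  apply: le_trans (ler_normB _ _) _.
  move: h1 h2; rewrite -/(F x) -/(F y) -/(F (x - _)) -/(F (y - _)).
  have -> : y - (N j)^-1 - (x - (N j)^-1) = y - x by ring.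
  lra.
have qk j t : `|q j t| <= k%:R.
  rewrite /q normrM (gtr0_norm (N0 j)) -ler_pdivlMl// mulrC.
  have := FL (t - (N j)^-1) t; rewrite gerBl invr_ge0 ltW// => /(_ erefl).
  by have -> : t - (t - (N j)^-1) = (N j)^-1 by ring.
have mq j : measurable_fun I01 (q j).
  have [phi [pq _ _]] := lipschitz_prim (qL j); exact: prim_measurable pq.
have dF : {ae mu, forall t, `]0, 1[%classic t -> derivable F t 1 /\ derive1 F t = psi t}.
  by apply: integrable_primitive_derivable => // t _; rewrite [F 0]F0// add0r.
have qg : {ae mu, forall t, I01 t -> (g t - q j t) ^+ 2 @[j --> \oo] --> 0}.
  apply: ae_imp (ae_and dF (ae_neq 0)) => t [{}dF t0] It.
  have {}dF : is_derive t (1 : R) F (g t).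
    have [|df dE] := dF; first by move: It; rewrite /= !in_itv /= lt0r t0.
    split => //; rewrite -derive1E dE /psi patchE ifT// inE//.
  have cvh : (- (N j)^-1) @[j --> \oo] --> (0 : R)^'.
    move=> A [e /= e0 eA]; change (\forall j \near \oo, A (- (N j)^-1)).
    near=> j; apply: eA; last first.
      by rewrite oppr_eq0 invr_eq0 gt_eqF.
    rewrite /= sub0r opprK ger0_norm ?invr_ge0 ?ltW//; apply: le_lt_trans (Nj j) _.
    by near: j; exact: (near_infty_natSinv_lt (PosNum e0)).
  have cq : q j t @[j --> \oo] --> g t.
    have [df <-] := dF.
    have cvd : h^-1 *: ((F \o shift t) (h *: (1 : R)) - F t) @[h --> (0 : R)^'] --> 'D_1 F t := df.
    have := cvg_comp _ _ cvh cvd.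
    apply: cvg_trans; apply: near_eq_cvg; near=> j.
    rewrite /= /GRing.scale /= mulr1 /q [- _ + t]addrC invrN invrK mulNr -mulrN opprB.
    by [].
  have -> : 0 = (g t - g t) ^+ 2 :> R by rewrite subrr expr0n.
  rewrite expr2; under eq_fun do rewrite expr2.
  by apply: cvgM; apply: cvgB => //; exact: cvg_cst.
have mgq j : measurable_fun I01 (fun t => (g t - q j t) ^+ 2).
  by apply: measurable_funX; exact: measurable_funB.
have bgq j t : I01 t -> `|(g t - q j t) ^+ 2| <= (2 * k%:R) ^+ 2.
  move=> It; rewrite ger0_norm ?sqr_ge0// -[leLHS]real_normK ?num_real//.
  rewrite ler_pXn2r ?nnegrE// ?mulr_ge0//; apply: le_trans (ler_normB _ _) _.
  by have := gk t; have := qk j t; lra.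
have [j jE] := dominated_Rintegral_cvg0 (u := fun j t => (g t - q j t) ^+ 2) mgq
  (integrable_I01_cst ((2 * k%:R) ^+ 2)) bgq qg eps0.
exists (q j), (2 * N j * k%:R); split => //.
- exact: qL.
- by rewrite /q !F0 ?subrr ?mulr0// sub0r oppr_le0 invr_ge0 ltW.
- suff H : F 1 = F (1 - (N j)^-1) by rewrite /q H subrr mulr0.
  apply/eqP; rewrite -subr_eq0 /F Rintegral_itvB//; last 3 first.
  - exact: integrableS ipsi.
  - by rewrite bnd_simp subr_ge0 invf_le1// ler1n ltn_addr.
  - by rewrite bnd_simp gerBl invr_ge0 ltW.
  rewrite (@eq_Rintegral _ _ _ mu _ (fun=> 0)) ?Rintegral_cst ?mul0r// => s.
  rewrite inE /= in_itv /= => /andP[/ltW s1 _]; rewrite /psi patchE; case: ifP => // _.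
  by apply: g1; apply: le_trans s1; rewrite lerD2l lerN2.
Unshelve. all: by end_near. Qed.

Lemma l2dist_prim f : measurable_fun I01 f ->
  mu.-integrable I01 (EFin \o (fun t => f t ^+ 2)) -> forall eps : R, 0 < eps ->
  exists q phi (M : R),
    [/\ prim q phi, measurable_fun I01 phi & forall t, `|phi t| <= M] /\
    [/\ q 0 = 0, q t @[t --> 1^'-] --> 0,
        mu.-integrable I01 (EFin \o (fun t => (f t - q t) ^+ 2)) &
        l2dist f q < eps].
Proof.
move=> mf if2 eps eps0.
(* Each approximation gets [eps / 4] because [(f - q)^2 <= 2 ((f - g)^2 + (g - q)^2)]. *)
have [g [k [mg k0 gk g1 [ifg dfg]]]] := l2dist_truncate mf if2 (eps := eps / 4) ltac:(lra).
have [q [M [qM q0 q1 qk dgq]]] := l2dist_lipschitz mg k0 gk g1 (eps := eps / 4) ltac:(lra).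
have [phi [pq mphi bphi]] := lipschitz_prim qM.
have mq := prim_measurable pq.
have igq := bounded_sub_integrable mg mq (fun t _ => gk t) qk.
have i2 : mu.-integrable I01 (EFin \o (fun t => 2 * ((f t - g t) ^+ 2 + (g t - q t) ^+ 2))).
  by apply: RintegrableZ => //; exact: RintegrableD.
have le2 t : (f t - q t) ^+ 2 <= 2 * ((f t - g t) ^+ 2 + (g t - q t) ^+ 2).
  by have := sqr_ge0 ((f t - g t) - (g t - q t)); nra.
have ifq : mu.-integrable I01 (EFin \o (fun t => (f t - q t) ^+ 2)).
  apply: (@le_integrableR _ _ _ _ _ _ _ i2) => //.
  - by apply: measurable_funX; exact: measurable_funB.
  - by move=> t _; rewrite ger0_norm ?sqr_ge0.
exists q, phi, M; split => //; split => //; last first.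
  apply: (@le_lt_trans _ _ (2 * (l2dist f g + l2dist g q))); last by lra.
  rewrite /l2dist -RintegralD// -RintegralZl//; last exact: RintegrableD.
  by apply: le_Rintegral.
apply/cvgrPdist_lt => e e0; have M0 : 0 <= M.
  by have := qM 0 1 ler01; rewrite subr0 mulr1; exact: le_trans.
have M1 : 0 < M + 1 by rewrite ltr_wpDl.
near=> t; rewrite -q1; apply: le_lt_trans (qM t 1 _) _; first exact/ltW.
have : 1 - e / (M + 1) < t.
  by near: t; apply: nbhs_left_gt; rewrite ltrBlDr ltrDl divr_gt0.
rewrite ltrBlDr -ltrBlDl ltr_pdivlMr// => h; apply: le_lt_trans h.
rewrite mulrC; apply: ler_wpM2l; last by rewrite lerDl.
by rewrite subr_ge0 ltW.
Unshelve. all: by end_near. Qed.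

End LipschitzDensity.

Section DenseDomain.
Context {R : realType}.
Local Notation C := R[i].
Local Notation Re := (@complex.Re R).
Local Notation Im := (@complex.Im R).
Local Notation mu := (@lebesgue_measure R).
Local Notation I01 := (`[0, 1[%classic : set R).

Lemma square_integrable_dense (f : R -> C) (eps : R) : square_integrable f ->
  0 < eps -> exists q phi : R -> C,
    [/\ cprim q phi, cmeasurable phi, cbounded phi & q 0 = 0] /\
    [/\ clim1 q 0, mu.-integrable I01 (EFin \o (fun t => absq (f t - q t))) &
        (\int[mu]_(t in I01) absq (f t - q t))%R < eps].
Proof.
move=> [[m1 m2] if2] eps0; have eps2 : 0 < eps / 2 by rewrite divr_gt0.
have i1 : mu.-integrable I01 (EFin \o (fun t => Re (f t) ^+ 2)).
  apply: (@le_integrableR _ _ _ _ _ _ _ if2) => //; first exact: measurable_funX.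
  by move=> t _; rewrite ger0_norm ?sqr_ge0// lerDl sqr_ge0.
have i2 : mu.-integrable I01 (EFin \o (fun t => Im (f t) ^+ 2)).
  apply: (@le_integrableR _ _ _ _ _ _ _ if2) => //; first exact: measurable_funX.
  by move=> t _; rewrite ger0_norm ?sqr_ge0// lerDr sqr_ge0.
have [q1 [p1 [M1 [[pq1 mp1 bp1] [q10 q11 iq1 d1]]]]] := l2dist_prim m1 i1 eps2.
have [q2 [p2 [M2 [[pq2 mp2 bp2] [q20 q21 iq2 d2]]]]] := l2dist_prim m2 i2 eps2.
have absE : (fun t => absq (f t - (q1 t +i* q2 t)%C)) =
    (fun t => (Re (f t) - q1 t) ^+ 2 + (Im (f t) - q2 t) ^+ 2).
  by apply/funext => t; rewrite /absq ReD ImD ReN ImN.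
exists (fun t => (q1 t +i* q2 t)%C), (fun t => (p1 t +i* p2 t)%C); split; split => //.
- exists (M1 ^+ 2 + M2 ^+ 2) => t _; rewrite /absq /=.
  have M10 : 0 <= M1 by apply: le_trans (bp1 0).
  have M20 : 0 <= M2 by apply: le_trans (bp2 0).
  by apply: lerD; rewrite -[leLHS]real_normK ?num_real// ler_pXn2r ?nnegrE.
- by rewrite q10 q20.
- by rewrite absE; exact: RintegrableD.
- by rewrite absE RintegralD//; move: d1 d2; rewrite /l2dist; lra.
Qed.

Variables (n : nat) (n_gt0 : (0 < n)%N) (beta : nat -> C).
Hypothesis beta_lt1 : forall k, (k < n)%N -> absq (beta k) < 1.
Local Notation b := (fun t : R => beta (step_index n t)).
Local Notation A := (fun t : R => dirac_coef (beta (step_index n t))).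

(** The approximant vanishes at 0 and in the limit at 1, so both boundary conditions hold with
    scalar 0, and its derivative is bounded, so [tau] maps it into the space. *)
Lemma dirac_op_densely_defined : densely_defined (L2W b) (ipW b) (dirac_op b).
Proof.
move=> h Hh eps eps0; have sh := iffLR (L2W_P n_gt0 beta_lt1 h) Hh.
have [K K0 hK] := wdot_le_colsq n_gt0 beta_lt1.
(* [K] converts to the weighted norm, and each coordinate receives half of the squared error. *)
have d0 : 0 < eps ^+ 2 / K / 2 by rewrite !divr_gt0// exprn_gt0.
have [q0 [phi0 [[pq0 mp0 bp0 q00] [l0 i0 e0]]]] := square_integrable_dense (sh 0) d0.
have [q1 [phi1 [[pq1 mp1 bp1 q10] [l1 i1 e1]]]] := square_integrable_dense (sh 1) d0.
pose p t : 'cV[C]_2 := cv2 (q0 t) (q1 t).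
pose Phi t : 'cV[C]_2 := cv2 (phi0 t) (phi1 t).
have pp : mprim p Phi.
  move=> i j; rewrite ord1; elim/ord2_cases: i.
    by apply: cprim_eq pq0 _ _ => t; rewrite mxE.
  by apply: cprim_eq pq1 _ _ => t; rewrite mxE.
have pl : mlim1 p 0.
  move=> i j; rewrite ord1 mxE; elim/ord2_cases: i.
    by under eq_fun do rewrite mxE; exact: l0.
  by under eq_fun do rewrite mxE; exact: l1.
have sPhi : vsquare_integrable Phi.
  move=> i; elim/ord2_cases: i.
    by under eq_fun do rewrite mxE; exact: bounded_square_integrable.
  by under eq_fun do rewrite mxE; exact: bounded_square_integrable.
(* The constant matrix by which [tau] multiplies the derivative on the [k]-th interval. *)
pose Wi k := (2 / (1 - `|beta k| ^+ 2)) *: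
    (mx2 (1 + `|beta k| ^+ 2) (2 * beta k) (2 * Num.conj (beta k)) (1 + `|beta k| ^+ 2) *m
       mx2 (- 'i) 0 0 'i).
pose f t := Wi (step_index n t) *m Phi t.
have sf := vsquare_integrable_mul n_gt0 Wi sPhi.
have Hf : L2W b f := iffRL (L2W_P n_gt0 beta_lt1 f) sf.
have pf : mprim p (fun t => A t *m f t).
  apply: mprim_eq_in pp _ => t It; apply/dirac_eqP.
    exact: (step_absq_lt1 n_gt0 beta_lt1).
  by rewrite scalemxAl.
have Gp : dirac_op b (p, f).
  apply: (mprim_dirac_op n_gt0 beta_lt1 Hf pf _ pl).
    by exists 0; rewrite /p q00 q10 cv2_scale !mul0r.
  by rewrite /end_form !mxE mulr0 subr0.
exists (p, f); first exact: Gp.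
have [Hp _ _] := Gp; have Hd := L2WB n_gt0 beta_lt1 Hh Hp.
have cE : (fun t => colsq ((h - p) t)) =
    (fun t => absq (h t 0 0 - q0 t) + absq (h t 1 0 - q1 t)).
  by apply/funext => t; rewrite /colsq -[(h - p) t]/(h t - p t) !mxE.
rewrite -(@ltr_pXn2r _ 2)// ?nnegrE ?hnorm_ge0 ?(ltW eps0)//.
rewrite (hnorm_sqE n_gt0 beta_lt1).
apply: (@le_lt_trans _ _ (\int[mu]_(t in I01) (K * colsq ((h - p) t)))%R).
  apply: le_Rintegral => //.
  - by case: (L2W_wdot n_gt0 beta_lt1 Hd Hd).
  - by apply: RintegrableZ => //; rewrite cE; exact: RintegrableD.
  - by move=> t It; exact: hK.
rewrite RintegralZl//; last by rewrite cE; exact: RintegrableD.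
rewrite cE RintegralD//; rewrite -ltr_pdivlMl// mulrC.
by have := ltrD e0 e1; lra.
Qed.

End DenseDomain.

(** * Verblunsky coefficients *)

Section VerblunskyCoefficients.
Context {R : realType}.
Local Notation C := R[i].
Local Open Scope sesquilinear_scope.

Lemma trCK m n (A : 'M[C]_(m, n)) : (A^t*)^t* = A.
Proof. by apply/matrixP => i j; rewrite !mxE conjCK. Qed.

Lemma hdotDl n (u v w : 'cV[C]_n) : hdot (u + v) w = hdot u w + hdot v w.
Proof. by rewrite /hdot raddfD /= map_mxD mulmxDl mxE. Qed.

Lemma hdotDr n (u v w : 'cV[C]_n) : hdot u (v + w) = hdot u v + hdot u w.
Proof. by rewrite /hdot mulmxDr mxE. Qed.

Lemma hdotZl n c (u v : 'cV[C]_n) : hdot (c *: u) v = Num.conj c * hdot u v.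
Proof. by rewrite /hdot linearZ /= map_mxZ -scalemxAl mxE. Qed.

Lemma hdotZr n c (u v : 'cV[C]_n) : hdot u (c *: v) = c * hdot u v.
Proof. by rewrite /hdot -scalemxAr mxE. Qed.

Lemma hdotC n (u v : 'cV[C]_n) : hdot v u = Num.conj (hdot u v).
Proof.
rewrite /hdot !mxE rmorph_sum; apply: eq_bigr => i _.
by rewrite rmorphM /= !mxE conjCK mulrC.
Qed.

Lemma hdot_unitary n (V : 'M[C]_n) (u v : 'cV[C]_n) : V \is unitarymx ->
  hdot (V *m u) (V *m v) = hdot u v.
Proof.
move=> /unitarymxP/mulmx1C VV; rewrite /hdot trC_mul -mulmxA [V^t* *m _]mulmxA.
by rewrite VV mul1mx.
Qed.

Lemma hdot_eq0 n (u : 'cV[C]_n) : hdot u u = 0 -> u = 0.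
Proof.
rewrite /hdot mxE => /eqP; rewrite psumr_eq0 => [/allP h|i _]; last first.
  by rewrite !mxE mulrC mul_conjC_ge0.
apply/colP => i; have := h i; rewrite mem_index_enum => /(_ isT) /=.
by rewrite !mxE mulrC mul_conjC_eq0 => /eqP.
Qed.

Lemma hdot_ge0 n (u : 'cV[C]_n) : 0 <= hdot u u.
Proof.
by rewrite /hdot mxE; apply: sumr_ge0 => i _; rewrite !mxE mulrC mul_conjC_ge0.
Qed.

Lemma revpoly1 : revpoly 0 (1 : {poly C}) = 1.
Proof.
apply/polyP => i; rewrite coef_poly [RHS]coef1; case: i => [|i] //=.
by rewrite coef1 conjC1.
Qed.

Section Cyclic.
Variables (n : nat) (V : 'M[C]_n.+1) (e : 'cV[C]_n.+1).

Lemma poly_act_horner_mx p : poly_act V p e = horner_mx V p *m e.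
Proof.
rewrite /poly_act -[in RHS](coefK p) poly_def rmorph_sum /= mulmx_suml.
by apply: eq_bigr => i _; rewrite horner_mxZ rmorphXn /= horner_mx_X scalemxAl.
Qed.

Lemma poly_actD p q : poly_act V (p + q) e = poly_act V p e + poly_act V q e.
Proof. by rewrite !poly_act_horner_mx rmorphD mulmxDl. Qed.

Lemma poly_actX p : poly_act V ('X * p) e = V *m poly_act V p e.
Proof. by rewrite !poly_act_horner_mx rmorphM /= horner_mx_X mulmxA. Qed.

Lemma poly_actC c p : poly_act V (c%:P * p) e = c *: poly_act V p e.
Proof.
by rewrite !poly_act_horner_mx rmorphM /= horner_mx_C -mulmxE mul_scalar_mx scalemxAl.
Qed.

Hypothesis V_unitary : V \is unitarymx.
Variable lam : 'I_n.+1 -> R.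
Hypothesis eig_distinct : injective (fun k => expi (lam k)).
Hypothesis eigP : forall z : C, eigenvalue V z <-> exists k, z = expi (lam k).
Hypothesis e_cyclic : forall (v : 'cV[C]_n.+1) (z : C),
  v != 0 -> V *m v = z *: v -> hdot e v != 0.

Lemma expi_conj (x : R) : expi x * Num.conj (expi x) = 1.
Proof. by rewrite conj_mul_normC normC_sqr /absq /= cos2Dsin2. Qed.

(** Since [e] is not orthogonal to any eigenvector, [p(V) e = 0] forces [p] to vanish at all [n + 1]
    distinct eigenvalues, too many for its degree. *)
Lemma poly_act_neq0 (p : {poly C}) : p != 0 -> (size p <= n.+1)%N -> poly_act V p e != 0.
Proof.
move=> p0 sp; apply/eqP => pe0.
have root_p k : root p (expi (lam k)).
  have /eigenvalueP[v vV v0] : eigenvalue V (expi (lam k)) by apply/eigP; exists k.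
  (* [eigenvalue] refers to row eigenvectors and [e_cyclic] to column ones; unitarity makes the
     conjugate transpose a column eigenvector for the same eigenvalue. *)
  have Vu : V *m v^t* = expi (lam k) *: v^t*.
    have h : V^t* *m v^t* = Num.conj (expi (lam k)) *: v^t*.
      by rewrite -trC_mul vV linearZ /= map_mxZ.
    have := congr1 (mulmx V) h; rewrite mulmxA (unitarymxP V_unitary) mul1mx -scalemxAr.
    by move=> E; rewrite [in RHS]E scalerA expi_conj scale1r.
  have u0 : v^t* != 0.
    by apply: contra v0 => /eqP h; rewrite -[v]trCK h trmx0 map_mx0.
  have vp : v *m horner_mx V p = p.[expi (lam k)] *: v.
    elim/poly_ind: p {p0 sp pe0} => [|p c IH].
      by rewrite rmorph0 mulmx0 horner0 scale0r.
    rewrite rmorphD rmorphM /= horner_mx_X horner_mx_C mulmxDr mulmxA IH.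
    by rewrite -scalemxAl vV scalerA mul_mx_scalar -scalerDl !hornerE.
  have := e_cyclic u0 Vu; rewrite hdotC conjC_eq0 /hdot trCK => ue.
  have := congr1 (fun x => (v *m x) 0 0) pe0; rewrite poly_act_horner_mx mulmxA vp.
  rewrite mulmx0 -scalemxAl mxE [RHS]mxE => /eqP; rewrite mulf_eq0 => /orP[//|].
  by rewrite (negPf ue).
pose rs := [seq expi (lam k) | k <- enum 'I_n.+1].
have all_rs : all (root p) rs by apply/allP => _ /mapP[k _ ->].
have uniq_rs : uniq rs by rewrite map_inj_uniq// enum_uniq.
by have := max_poly_roots p0 all_rs uniq_rs; rewrite size_map size_enum_ord ltnNge sp.
Qed.

Variable alpha : 'I_n.+1 -> C.
Variable Phi : nat -> {poly C}.
Hypothesis PhiP : szego_polys V e Phi.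
Hypothesis alphaP : forall k : 'I_n.+1,
  Phi k.+1 = 'X * Phi k - ((alpha k)^*)%:P * revpoly k (Phi k) /\
  revpoly k.+1 (Phi k.+1) = - (alpha k)%:P * ('X * Phi k) + revpoly k (Phi k).

Let v k := poly_act V (Phi k) e.
Let w k := poly_act V (revpoly k (Phi k)) e.

Let v_rec (k : 'I_n.+1) : v k.+1 = V *m v k - Num.conj (alpha k) *: w k.
Proof.
have [E _] := alphaP k; rewrite {1}/v E poly_actD poly_actX -mulNr -polyCN poly_actC.
by rewrite scaleNr.
Qed.

Let w_rec (k : 'I_n.+1) : w k.+1 = - (alpha k *: (V *m v k)) + w k.
Proof.
have [_ E] := alphaP k; rewrite {1}/w E poly_actD -polyCN poly_actC poly_actX.
by rewrite scaleNr.
Qed.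

Let Phi0 : Phi 0%N = 1. Proof. by case: PhiP. Qed.

Let Vv (k : 'I_n.+1) : V *m v k = v k.+1 + Num.conj (alpha k) *: w k.
Proof. by rewrite v_rec subrK. Qed.

(** Eliminating [V v_k] from the recursion writes [w_(k+1)] as a combination of [v_(k+1)] and [w_k],
    so [w_k] lies in the span of [v_0, .., v_k]. *)
Let w_orth (x : 'cV[C]_n.+1) k : (k <= n)%N ->
  (forall j, (j <= k)%N -> hdot x (v j) = 0) -> hdot x (w k) = 0.
Proof.
elim: k => [|k IH] kn h; first by rewrite /w Phi0 revpoly1 -Phi0; exact: h.
have IHk : hdot x (w k) = 0.
  by apply: IH => [|j jk]; [exact: ltnW|apply: h; exact: leqW].
have -> := w_rec (Ordinal (ltnW kn : k < n.+1)%N).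
rewrite Vv /= hdotDr -scaleNr hdotZr hdotDr hdotZr IHk h//.
by rewrite !(mulr0, addr0).
Qed.

Let v_end : v n.+1 = 0.
Proof.
by rewrite /v; have [_ _ _ ->] := PhiP; rewrite poly_act_horner_mx Cayley_Hamilton mul0mx.
Qed.

(** For [k < n] this comes from orthogonality of the Gram-Schmidt basis; for [k = n] the vector
    [v n.+1] is zero by Cayley-Hamilton. *)
Let vw_orth k : (k <= n)%N -> hdot (v k.+1) (w k) = 0.
Proof.
move=> kn; apply: w_orth => // j jk.
have [kn'|nk] := ltnP k.+1 n.+1.
  have [_ _ orth _] := PhiP.
  by rewrite hdotC /v (orth j k.+1) ?conjC0// ltnS jk.
have -> : k = n by apply/eqP; rewrite eqn_leq kn.
by rewrite v_end /hdot trmx0 map_mx0 mul0mx mxE.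
Qed.

Let vv_neq0 k : (k <= n)%N -> hdot (v k) (v k) != 0.
Proof.
move=> kn; have [_ /(_ k kn)[mP sP] _ _] := PhiP.
apply/eqP => /hdot_eq0/eqP; apply/negP; apply: poly_act_neq0.
  exact: monic_neq0.
by rewrite sP.
Qed.

(** Pythagoras for [V v_k = v_(k+1) + conj alpha_k w_k], with [V] an isometry; the equality of the
    norms of [v_k] and [w_k] is carried along as an invariant. *)
Let norm_rec k (kn : (k < n.+1)%N) : hdot (v k) (v k) = hdot (w k) (w k) ->
  hdot (v k.+1) (v k.+1) = (1 - `|alpha (Ordinal kn)| ^+ 2) * hdot (v k) (v k) /\
  hdot (w k.+1) (w k.+1) = (1 - `|alpha (Ordinal kn)| ^+ 2) * hdot (v k) (v k).
Proof.
set a := alpha _ => vw; have o1 := vw_orth kn.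
have o2 : hdot (w k) (v k.+1) = 0 by rewrite hdotC o1 conjC0.
have aa := conj_mul_normC a.
have vE : hdot (v k.+1) (v k.+1) = (1 - `|a| ^+ 2) * hdot (v k) (v k).
  have h := hdot_unitary (v k) (v k) V_unitary.
  rewrite (Vv (Ordinal kn)) /= -/a in h.
  rewrite hdotDl !hdotDr !hdotZl !hdotZr o1 o2 conjCK -vw in h.
  by rewrite mulrBl mul1r -{1}h -aa; ring.
split=> //; rewrite (w_rec (Ordinal kn)) (Vv (Ordinal kn)) /= -/a.
rewrite -scaleNr hdotDl !hdotDr !hdotZl !hdotZr !hdotDl !hdotDr !hdotZl !hdotZr.
by rewrite o1 o2 rmorphN conjCK vE -vw -aa; ring.
Qed.

Let vw_norm k : (k <= n.+1)%N -> hdot (v k) (v k) = hdot (w k) (w k).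
Proof.
elim: k => [|k IH] kn; first by rewrite /v /w Phi0 revpoly1.
by have [-> ->] := norm_rec kn (IH (ltnW kn)).
Qed.

Lemma verblunsky_lt1 (k : 'I_n.+1) : (k < n)%N -> absq (alpha k) < 1.
Proof.
case: k => k kn /= kn'; have [h _] := norm_rec kn (vw_norm (ltnW kn)).
have v0 j : (j <= n)%N -> 0 < hdot (v j) (v j).
  by move=> jn; rewrite lt0r hdot_ge0 vv_neq0.
rewrite -normC_lt1 -(@ltr_pXn2r _ 2)// ?nnegrE// expr1n -subr_gt0.
by rewrite -(pmulr_lgt0 _ (v0 k kn)) -h v0.
Qed.

Lemma verblunsky_last : absq (alpha ord_max) = 1.
Proof.
have [h _] := norm_rec (ltnSn n) (vw_norm (leqnSn n)).
move: h; rewrite v_end {1}/hdot mulmx0 mxE => /esym/eqP.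
rewrite mulf_eq0 (negPf (vv_neq0 (leqnn n))) orbF one_sub_normC fmorph_eq0 subr_eq0.
move=> /eqP ->; congr (absq (alpha _)); exact/val_inj.
Qed.

End Cyclic.
End VerblunskyCoefficients.

(** * Path vertices, transfer matrices and the discriminant *)

Section Transfer.
Context {R : realType}.
Local Notation C := R[i].

Section PathVertices.
Variable a : nat -> C.

(* The product of the first k matrices is [[conj d, c], [conj c, d]] with
   (c, d) = su_entries k. *)
Fixpoint su_entries (k : nat) : C * C :=
  if k is k'.+1 then
    let: (c, d) := su_entries k' in
    (Num.conj d * Num.conj (a k') + c, Num.conj c * Num.conj (a k') + d)
  else (0, 1).

Definition su_matrix (k : nat) : 'M[C]_2 :=
  let: (c, d) := su_entries k in mx2 (Num.conj d) c (Num.conj c) d.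

Lemma su_matrixS k :
  su_matrix k.+1 = su_matrix k *m mx2 1 (Num.conj (a k)) (a k) 1.
Proof.
rewrite /su_matrix /=; case: (su_entries k) => c d; rewrite mx2_mul.
by congr mx2; rewrite ?rmorphD ?rmorphM /= ?conjCK; ring.
Qed.

(** The gap is the determinant of [su_matrix], and [1 - absq (a k)] that of the new factor. *)
Lemma su_gapS k :
  absq (su_entries k.+1).2 - absq (su_entries k.+1).1 =
  (absq (su_entries k).2 - absq (su_entries k).1) * (1 - absq (a k)).
Proof.
rewrite /=; case: (su_entries k) => c d /=; rewrite /absq.
by rewrite !ReD !ImD !ReM !ImM !ReJ !ImJ; ring.
Qed.

Lemma su_gap_gt0 k : (forall j, (j < k)%N -> absq (a j) < 1) ->
  absq (su_entries k).1 < absq (su_entries k).2.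
Proof.
rewrite -subr_gt0; elim: k => [|k IH] ak; first by rewrite /absq /= expr1n expr0n /= !addr0 subr0.
rewrite su_gapS mulr_gt0 ?subr_gt0 ?ak// -subr_gt0; apply: IH => j jk.
by apply: ak; exact: leqW.
Qed.

Lemma absq_gt0_neq0 (x : C) : 0 < absq x -> x != 0.
Proof. by apply: contraTneq => ->; rewrite /absq /= expr0n addr0 ltxx. Qed.

Lemma su_entry_neq0 k : (forall j, (j < k)%N -> absq (a j) < 1) ->
  (su_entries k).2 != 0.
Proof. by move=> /su_gap_gt0 h; apply/absq_gt0_neq0/(le_lt_trans _ h)/absq_ge0. Qed.

Lemma absq_div (x y : C) : y != 0 -> absq (x / y) * absq y = absq x.
Proof. by move=> y0; rewrite -absqM divfK. Qed.

Lemma su_ratio_lt1 k : (forall j, (j < k)%N -> absq (a j) < 1) ->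
  absq ((su_entries k).1 / (su_entries k).2) < 1.
Proof.
move=> ak; have h := su_gap_gt0 ak; have d0 := su_entry_neq0 ak.
have dp : 0 < absq (su_entries k).2 by apply: le_lt_trans h; exact: absq_ge0.
by rewrite -(ltr_pM2r dp) mul1r absq_div.
Qed.

(** The last determinant is zero and cannot exclude a vanishing denominator; such a zero would
    instead force [|c| = |d|] one index earlier, where the gap is positive. Thus [b(1)] is a genuine
    quotient and not the default value of a division by 0. *)
Lemma su_last_neq0 k : (forall j, (j < k)%N -> absq (a j) < 1) -> absq (a k) = 1 ->
  (su_entries k.+1).2 != 0.
Proof.
move=> ak a1; have := su_gap_gt0 ak; rewrite /=; case: (su_entries k) => c d /= h.
apply/eqP => /eqP; rewrite addr_eq0 => /eqP E.
move: h; suff -> : absq c = absq d by rewrite ltxx.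
have := congr1 absq E; rewrite absqM !absqJ a1 mulr1 => ->.
by rewrite /absq ReN ImN !sqrrN.
Qed.

Lemma su_ratio_last k : (forall j, (j < k)%N -> absq (a j) < 1) -> absq (a k) = 1 ->
  absq ((su_entries k.+1).1 / (su_entries k.+1).2) = 1.
Proof.
move=> ak a1; have d0 := su_last_neq0 ak a1.
have /eqP := su_gapS k; rewrite a1 subrr mulr0 subr_eq0 => /eqP E.
have dp : absq (su_entries k.+1).2 != 0.
  by apply: contra d0 => /eqP/absq_eq0 ->.
by apply: (mulIf dp); rewrite absq_div// mul1r.
Qed.

End PathVertices.

Lemma bvertex_su n (alpha : 'I_n.+1 -> C) k : (k <= n.+1)%N ->
  bvertex alpha k =
  (su_entries (alpha \o inord) k).1 / (su_entries (alpha \o inord) k).2.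
Proof.
move=> kn; rewrite /bvertex.
have -> : \prod_(j < n.+1 | (j < k)%N) mx2 1 ((alpha j)^*) (alpha j) 1 =
    su_matrix (alpha \o inord) k.
  (* [inord] extends the coefficients to all indices, so that the product can be treated by
     recursion on [k]. *)
  transitivity (\prod_(j < k) mx2 1 (Num.conj (alpha (inord j))) (alpha (inord j)) 1).
    rewrite (big_ord_widen _ (fun j => mx2 1 (Num.conj (alpha (inord j))) (alpha (inord j)) 1) kn).
    by apply: eq_bigr => j _; rewrite inord_val.
  elim: k {kn} => [|k IH].
    by rewrite big_ord0 /su_matrix /= rmorph0 rmorph1 mx2_1.
  by rewrite big_ord_recr /= IH su_matrixS.
rewrite /su_matrix; case: (su_entries _ k) => c d; rewrite mx2_mul_cv /proj_ratio !mxE /=.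
by rewrite !mulr0 !add0r !mulr1.
Qed.

(** [Q_(n+1)] is singular, so the end condition cannot be pulled back through it. Its ratio of
    entries is instead tested against [Q_n], and what remains is [u1 - conj al u2], the first row of
    the last recursion step. *)
Lemma end_form_su (c d al u1 u2 : C) :
  Num.conj c * Num.conj al + d != 0 ->
  end_form ((Num.conj d * Num.conj al + c) / (Num.conj c * Num.conj al + d))
    (mx2 (Num.conj d) c (Num.conj c) d *m cv2 u1 u2) =
  (absq d - absq c)%:C%C / (Num.conj c * Num.conj al + d) * (u1 - Num.conj al * u2).
Proof.
move=> d0; rewrite mx2_mul_cv /end_form !mxE /= rmorphB /=.
by rewrite -!normC_sqr -!conj_mul_normC; field.
Qed.

Section Discriminant.
Variables (n : nat) (alpha : 'I_n.+1 -> C) (Phi : nat -> {poly C}).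
Hypothesis alpha_lt1 : forall k : 'I_n.+1, (k < n)%N -> absq (alpha k) < 1.
Hypothesis alpha_last : absq (alpha ord_max) = 1.
Hypothesis Phi0 : Phi 0%N = 1.
Hypothesis alphaP : forall k : 'I_n.+1,
  Phi k.+1 = 'X * Phi k - ((alpha k)^*)%:P * revpoly k (Phi k) /\
  revpoly k.+1 (Phi k.+1) = - (alpha k)%:P * ('X * Phi k) + revpoly k (Phi k).
Let a := alpha \o inord.
Let beta := bvertex alpha.

Let a_lt1 j : (j < n)%N -> absq (a j) < 1.
Proof. by move=> jn; apply: alpha_lt1; rewrite inordK// leqW. Qed.

Let a_last : absq (a n) = 1.
Proof. by rewrite -alpha_last /a /=; congr (absq (alpha _)); apply: val_inj; rewrite /= inordK. Qed.

Lemma bvertex_lt1 k : (k < n.+1)%N -> absq (bvertex alpha k) < 1.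
Proof.
move=> kn; rewrite (bvertex_su _ (ltnW kn)); apply: (@su_ratio_lt1 a) => j jk.
by apply: a_lt1; exact: leq_trans jk kn.
Qed.

Lemma bvertex_last : absq (bvertex alpha n.+1) = 1.
Proof. by rewrite (bvertex_su _ (leqnn _)); exact: su_ratio_last a_lt1 a_last. Qed.

Variable z : C.
Let u : C := cexp (z * 'i / 2) n.+1%:R^-1.
Let u' : C := cexp (- (z * 'i / 2)) n.+1%:R^-1.
(** The number e^(iz/(n+1)); extracting the scalar [u'] from the exponential leaves diag(x, 1), the
    diagonal factor of the recursion. *)
Let x : C := u * u.
Let S k : 'cV[C]_2 := cv2 (Phi k).[x] (revpoly k (Phi k)).[x].
Let Q := su_matrix a.

Let u'0 : u' != 0. Proof. exact: cexp_neq0. Qed.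

Let emat_x : emat z n.+1%:R^-1 = u' *: mx2 x 0 0 1.
Proof. by rewrite mx2_scale /emat -/u -/u' !mulr0 mulr1 /x mulrA cexpN mul1r. Qed.

(** [Q k] is [tmat (beta k)] times a diagonal matrix, which commutes with diag(x, 1); conjugation by
    [Q k] and by [tmat (beta k)] therefore agree. *)
Let pieceQ k : (k < n.+1)%N ->
  propagator_piece n.+1 beta z k 1 *m Q k = u' *: (Q k *m mx2 x 0 0 1).
Proof.
move=> kn; rewrite (propagator_piece1 (ltn0Sn n) beta z kn).
have [D QD DE] : exists2 D, Q k = tmat (beta k) *m D & D *m mx2 x 0 0 1 = mx2 x 0 0 1 *m D.
  have ak j : (j < k)%N -> absq (a j) < 1.
    by move=> jk; apply: a_lt1; exact: leq_trans jk kn.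
  have d0 := su_entry_neq0 ak.
  exists (mx2 (Num.conj (su_entries a k).2) 0 0 (su_entries a k).2).
    rewrite /beta (bvertex_su _ (ltnW kn)) /Q /su_matrix mx2_mul -/a.
    move: d0; case: (su_entries a k) => c d /= d0; rewrite !(mulr0, mul1r, addr0, add0r).
    by rewrite divfK// rmorphM fmorphV /= divfK// conjC_eq0.
  by rewrite !mx2_mul; congr mx2; ring.
rewrite QD -!mulmxA [tinv _ *m _]mulmxA (mulmx1C (tmatK (bvertex_lt1 kn))) mul1mx.
by rewrite emat_x -scalemxAl -DE -!scalemxAr.
Qed.

Let S_step (k : 'I_n.+1) : (mx2 1 (- Num.conj (alpha k)) (- alpha k) 1 *m
  (mx2 x 0 0 1 *m S k)) = S k.+1.
Proof.
have [E1 E2] := alphaP k; rewrite /S E2 E1 !mx2_mul_cv !(hornerD, hornerN, hornerM, hornerX, hornerC).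
by congr cv2; ring.
Qed.

Let propagatorQ k : (k <= n)%N -> exists2 s : C, s != 0 &
  propagator n.+1 beta z k 1 *m cv2 1 1 = s *: (Q k *m S k).
Proof.
elim: k => [|k IH] kn.
  exists 1; first exact: oner_neq0.
  rewrite mul1mx scale1r /Q /su_matrix /= rmorph0 rmorph1 mx2_1 mul1mx.
  by rewrite /S Phi0 revpoly1 !hornerE.
have [s s0 sE] := IH (ltnW kn).
have kn' : (k < n.+1)%N by exact: leqW.
have a1 := one_sub_normC_neq0 (a_lt1 kn).
(* The denominator is the determinant of the factor leading from [Q k] to [Q k.+1]; it is nonzero
   for [k < n] and zero for [k = n], so the induction stops at [n]. *)
exists (s * u' / (1 - `|a k| ^+ 2)).
  by rewrite !mulf_neq0 ?invr_neq0.
rewrite /= -mulmxA sE -scalemxAr mulmxA pieceQ// -scalemxAl scalerA -mulmxA.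
rewrite -(S_step (Ordinal kn')) /Q su_matrixS -!mulmxA.
have <- : a k = alpha (Ordinal kn') by congr alpha; apply: val_inj; rewrite /= inordK.
have MM : mx2 1 (Num.conj (a k)) (a k) 1 *m mx2 1 (- Num.conj (a k)) (- a k) 1 =
    (1 - `|a k| ^+ 2) *: 1%:M.
  rewrite mx2_mul -mx2_1 mx2_scale -conj_mul_normC; congr mx2; ring.
rewrite [mx2 1 (Num.conj (a k)) (a k) 1 *m _]mulmxA MM -scalemxAl mul1mx -scalemxAr scalerA.
by rewrite divfK.
Qed.

Lemma discriminant_szego : exists2 s : C, s != 0 &
  discriminant n.+1 (bvertex alpha) z = s * (Phi n.+1).[x].
Proof.
have [s s0 sE] := propagatorQ (leqnn n).
have g := su_gap_gt0 a_lt1; have d0 := su_last_neq0 a_lt1 a_last.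
have gC : absq (su_entries a n).2 - absq (su_entries a n).1 != 0.
  by rewrite subr_eq0 gt_eqF.
exists (s * u' * ((absq (su_entries a n).2 - absq (su_entries a n).1)%:C%C / (su_entries a n.+1).2)).
  by rewrite !mulf_neq0 ?invr_neq0// fmorph_eq0.
rewrite /discriminant /= -mulmxA sE -scalemxAr mulmxA pieceQ// -scalemxAl scalerA -mulmxA.
rewrite end_formZ -mulrA; congr (_ * _).
have [-> _] := alphaP ord_max.
rewrite (bvertex_su _ (leqnn _)) -/a hornerD hornerN !hornerM hornerX hornerC.
have <- : a n = alpha ord_max by congr alpha; apply: val_inj; rewrite /= inordK.
rewrite /S mx2_mul_cv !mul0r addr0 add0r mul1r.
move: d0; rewrite /Q /su_matrix /=; case: (su_entries a n) => c d; exact: end_form_su.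
Qed.

End Discriminant.

End Transfer.

(** * The spectrum *)

Section SpectrumOfTau.
Context {R : realType}.
Local Notation C := R[i].
Local Notation Re := (@complex.Re R).
Local Notation Im := (@complex.Im R).

Lemma cos_sin_period (m : nat) :
  cos (2 * pi * m%:R : R) = 1 /\ sin (2 * pi * m%:R : R) = 0.
Proof.
elim: m => [|m [c s]]; first by rewrite mulr0 cos0 sin0.
rewrite -[m.+1%:R]natr1 mulrDr mulr1 cosD sinD c s.
have -> : 2 * pi = pi *+ 2 :> R by rewrite mulr_natl.
rewrite cos2pi sin2pi; by rewrite !(mul0r, mulr0, mulr1) subr0 addr0.
Qed.

Lemma expi_period (t : R) (j : int) : expi (t + 2 * pi * j%:~R) = expi t.
Proof.
have [c s] : cos (2 * pi * j%:~R : R) = 1 /\ sin (2 * pi * j%:~R : R) = 0.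
  case: j => m; first exact: cos_sin_period.
  rewrite NegzE mulrNz mulrN cosN sinN; have [-> ->] := cos_sin_period m.+1.
  by rewrite oppr0.
by rewrite /expi cosD sinD c s !mulr1 !mulr0 subr0 addr0.
Qed.

(** Subtracting a multiple of [2 * pi] leaves [r] in [[0, 2 pi)] with [cos r = 1]. By the half angle
    formula [sin (r / 2)] is 0, and [r / 2] lies in [[0, pi)], so [r = 0]. *)
Lemma expi_inj_mod (s t : R) : expi s = expi t -> exists j : int, s = t + 2 * pi * j%:~R.
Proof.
move=> /eqP; rewrite eq_complex /= => /andP[/eqP cE /eqP sE].
have pi0 := @pi_gt0 R; have p2 : 0 < 2 * pi :> R by rewrite mulr_gt0.
set j := Num.floor ((s - t) / (2 * pi)); exists j.
pose r := s - t - 2 * pi * j%:~R.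
have r0 : 0 <= r < 2 * pi.
  have h1 : j%:~R <= (s - t) / (2 * pi) := floor_le _.
  have h2 : (s - t) / (2 * pi) < j%:~R + 1.
    by have := floorD1_gt ((s - t) / (2 * pi)); rewrite intrD.
  move: h1 h2; rewrite ler_pdivlMr// ltr_pdivrMr// /r; lra.
have sE' : s = t + r + 2 * pi * j%:~R by rewrite /r; ring.
suff r1 : r = 0 by rewrite {1}sE' r1 addr0.
have cr : cos r = 1.
  have := expi_period (t + r) j; rewrite -sE' => /eqP; rewrite eq_complex /= => /andP[/eqP c1 /eqP s1].
  have -> : r = (t + r) - t by ring.
  by rewrite cosB -c1 -s1 cE sE -!expr2 cos2Dsin2.
have [->//|rp] := eqVneq r 0.
have : 0 < sin (r / 2).
  have r0' : 0 < r by rewrite lt0r rp; case/andP: r0.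
  by apply: sin_gt0_pi; rewrite divr_gt0// ltr_pdivrMr// mulrC; case/andP: r0.
have := cos2Dsin2 (r / 2); have : r = r / 2 + r / 2 by field.
move=> rE; move: cr; rewrite {1}rE cosD; nra.
Qed.

Lemma cexp_sq (z : C) (n : nat) :
  cexp (z * 'i / 2) n%:R^-1 * cexp (z * 'i / 2) n%:R^-1 = cexp (z * 'i) n%:R^-1.
Proof. by rewrite -cexpD -splitr. Qed.

Lemma cexp_eq_expi (z : C) (n : nat) (t : R) : (0 < n)%N ->
  cexp (z * 'i) n%:R^-1 = expi t <->
  exists j : int, z = (n%:R * t + 2 * pi * n%:R * j%:~R)%:C%C.
Proof.
move=> n0; have n0' : n%:R != 0 :> R by rewrite pnatr_eq0 -lt0n.
have ReE : Re (z * 'i) = - Im z by rewrite ReM /= mulr0 mulr1 sub0r.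
have ImE : Im (z * 'i) = Re z by rewrite ImM /= mulr0 mulr1 addr0.
rewrite /cexp ReE ImE; split=> [E|[j zE]].
  (* Comparing moduli makes the square of this exponential 1, which forces [z] to be real. *)
  have e1 : expR (- Im z * n%:R^-1) = 1.
    have := congr1 absq E; rewrite /absq /= cos2Dsin2 !exprMn -mulrDr cos2Dsin2 mulr1.
    by move=> /eqP; rewrite -subr_eq0 subr_sqr_1 mulf_eq0 => /orP[|]; rewrite ?subr_eq0; [move/eqP|rewrite gt_eqF// addr_gt0// expR_gt0].
  have Im0 : Im z = 0.
    have /eqP := expR_inj (etrans e1 (esym (expR0 R))).
    by rewrite mulf_eq0 invr_eq0 (negPf n0') orbF oppr_eq0 => /eqP.
  have : expi (Re z / n%:R) = expi t by rewrite -E e1 !mul1r.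
  move=> /expi_inj_mod[j jE]; exists j; apply: complex_eqP => //=.
  rewrite -[LHS](divfK n0') jE; ring.
rewrite zE /= oppr0 mul0r expR0 !mul1r -(expi_period t j) /expi.
by have -> : (n%:R * t + 2 * pi * n%:R * j%:~R) / n%:R = t + 2 * pi * j%:~R by field.
Qed.

End SpectrumOfTau.

Lemma discriminant_eq0 (R : realType) (n : nat) (V : 'M[R[i]]_n.+1)
    (lam : 'I_n.+1 -> R) (alpha : 'I_n.+1 -> R[i]) (Phi : nat -> {poly R[i]}) (z : R[i]) :
  (forall x : R[i], eigenvalue V x <-> exists k, x = expi (lam k)) ->
  (forall k : 'I_n.+1, (k < n)%N -> absq (alpha k) < 1) ->
  absq (alpha ord_max) = 1 -> Phi 0%N = 1 -> Phi n.+1 = char_poly V ->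
  (forall k : 'I_n.+1,
    Phi k.+1 = 'X * Phi k - (Num.conj (alpha k))%:P * revpoly k (Phi k) /\
    revpoly k.+1 (Phi k.+1) =
      - (alpha k)%:P * ('X * Phi k) + revpoly k (Phi k)) ->
  discriminant n.+1 (bvertex alpha) z = 0 <->
  exists (k : 'I_n.+1) (j : int),
    z = (n.+1%:R * lam k + 2 * pi * n.+1%:R * j%:~R)%:C%C.
Proof.
move=> eigP a1 alast Phi0 PhiN alphaP.
have [s s0 ->] := discriminant_szego a1 alast Phi0 alphaP z.
rewrite cexp_sq PhiN; split=> [/eqP|[k [j zE]]].
  rewrite mulf_eq0 (negPf s0) /= -[_ == 0]/(root _ _) -eigenvalue_root_char.
  by move=> /eigP[k /cexp_eq_expi-/(_ (ltn0Sn n))[j zE]]; exists k, j.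
have /eigP : exists k, cexp (z * 'i) n.+1%:R^-1 = expi (lam k).
  by exists k; apply/cexp_eq_expi => //; exists j.
by rewrite eigenvalue_root_char => /eqP ->; rewrite mulr0.
Qed.

Theorem proposition16 (R : realType) (n : nat) (V : 'M[R[i]]_n)
    (e : 'cV[R[i]]_n) (lam : 'I_n -> R) (alpha : 'I_n -> R[i])
    (V_unitary : V \is unitarymx)
    (eig_distinct : injective (fun k => expi (lam k)))
    (eigP : forall z : R[i], eigenvalue V z <-> exists k, z = expi (lam k))
    (e_unit : hdot e e = 1)
    (e_cyclic : forall (v : 'cV[R[i]]_n) (z : R[i]),
       v != 0 -> V *m v = z *: v -> hdot e v != 0)
    (alphaP : is_verblunsky V e alpha) :
  let b := bpath alpha in
  [/\ forall t : R, 0 <= t < 1 -> `|b t| < 1,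
      `|b 1| = 1,
      self_adjoint (L2W b) (ipW b) (dirac_op b)
    & spectrum (L2W b) (ipW b) (dirac_op b) =
        [set z : R[i] | exists (k : 'I_n) (j : int),
           z = (n%:R * lam k + 2 * pi * n%:R * j%:~R)%:C%C] ].

Proof.
case: n V e lam alpha V_unitary eig_distinct eigP e_unit e_cyclic alphaP
  => [|n] V e lam alpha Vu eig_inj eigP e1 e_cyc [Phi PhiP alphaP].
  (* A unit vector excludes dimension 0. *)
  move: e1; rewrite /hdot mxE big_ord0 => /eqP.
  by rewrite eq_sym oner_eq0.
have a1 := verblunsky_lt1 Vu eig_inj eigP e_cyc PhiP alphaP.
have alast := verblunsky_last Vu eig_inj eigP e_cyc PhiP alphaP.
have [Phi0 _ _ PhiN] := PhiP.
have b1 := bvertex_lt1 a1; have blast := bvertex_last a1 alast.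
have disc z := discriminant_eq0 z eigP a1 alast Phi0 PhiN alphaP.
(* All zeros of the discriminant are real, so it is nonzero at ['i] and [- 'i], as the adjoint
   argument requires. *)
have disc_im z : complex.Im z != 0 -> discriminant n.+1 (bvertex alpha) z != 0.
  by move=> zi; apply/eqP => /disc[k [j zE]]; move: zi; rewrite zE eqxx.
have n0 := ltn0Sn n.
have Im1 : complex.Im ('i : R[i]) != 0 by exact: oner_neq0.
have ImN1 : complex.Im (- 'i : R[i]) != 0 by rewrite ImN oppr_eq0.
split.
- by move=> t t01; rewrite normC_lt1; apply: (step_absq_lt1 n0 b1); rewrite /= in_itv.
- by apply: normC_eq1; rewrite /bpath mulr1 natrK.
- split; first exact: (dirac_op_densely_defined n0 b1).
  exact: (dirac_op_adjoint n0 b1 blast (disc_im _ Im1) (disc_im _ ImN1)).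
- apply/seteqP; split=> z.
    move=> nz; apply/disc/eqP; apply: contra_notT nz.
    exact: dirac_op_resolvent.
  by move=> /disc; exact: dirac_op_eigenvalue.
Qed.
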